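(* Let $G$ be a block graph that is a VPG graph. Then $G$ is $B_0$-VPG if and only if $G$ is $\mathcal{F}$-free. Moreover, the graphs of $\mathcal{F}$ are minimal not $B_0$-VPG, i.e. each graph in $\mathcal{F}$ is not $B_0$-VPG, while every proper induced subgraph of it is $B_0$-VPG.
   Context: All graphs are finite and simple. A block graph is a connected graph in which every two-connected component (block) is a clique, i.e. every block is complete (bridges count as blocks of size 2). A cutpoint is a vertex whose removal increases the number of connected components. An endblock is a block having exactly one cutpoint. A 2-cutpoint is a cutpoint that belongs to exactly 2 blocks, one of which is an endblock. A VPG representation of a graph $G$ is a collection of paths of the two-dimensional grid, one path $P_v$ for each vertex $v$ of $G$, such that two vertices are adjacent in $G$ if and only if the corresponding paths share at least one vertex of the grid (a path may consist of a single grid vertex). A graph having such a representation is a VPG graph. A $B_0$-VPG representation is a VPG representation in which each path is either a horizontal path or a vertical path on the grid; a graph is a $B_0$-VPG graph if it has a $B_0$-VPG representation. The thin spider $N_n$ is the graph whose $2n$ vertices are partitioned into a clique $\{c_1,\dots,c_n\}$ and a set $\{s_1,\dots,s_n\}$ of pairwise nonadjacent vertices such that $s_i$ is adjacent to $c_j$ if and only if $i=j$; it is called the thin spider of size $n$. $\mathcal{F}$ is the family of block graphs obtained from $N_5$ by a finite (possibly empty) sequence of applications of the following procedure to the current graph $G$: let $H$ be a complete subgraph of size 4 in $G$ having at least two 2-cutpoints (of $G$), say $v_1$ and $v_2$, with endblocks $B_1\ni v_1$ and $B_2\ni v_2$. Contract $v_1$ and $v_2$ into a single vertex $x$. Then replace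 $B_1-\{x\}$ and $B_2-\{x\}$ (i.e. the vertices of $B_1$ other than $v_1$ and of $B_2$ other than $v_2$) by two disjoint thin spiders of size 3, making $x$ adjacent to the three clique vertices $c_1,c_2,c_3$ of each of the two spiders (and to no other vertices of the spiders). A graph is $\mathcal{F}$-free if it contains no induced subgraph isomorphic to a member of $\mathcal{F}$. *)

(* Defs.v *)
From HB Require Import structures.
From mathcomp Require Import all_boot all_order all_algebra.

Set Implicit Arguments.
Unset Strict Implicit.
Unset Printing Implicit Defensive.

Record sgraph := SGraph {
  svertex :> finType;
  sedge : rel svertex;
  sedge_sym : symmetric sedge;
  sedge_irrefl : irreflexive sedge
}.

Section Induced.
Variables (G : sgraph) (S : {set G}).

Definition induced_edge : rel {x : G | x \in S} :=
  fun x y => sedge (val x) (val y).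

Lemma induced_edge_sym : symmetric induced_edge.
Proof. by move=> x y; rewrite /induced_edge sedge_sym. Qed.

Lemma induced_edge_irrefl : irreflexive induced_edge.
Proof. by move=> x; rewrite /induced_edge sedge_irrefl. Qed.

Definition induced : sgraph := SGraph induced_edge_sym induced_edge_irrefl.
End Induced.

Definition isomorphic (G H : sgraph) : Prop :=
  exists2 f : G -> H, bijective f & forall x y, sedge (f x) (f y) = sedge x y.

Definition clique (G : sgraph) (A : {set G}) : bool :=
  [forall x in A, forall y in A, (x != y) ==> sedge x y].

Definition connected (G : sgraph) : bool :=
  [forall x : G, forall y : G, connect (@sedge G) x y].

Definition ncomponents (G : sgraph) : nat := n_comp (@sedge G) G.

Definition cutpoint (G : sgraph) (v : G) : bool :=
  ncomponents G < ncomponents (induced [set~ v]).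

(* Blocks are represented by their vertex sets, since a block is always an
   induced subgraph.  Nonseparability refers to the cutpoints of the subgraph
   induced by B, so that bridges are blocks of size 2. *)
Definition nonseparable (G : sgraph) (B : {set G}) : bool :=
  connected (induced B) && [forall v : induced B, ~~ cutpoint v].

Definition block (G : sgraph) (B : {set G}) : bool :=
  maxset (@nonseparable G) B.

Definition block_graph (G : sgraph) : Prop :=
  connected G /\ forall B : {set G}, block B -> clique B.

(* The cutpoints counted here are those of G, not of the subgraph induced
   by B (which has none). *)
Definition endblock (G : sgraph) (B : {set G}) : bool :=
  block B && (#|[set v in B | cutpoint v]| == 1).

Definition two_cutpoint (G : sgraph) (v : G) : bool :=
  [&& cutpoint v,
      #|[set B : {set G} | block B & v \in B]| == 2
    & [exists B : {set G}, endblock B && (v \in B)]].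

Definition gridpoint : Type := (int * int)%type.

Definition grid_adj : rel gridpoint :=
  fun p q => `|p.1 - q.1| + `|p.2 - q.2| == 1.

Definition grid_path (s : seq gridpoint) : bool :=
  [&& s != [::], sorted grid_adj s & uniq s].

Definition horizontal (s : seq gridpoint) : Prop :=
  exists y : int, forall p, p \in s -> p.2 = y.

Definition vertical (s : seq gridpoint) : Prop :=
  exists x : int, forall p, p \in s -> p.1 = x.

Definition VPG_rep (G : sgraph) (P : G -> seq gridpoint) : Prop :=
  (forall v, grid_path (P v)) /\
  (forall u v, u != v ->
     (sedge u v <-> exists p, p \in P u /\ p \in P v)).

Definition VPG (G : sgraph) : Prop :=
  exists P : G -> seq gridpoint, VPG_rep P.

Definition B0_VPG (G : sgraph) : Prop :=
  exists P : G -> seq gridpoint,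
    VPG_rep P /\ forall v, horizontal (P v) \/ vertical (P v).

Section ThinSpider.
Variable n : nat.

(* [inl i] is the clique vertex c_i and [inr i] the vertex s_i. *)
Definition spider_edge : rel ('I_n + 'I_n) := fun x y =>
  match x, y with
  | inl i, inl j => i != j
  | inl i, inr j => i == j
  | inr i, inl j => i == j
  | inr _, inr _ => false
  end.

Lemma spider_edge_sym : symmetric spider_edge.
Proof. by move=> [i|i] [j|j] //=; rewrite eq_sym. Qed.

Lemma spider_edge_irrefl : irreflexive spider_edge.
Proof. by move=> [i|i] //=; rewrite eqxx. Qed.

Definition thin_spider : sgraph := SGraph spider_edge_sym spider_edge_irrefl.
End ThinSpider.

Section SpiderReplace.
Variables (G : sgraph) (v1 v2 : G) (B1 B2 : {set G}).

(* Contraction of v1 and v2, where v1 is kept as the contracted vertex x. *)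
Definition contract_edge : rel G := fun u w =>
  (u != w) &&
  [|| sedge u w, (u == v1) && sedge v2 w | (w == v1) && sedge u v2].

Definition kept : {set G} :=
  ~: (v2 |: ((B1 :\ v1) :|: (B2 :\ v2))).

(* [inr (b, a)] is the vertex a of the b-th of the two new spiders. *)
Definition replace_edge : rel ({u : G | u \in kept} + bool * thin_spider 3) :=
  fun x y =>
  match x, y with
  | inl u, inl w => contract_edge (val u) (val w)
  | inl u, inr (_, inl _) => val u == v1
  | inr (_, inl _), inl u => val u == v1
  | inr (b, a), inr (b', a') => (b == b') && sedge a a'
  | _, _ => false
  end.

Lemma replace_edge_sym : symmetric replace_edge.
Proof.
move=> [u|[b [i|i]]] [w|[b' [j|j]]] //=; last 4 first.
- by rewrite eq_sym [i == j]eq_sym.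
- by rewrite eq_sym [i == j]eq_sym.
- by rewrite eq_sym [i == j]eq_sym.
- by rewrite eq_sym.
rewrite /contract_edge eq_sym (sedge_sym (val u) (val w)).
rewrite (sedge_sym v2 (val w)) (sedge_sym (val u) v2).
by congr (_ && (_ || _)); rewrite orbC.
Qed.

Lemma replace_edge_irrefl : irreflexive replace_edge.
Proof.
move=> [u|[b [i|i]]] /=; first by rewrite /contract_edge eqxx.
- by rewrite !eqxx.
- by rewrite eqxx.
Qed.

Definition spider_replace : sgraph :=
  SGraph replace_edge_sym replace_edge_irrefl.
End SpiderReplace.

(* Members of the family are represented up to isomorphism. *)
Inductive family_F : sgraph -> Prop :=
| family_F_base : family_F (thin_spider 5)
| family_F_step (G : sgraph) (H : {set G}) (v1 v2 : G) (B1 B2 : {set G}) :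
    family_F G ->
    clique H -> #|H| = 4 ->
    v1 \in H -> v2 \in H -> v1 != v2 ->
    two_cutpoint v1 -> two_cutpoint v2 ->
    endblock B1 -> v1 \in B1 ->
    endblock B2 -> v2 \in B2 ->
    family_F (spider_replace v1 v2 B1 B2).

Definition F_free (G : sgraph) : Prop :=
  forall (F : sgraph) (S : {set G}), family_F F -> ~ isomorphic (induced S) F.

(* Main.v *)
Require Import Defs.
From HB Require Import structures.
From mathcomp Require Import all_boot all_order all_algebra zify.

Set Implicit Arguments.
Unset Strict Implicit.
Unset Printing Implicit Defensive.

(** In a representation by horizontal and vertical segments, the members of a
    clique pass through a common point (Helly property, [rep_helly]), and the
    points of different blocks are different.  Of the four directions at the
    point of a block, each can be used by only one cutpoint of the block to
    reach its other blocks: of two segments that leave the point in the same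
    direction and meet further segments there, the longer one meets those of
    the other ([dir_neq]).  The points of the blocks at a cutpoint lie on its
    segment, and at all of them but the first and the last the cutpoint uses
    two directions.  Hence a block has at most four cutpoints; a block with four
    cutpoints lies at an end of each of their segments; in a block with three
    cutpoints at most one of the segments passes through.

    These constraints propagate through the tree of blocks.  Call a block at a
    vertex [v] forced if it has to lie at an end of the segment of [v]: it has
    three cutpoints besides [v], or two, at one of which there hang two forced
    blocks, so that this cutpoint has to pass through.  A graph is obstructed
    when five cutpoints share a block or three forced blocks share a vertex.
    For connected block graphs these are the only reasons not to be B0-VPG, and
    the smallest obstructed graphs are the members of the family.

    To make this precise, rooted graphs are described by terms ([plan],
    [realizes]) built from single vertices by joining roots; a plan determines
    a graph up to isomorphism ([realizes_iso]), and [obstruction] selects the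
    plans of the smallest obstructed graphs.  The proof has four parts.

    - No graph that realizes an obstruction has a representation
      ([obstruction_norep]), by the counting of directions above.

    - When a vertex is deleted from an obstruction, the blocks that needed it to
      be forced no longer are, and the rest can be drawn ([obstruction_del]).

    - A connected graph in which every cycle is a clique and which realizes no
      obstruction can be drawn ([noobs_rep]): it is cut into pieces hanging at
      a vertex or at a block, and each piece has either a drawing of the best
      possible kind or an induced subgraph that excludes it ([vstatus],
      [qstatus]).

    - Up to isomorphism, the members of the family are the graphs that realize
      obstructions ([obstruction_in_family], [family_obstruction]).  A cherry of
      three forced blocks amounts to a ternary tree without a distinguished
      root, whose leaves are blocks with four cutpoints; the replacement procedure
      turns such a leaf into an inner node with two leaves.  Both inclusions
      move the root of the tree next to the leaf in question
      ([cherry_rot], [cherry_at_reroot]). *)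

(** * Connectivity inside a vertex set *)

Definition restr (G : sgraph) (S : {set G}) : rel G :=
  fun u w => [&& u \in S, w \in S & sedge u w].

Definition linked (G : sgraph) (S : {set G}) : rel G := connect (restr S).

Lemma restr_sym (G : sgraph) (S : {set G}) : symmetric (restr S).
Proof. by move=> u w; rewrite /restr sedge_sym andbCA. Qed.

Lemma linked_sym (G : sgraph) (S : {set G}) : symmetric (linked S).
Proof. exact: sym_connect_sym (restr_sym S). Qed.

Lemma linked_edge (G : sgraph) (S : {set G}) u w :
  u \in S -> w \in S -> sedge u w -> linked S u w.
Proof. by move=> uS wS e; apply: connect1; rewrite /restr uS wS. Qed.

Lemma linked_trans (G : sgraph) (S : {set G}) : transitive (linked S).
Proof. by move=> w u x; apply: connect_trans. Qed.

Lemma connect_ind (T : finType) (e : rel T) (P : T -> Prop) a b :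
  connect e a b -> P a -> (forall x y, P x -> e x y -> P y) -> P b.
Proof.
move=> /connectP[p ep ->] Pa step.
by elim: p a ep Pa => //= y p IH a /andP[eay ep] Pa; apply: IH => //; apply: step eay.
Qed.

Lemma linked_in (G : sgraph) (S : {set G}) u w :
  u \in S -> linked S u w -> w \in S.
Proof.
by move=> uS c; apply: (connect_ind (P := fun x => x \in S) c) => // x y _ /and3P[].
Qed.

Lemma linkedS (G : sgraph) (S T : {set G}) u w :
  S \subset T -> linked S u w -> linked T u w.
Proof.
move=> ST; apply: connect_sub => x y /and3P[xS yS e].
by apply: linked_edge e; apply: (subsetP ST).
Qed.

Lemma linked_setT (G : sgraph) (u w : G) :
  linked [set: G] u w = connect (@sedge G) u w.
Proof. by apply: eq_connect => x y; rewrite /restr !inE. Qed.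

(** Block graphs are assembled by gluing rooted pieces in this way: the new
    edges extend a clique of roots, or hang one at a single root.  Empty sets of
    roots express that there are no edges between the pieces. *)
Definition glue (G : sgraph) (S1 R1 S2 R2 : {set G}) : Prop :=
  [disjoint S1 & S2] /\
  {in S1 & S2, forall u w, sedge u w = (u \in R1) && (w \in R2)}.

Lemma glueC (G : sgraph) (S1 R1 S2 R2 : {set G}) :
  glue S1 R1 S2 R2 -> glue S2 R2 S1 R1.
Proof.
by case=> d e; split=> [|u w uS wS]; rewrite 1?disjoint_sym // sedge_sym e // andbC.
Qed.

Lemma glueUl (G : sgraph) (S1 R1 S2 R2 S R : {set G}) :
  R1 \subset S1 -> R2 \subset S2 -> [disjoint S1 & S2] ->
  glue (S1 :|: S2) (R1 :|: R2) S R <-> glue S1 R1 S R /\ glue S2 R2 S R.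
Proof.
move=> RS1 RS2 d; have d' u : u \in S1 -> u \in S2 -> False.
  by move=> u1 u2; have /pred0P/(_ u)/= := d; rewrite u1 u2.
split=> [[dd e] | [[d1 e1] [d2 e2]]].
  split; split.
  - by apply: disjointWl dd; apply: subsetUl.
  - move=> u w uS wS; rewrite e ?inE ?uS //; congr (_ && _).
    by case: (boolP (u \in R2)) => [/(subsetP RS2) /(d' u uS)|]; rewrite ?orbF.
  - by apply: disjointWl dd; apply: subsetUr.
  - move=> u w uS wS; rewrite e ?inE ?uS ?orbT //; congr (_ && _).
    by case: (boolP (u \in R1)) => [/(subsetP RS1) /(d' u)/(_ uS)|].
split; first by rewrite -setI_eq0 setIUl setU_eq0 !setI_eq0 d1.
move=> u w; rewrite !inE => /orP[uS|uS] wS.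
  rewrite e1 //; congr (_ && _).
  by case: (boolP (u \in R2)) => [/(subsetP RS2) /(d' u uS)|]; rewrite ?orbF.
rewrite e2 //; congr (_ && _).
by case: (boolP (u \in R1)) => [/(subsetP RS1) /(d' u)/(_ uS)|].
Qed.

Lemma glueUr (G : sgraph) (S1 R1 S2 R2 S R : {set G}) :
  R1 \subset S1 -> R2 \subset S2 -> [disjoint S1 & S2] ->
  glue S R (S1 :|: S2) (R1 :|: R2) <-> glue S R S1 R1 /\ glue S R S2 R2.
Proof.
move=> s1 s2 d; split=> [/glueC/glueUl[] // g1 g2 | [/glueC g1 /glueC g2]].
  by split; apply: glueC.
by apply: glueC; apply/glueUl.
Qed.

Lemma glueHl (G : sgraph) (S1 R1 S2 S R : {set G}) :
  R1 \subset S1 -> [disjoint S1 & S2] ->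
  glue (S1 :|: S2) R1 S R <-> glue S1 R1 S R /\ glue S2 set0 S R.
Proof. by move=> s1 d; rewrite -{1}[R1]setU0; apply: glueUl => //; apply: sub0set. Qed.

Lemma glueHr (G : sgraph) (S1 R1 S2 S R : {set G}) :
  R1 \subset S1 -> [disjoint S1 & S2] ->
  glue S R (S1 :|: S2) R1 <-> glue S R S1 R1 /\ glue S R S2 set0.
Proof. by move=> s1 d; rewrite -{1}[R1]setU0; apply: glueUr => //; apply: sub0set. Qed.

Lemma glue0 (G : sgraph) (S1 S2 R : {set G}) :
  glue S1 set0 S2 R <-> glue S1 set0 S2 set0.
Proof.
by split=> -[d e]; split=> // u w uS wS; rewrite e // inE.
Qed.

Lemma glueS (G : sgraph) (S1 R1 S2 R2 T1 T2 : {set G}) :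
  T1 \subset S1 -> T2 \subset S2 -> glue S1 R1 S2 R2 ->
  glue T1 (T1 :&: R1) T2 (T2 :&: R2).
Proof.
move=> s1 s2 [d e]; split; first exact: disjointW d.
by move=> u w uT wT; rewrite e ?(subsetP s1) ?(subsetP s2) // !inE uT wT.
Qed.

(** * Rooted block graphs *)

(** [Single] is a vertex that is its own root.  Both [Hang a q] and [Join a q]
    make all roots of [a] adjacent to all roots of [q]; [Hang a q] keeps the
    roots of [a] only (a block is hung at a cutpoint), [Join a q] keeps all of
    them (a block gets more vertices). *)
Inductive plan := Single | Hang of plan & plan | Join of plan & plan.

(** Sets of vertices of a given graph are used instead of a separate carrier, so
    that one can speak of the parts of a graph and of their mutual edges. *)
Fixpoint realizes (G : sgraph) (t : plan) (R S : {set G}) : Prop :=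
  match t with
  | Single => exists v, R = [set v] /\ S = [set v]
  | Hang a q => exists R1 S1 R2 S2, [/\ realizes a R1 S1, realizes q R2 S2,
      glue S1 R1 S2 R2, R = R1 & S = S1 :|: S2]
  | Join a q => exists R1 S1 R2 S2, [/\ realizes a R1 S1, realizes q R2 S2,
      glue S1 R1 S2 R2, R = R1 :|: R2 & S = S1 :|: S2]
  end.

Lemma realizes_sub (G : sgraph) t (R S : {set G}) :
  realizes t R S -> R \subset S.
Proof.
elim: t R S => [|a IHa q IHq|a IHa q IHq] R S /=.
- by case=> v [-> ->].
- case=> R1 [S1] [R2] [S2] [/IHa s1 _ _ -> ->].
  by apply: (subset_trans s1); apply: subsetUl.
- by case=> R1 [S1] [R2] [S2] [/IHa s1 /IHq s2 _ -> ->]; apply: setUSS.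
Qed.

Lemma realizes_root (G : sgraph) t (R S : {set G}) :
  realizes t R S -> exists v, v \in R.
Proof.
elim: t R S => [|a IHa q IHq|a IHa q IHq] R S /=.
- by case=> v [-> _]; exists v; rewrite inE.
- by case=> R1 [S1] [R2] [S2] [/IHa [v vR] _ _ -> _]; exists v.
- by case=> R1 [S1] [R2] [S2] [/IHa [v vR] _ _ -> _]; exists v; rewrite inE vR.
Qed.

Lemma glue_linked (G : sgraph) (S1 R1 S2 R2 : {set G}) r1 r2 :
  glue S1 R1 S2 R2 -> R1 \subset S1 -> R2 \subset S2 -> r1 \in R1 -> r2 \in R2 ->
  {in S1 &, forall u w, linked S1 u w} -> {in S2 &, forall u w, linked S2 u w} ->
  {in S1 :|: S2 &, forall u w, linked (S1 :|: S2) u w}.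
Proof.
move=> [_ g] s1 s2 r1R r2R c1 c2.
have r1S := subsetP s1 _ r1R; have r2S := subsetP s2 _ r2R.
have e : linked (S1 :|: S2) r1 r2.
  by apply: linked_edge; rewrite ?inE ?r1S ?r2S ?orbT // g // r1R.
have to u : u \in S1 :|: S2 -> linked (S1 :|: S2) u r1.
  rewrite inE => /orP[uS | uS].
    exact: (linkedS (subsetUl _ _) (c1 _ _ uS r1S)).
  apply: (linked_trans (linkedS (subsetUr _ _) (c2 _ _ uS r2S))).
  by rewrite linked_sym.
by move=> u w uS wS; apply: (linked_trans (to u uS)); rewrite linked_sym; apply: to.
Qed.

Lemma realizes_linked (G : sgraph) t (R S : {set G}) :
  realizes t R S -> {in S &, forall u w, linked S u w}.
Proof.
elim: t R S => [|a IHa q IHq|a IHa q IHq] R S /=.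
- by case=> v [_ ->] u w /set1P-> /set1P->; apply: connect0.
- case=> R1 [S1] [R2] [S2] [r1 r2 g _ ->].
  have [v1 v1R] := realizes_root r1; have [v2 v2R] := realizes_root r2.
  exact: (glue_linked g (realizes_sub r1) (realizes_sub r2) v1R v2R (IHa _ _ r1) (IHq _ _ r2)).
- case=> R1 [S1] [R2] [S2] [r1 r2 g _ ->].
  have [v1 v1R] := realizes_root r1; have [v2 v2R] := realizes_root r2.
  exact: (glue_linked g (realizes_sub r1) (realizes_sub r2) v1R v2R (IHa _ _ r1) (IHq _ _ r2)).
Qed.

Lemma joinC (G : sgraph) a q (R S : {set G}) :
  realizes (Join a q) R S -> realizes (Join q a) R S.
Proof.
case=> R1 [S1] [R2] [S2] [r1 r2 /glueC g -> ->].
by exists R2, S2, R1, S1; split; rewrite // setUC.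
Qed.

Lemma joinCA (G : sgraph) a b q (R S : {set G}) :
  realizes (Join a (Join b q)) R S -> realizes (Join b (Join a q)) R S.
Proof.
case=> R1 [S1] [_] [_] [r1 [R2 [S2 [R3 [S3 [r2 r3 g23 -> ->]]]]] g -> ->].
have [s1 s2 s3] := And3 (realizes_sub r1) (realizes_sub r2) (realizes_sub r3).
have /glueUr[//|//||g12 g13] := g; first by case: g23.
exists R2, S2, (R1 :|: R3), (S1 :|: S3); split; rewrite 1?setUCA //.
  by exists R1, S1, R3, S3.
by apply/glueUr => //; [case: g13 | split => //; apply: glueC].
Qed.

Lemma hangCA (G : sgraph) a b q (R S : {set G}) :
  realizes (Hang (Hang a b) q) R S -> realizes (Hang (Hang a q) b) R S.
Proof.
case=> [_] [_] [R3] [S3] [[R1 [S1 [R2 [S2 [r1 r2 g12 -> ->]]]]] r3 g -> ->].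
have [s1 s2 s3] := And3 (realizes_sub r1) (realizes_sub r2) (realizes_sub r3).
have /glueHl[//||g13 g23] := g; first by case: g12.
exists R1, (S1 :|: S3), R2, S2; split; rewrite 1?setUAC //.
  by exists R1, S1, R3, S3.
apply/glueHl => //; first by case: g13.
split=> //; apply/(glue0 _ _ R2); apply: glueC.
exact/(glue0 _ _ R3).
Qed.

Lemma join_hang (G : sgraph) a q (R S : {set G}) :
  realizes (Join a q) R S -> exists R', realizes (Hang a q) R' S.
Proof.
case=> R1 [S1] [R2] [S2] [r1 r2 g _ ->].
by exists R1, R1, S1, R2, S2.
Qed.

Lemma hang_join (G : sgraph) a q (R S : {set G}) :
  realizes (Hang a q) R S -> exists R', realizes (Join a q) R' S.
Proof.
case=> R1 [S1] [R2] [S2] [r1 r2 g _ ->].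
by exists (R1 :|: R2), R1, S1, R2, S2.
Qed.

(** [Hang] and [Join] differ in the roots only, so a block with the three
    members [a], [b], [p] can be regarded as hanging at any of them. *)
Lemma hang_rot (G : sgraph) a b p (R S : {set G}) :
  realizes (Hang a (Join p b)) R S ->
  exists R', realizes (Hang b (Join p a)) R' S.
Proof.
case/hang_join=> R' h.
have {}h : realizes (Join b (Join p a)) R' S.
  have := joinCA h; case=> R1 [S1] [R2] [S2] [r1 r2 g e1 e2].
  apply: joinCA; exists R1, S1, R2, S2; split=> //; exact: joinC.
exact: join_hang h.
Qed.

Lemma hangW (G : sgraph) a a' q (R S : {set G}) :
  (forall R S : {set G}, realizes a R S -> realizes a' R S) ->
  realizes (Hang a q) R S -> realizes (Hang a' q) R S.
Proof.
by move=> i [R1 [S1 [R2 [S2 [r1 r2 g e1 e2]]]]]; exists R1, S1, R2, S2; split; auto.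
Qed.

Lemma joinWr (G : sgraph) a q q' (R S : {set G}) :
  (forall R S : {set G}, realizes q R S -> realizes q' R S) ->
  realizes (Join a q) R S -> realizes (Join a q') R S.
Proof.
by move=> i [R1 [S1 [R2 [S2 [r1 r2 g e1 e2]]]]]; exists R1, S1, R2, S2; split; auto.
Qed.

(** [quad] and [tri a b] are the forced blocks without the vertex they hang at:
    three vertices with a pendant edge each, and two vertices, one with a
    pendant edge and the other with two forced blocks.  A [cherry] is a vertex
    with three forced blocks, and [spider5] is the thin spider of size 5, here a
    [quad] extended by two more vertices. *)
Definition pendant := Hang Single Single.
Definition quad := Join pendant (Join pendant pendant).
Definition two_hung a b := Hang (Hang Single a) b.
Definition tri a b := Join pendant (two_hung a b).
Definition cherry a b c := Hang (two_hung a b) c.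
Definition spider5 := Join pendant (Join pendant quad).

Inductive forced : plan -> Prop :=
| forced_quad : forced quad
| forced_tri a b : forced a -> forced b -> forced (tri a b).

Inductive obstruction : plan -> Prop :=
| obstruction_spider5 : obstruction spider5
| obstruction_cherry a b c :
    forced a -> forced b -> forced c -> obstruction (cherry a b c).

Lemma cherryCA (G : sgraph) a b c (R S : {set G}) :
  realizes (cherry a b c) R S -> realizes (cherry a c b) R S.
Proof. exact: hangCA. Qed.

Lemma cherryC (G : sgraph) a b c (R S : {set G}) :
  realizes (cherry a b c) R S -> realizes (cherry b a c) R S.
Proof. by apply: hangW => ? ?; apply: hangCA. Qed.

(** A ternary tree rooted at another inner node. *)
Lemma cherry_rot (G : sgraph) a b c d (R S : {set G}) :
  realizes (cherry a b (tri c d)) R S ->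
  exists R', realizes (cherry c d (tri a b)) R' S.
Proof. exact: hang_rot. Qed.

Fixpoint single_root (t : plan) : bool :=
  match t with Single => true | Hang a _ => single_root a | Join _ _ => false end.

(** The plans whose roots form a clique. *)
Fixpoint flat (t : plan) : bool :=
  match t with Join a q => single_root a && flat q | _ => single_root t end.

Lemma single_rootP (G : sgraph) t (R S : {set G}) :
  single_root t -> realizes t R S -> exists v, R = [set v].
Proof.
elim: t R S => //= [|a IHa q _] R S.
  by move=> _ [v [-> _]]; exists v.
by move=> sr [R1 [S1 [R2 [S2 [r1 _ _ -> _]]]]]; apply: IHa r1.
Qed.

Lemma flat_clique (G : sgraph) t (R S : {set G}) :
  flat t -> realizes t R S -> {in R &, forall u w, u != w -> sedge u w}.
Proof.
have single (t' : plan) (R' S' : {set G}) : single_root t' -> realizes t' R' S' ->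
    {in R' &, forall u w, u != w -> sedge u w}.
  move=> sr /(single_rootP sr)[v ->] u w /set1P-> /set1P->; by rewrite eqxx.
elim: t R S => [|a IHa q IHq|a IHa q IHq] R S; try exact: single.
move=> /andP[sa fq] [R1 [S1 [R2 [S2 [r1 r2 [d g] -> _]]]]] u w.
have [s1 s2] := (subsetP (realizes_sub r1), subsetP (realizes_sub r2)).
rewrite !inE => /orP[uR|uR] /orP[wR|wR] uw.
- exact: single sa r1 _ _ uR wR uw.
- by rewrite g ?s1 ?s2 // uR.
- by rewrite sedge_sym g ?s1 ?s2 // uR wR.
- exact: IHq fq r2 _ _ uR wR uw.
Qed.

Lemma glue_clique (G : sgraph) (y : G) (W K : {set G}) :
  glue [set y] [set y] W K -> K \subset W -> {in K &, forall u w, u != w -> sedge u w} ->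
  {in y |: K &, forall u w, u != w -> sedge u w}.
Proof.
move=> [d g] /subsetP KW cl u w; rewrite !inE => /orP[/eqP->|uK] /orP[/eqP->|wK] uw.
- by rewrite eqxx in uw.
- by rewrite g ?KW ?set11 // wK.
- by rewrite sedge_sym g ?KW ?set11 // uK.
- exact: cl.
Qed.

Lemma forced_flat q : forced q -> flat q.
Proof. by case. Qed.

(** Segments of distinct nonadjacent vertices have no common point. *)
Definition apart (G : sgraph) (u w : G) : bool := (u != w) && ~~ sedge u w.

Lemma apartC (G : sgraph) (u w : G) : apart u w = apart w u.
Proof. by rewrite /apart eq_sym sedge_sym. Qed.

Lemma glue_apart (G : sgraph) (S1 R1 S2 R2 : {set G}) u w :
  glue S1 R1 S2 R2 -> u \in S1 -> w \in S2 -> (u \notin R1) || (w \notin R2) -> apart u w.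
Proof.
move=> [d g] uS wS h; rewrite /apart g // negb_and h andbT.
by apply/eqP=> uw; move/pred0P/(_ u): d; rewrite /= uS uw wS.
Qed.

Lemma glue_edge (G : sgraph) (S1 R1 S2 R2 : {set G}) u w :
  glue S1 R1 S2 R2 -> R1 \subset S1 -> R2 \subset S2 -> u \in R1 -> w \in R2 ->
  u != w /\ sedge u w.
Proof.
move=> [d g] /subsetP s1 /subsetP s2 uR wR.
have uS := s1 _ uR; have wS := s2 _ wR; rewrite g // uR wR; split=> //.
by apply/eqP=> uw; move/pred0P/(_ u): d; rewrite /= uS uw wS.
Qed.

Lemma pendantP (G : sgraph) (R S : {set G}) : realizes pendant R S ->
  exists c s, [/\ R = [set c], S = [set c; s], c != s & sedge c s].
Proof.
case=> R1 [S1] [R2] [S2] [[c [-> ->]] [s [-> ->]] g -> ->]; exists c, s.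
by have [] := glue_edge g (subxx _) (subxx _) (set11 c) (set11 s).
Qed.

Lemma two_hungP (G : sgraph) a b (R S : {set G}) : realizes (two_hung a b) R S ->
  exists w Ka Wa Kb Wb, [/\ realizes a Ka Wa, realizes b Kb Wb,
    [/\ glue [set w] [set w] Wa Ka, glue [set w] [set w] Wb Kb & glue Wa set0 Wb set0],
    R = [set w] & S = [set w] :|: (Wa :|: Wb)].
Proof.
case=> [_] [_] [Kb] [Wb] [[_] [_] [Ka] [Wa] [[w [-> ->]] ra ga -> ->] rb gb -> ->].
have /glueHl[//||gwb gab] := gb; first by case: ga.
exists w, Ka, Wa, Kb, Wb; split; rewrite ?setUA //; split=> //.
exact/(glue0 _ _ Kb).
Qed.

Lemma glue_pendants (G : sgraph) (c1 s1 c2 s2 : G) :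
  c1 != s1 -> c2 != s2 -> glue [set c1; s1] [set c1] [set c2; s2] [set c2] ->
  [/\ c1 != c2, sedge c1 c2, apart c1 s2, apart s1 c2 & apart s1 s2].
Proof.
move=> n1 n2 g.
have [||h1 h2] := glue_edge g _ _ (set11 c1) (set11 c2); rewrite ?subsetUl //.
by split=> //; apply: (glue_apart g); rewrite !inE ?eqxx ?orbT // ?[s1 == _]eq_sym
  ?[s2 == _]eq_sym ?n1 ?n2 ?orbT.
Qed.

Lemma cherryP (G : sgraph) a b c (R S : {set G}) : realizes (cherry a b c) R S ->
  exists w Ka Wa Kb Wb Kc Wc, [/\ [/\ realizes a Ka Wa, realizes b Kb Wb & realizes c Kc Wc],
    [/\ glue [set w] [set w] Wa Ka, glue [set w] [set w] Wb Kb & glue [set w] [set w] Wc Kc],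
    [/\ glue Wa set0 Wb set0, glue Wa set0 Wc set0 & glue Wb set0 Wc set0],
    R = [set w] & S = [set w] :|: (Wa :|: (Wb :|: Wc))].
Proof.
case=> [R1] [S1] [Kc] [Wc] [/two_hungP[w [Ka [Wa [Kb [Wb [ra rb [ga gb gab] -> ->]]]]]] rc gc -> ->].
have /glueHl[//||gwc gabc] := gc.
  by rewrite -setI_eq0 setIUr setU_eq0 !setI_eq0; case: ga => ->; case: gb => ->.
have /glueUl[||| gac gbc] : glue (Wa :|: Wb) (set0 :|: set0) Wc Kc by rewrite setU0.
- exact: sub0set.
- exact: sub0set.
- by case: gab.
exists w, Ka, Wa, Kb, Wb, Kc, Wc; split; rewrite -?setUA //; split=> //; exact/(glue0 _ _ Kc).
Qed.

(** * Plans determine rooted graphs *)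

Lemma glue_imset (G G' : sgraph) (f : G -> G') (S1 R1 S2 R2 : {set G}) :
  {in S1 :|: S2 &, injective f} ->
  {in S1 :|: S2 &, forall u w, sedge (f u) (f w) = sedge u w} ->
  R1 \subset S1 -> R2 \subset S2 ->
  glue S1 R1 S2 R2 -> glue (f @: S1) (f @: R1) (f @: S2) (f @: R2).
Proof.
move=> inj e s1 s2 [d g].
have mem (A B : {set G}) u : A \subset B -> B \subset S1 :|: S2 -> u \in B ->
    (f u \in f @: A) = (u \in A).
  move=> sA sB uB; apply/imsetP/idP => [[w wA fuw] | uA]; last by exists u.
  by rewrite (inj u w) // (subsetP sB) // (subsetP sA).
split.
  apply/pred0P => x /=; apply/negP => /andP[/imsetP[u uS ->]].
  case/imsetP=> w wS fuw.
  have uw := inj _ _ _ _ fuw; move/pred0P/(_ u): d => /=.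
  by rewrite uS uw ?wS // inE ?uS ?wS ?orbT.
move=> _ _ /imsetP[u uS ->] /imsetP[w wS ->].
by rewrite (mem R1 S1) ?subsetUl // (mem R2 S2) ?subsetUr // e ?g // inE ?uS ?wS ?orbT.
Qed.

Lemma realizes_imset (G G' : sgraph) (f : G -> G') t (R S : {set G}) :
  {in S &, injective f} -> {in S &, forall u w, sedge (f u) (f w) = sedge u w} ->
  realizes t R S -> realizes t (f @: R) (f @: S).
Proof.
elim: t R S => [|a IHa q IHq|a IHa q IHq] R S /= inj e.
- by case=> v [-> ->]; exists (f v); rewrite !imset_set1.
- case=> R1 [S1] [R2] [S2] [r1 r2 g eR eS]; rewrite {}eR {}eS {R S} in inj e *.
  exists (f @: R1), (f @: S1), (f @: R2), (f @: S2); split=> //.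
  + apply: IHa => // u w uS wS; [apply: inj | apply: e]; by rewrite inE ?uS ?wS.
  + apply: IHq => // u w uS wS; [apply: inj | apply: e]; by rewrite inE ?uS ?wS orbT.
  + exact: glue_imset inj e (realizes_sub r1) (realizes_sub r2) g.
  + by rewrite imsetU.
- case=> R1 [S1] [R2] [S2] [r1 r2 g eR eS]; rewrite {}eR {}eS {R S} in inj e *.
  exists (f @: R1), (f @: S1), (f @: R2), (f @: S2); split=> //.
  + apply: IHa => // u w uS wS; [apply: inj | apply: e]; by rewrite inE ?uS ?wS.
  + apply: IHq => // u w uS wS; [apply: inj | apply: e]; by rewrite inE ?uS ?wS orbT.
  + exact: glue_imset inj e (realizes_sub r1) (realizes_sub r2) g.
  + by rewrite imsetU.
  + by rewrite imsetU.
Qed.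

Definition rooted_iso (G G' : sgraph) (f : G -> G') (R S : {set G}) (R' S' : {set G'}) :=
  [/\ {in S &, injective f}, {in S &, forall u w, sedge (f u) (f w) = sedge u w},
      f @: S = S' & f @: R = R'].

Lemma glue_iso (G G' : sgraph) (f1 f2 : G -> G') (S1 R1 S2 R2 : {set G})
    (S1' R1' S2' R2' : {set G'}) :
  R1 \subset S1 -> R2 \subset S2 ->
  glue S1 R1 S2 R2 -> glue S1' R1' S2' R2' ->
  rooted_iso f1 R1 S1 R1' S1' -> rooted_iso f2 R2 S2 R2' S2' ->
  exists f, [/\ {in S1, f =1 f1}, {in S2, f =1 f2} &
    {in S1 :|: S2 &, injective f} /\
    {in S1 :|: S2 &, forall u w, sedge (f u) (f w) = sedge u w}].
Proof.
move=> s1 s2 [d g] [d' g'] [i1 e1 im1 ir1] [i2 e2 im2 ir2].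
pose f u := if u \in S1 then f1 u else f2 u.
have ff1 : {in S1, f =1 f1} by move=> u uS; rewrite /f uS.
have ff2 : {in S2, f =1 f2}.
  move=> u uS; rewrite /f; case: ifP => // uS1.
  by move/pred0P/(_ u): d; rewrite /= uS uS1.
have m1 u : u \in S1 -> f1 u \in S1' by move=> uS; rewrite -im1 imset_f.
have m2 u : u \in S2 -> f2 u \in S2' by move=> uS; rewrite -im2 imset_f.
have n12 u w : u \in S1 -> w \in S2 -> f1 u <> f2 w.
  move=> uS wS fuw; move/pred0P/(_ (f1 u)): d' => /=.
  by rewrite m1 // fuw m2.
have e12 u w : u \in S1 -> w \in S2 -> sedge (f1 u) (f2 w) = sedge u w.
  move=> uS wS; rewrite g' ?g ?m1 ?m2 // -ir1 -ir2; congr (_ && _).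
    apply/imsetP/idP => [[x xR fux] | ]; last by exists u.
    by rewrite (i1 u x) // (subsetP s1).
  apply/imsetP/idP => [[x xR fux] | ]; last by exists w.
  by rewrite (i2 w x) // (subsetP s2).
exists f; split=> //; split=> u w; rewrite !inE => /orP[uS|uS] /orP[wS|wS].
- by rewrite (ff1 u uS) (ff1 w wS); apply: i1.
- by rewrite (ff1 u uS) (ff2 w wS) => h; case: (n12 _ _ uS wS h).
- by rewrite (ff2 u uS) (ff1 w wS) => h; case: (n12 _ _ wS uS (esym h)).
- by rewrite (ff2 u uS) (ff2 w wS); apply: i2.
- by rewrite (ff1 u uS) (ff1 w wS); apply: e1.
- by rewrite (ff1 u uS) (ff2 w wS); apply: e12.
- by rewrite (ff2 u uS) (ff1 w wS) sedge_sym e12 // sedge_sym.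
- by rewrite (ff2 u uS) (ff2 w wS); apply: e2.
Qed.

(** The edges are determined by the plan, so isomorphisms of the two glued
    parts that match their roots can be put together. *)
Lemma realizes_iso (G G' : sgraph) t (R S : {set G}) (R' S' : {set G'}) :
  realizes t R S -> realizes t R' S' ->
  exists f : G -> G', rooted_iso f R S R' S'.
Proof.
elim: t R S R' S' => [|a IHa q IHq|a IHa q IHq] R S R' S' /=.
- case=> v [-> ->] [v' [-> ->]]; exists (fun => v').
  split; rewrite ?imset_set1 // => u w /set1P-> /set1P-> //.
  by rewrite !sedge_irrefl.
- case=> R1 [S1] [R2] [S2] [r1 r2 g -> ->].
  case=> R1' [S1'] [R2'] [S2'] [r1' r2' g' -> ->].
  have [f1 F1] := IHa _ _ _ _ r1 r1'; have [f2 F2] := IHq _ _ _ _ r2 r2'.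
  have s1 := realizes_sub r1.
  have [f [ff1 ff2 [i e]]] := glue_iso s1 (realizes_sub r2) g g' F1 F2.
  case: F1 => _ _ im1 ir1; case: F2 => _ _ im2 ir2.
  exists f; split=> //.
    by rewrite imsetU -im1 -im2; congr (_ :|: _); apply: eq_in_imset.
  by rewrite -ir1; apply: eq_in_imset => u uR; apply: ff1; apply: (subsetP s1).
- case=> R1 [S1] [R2] [S2] [r1 r2 g -> ->].
  case=> R1' [S1'] [R2'] [S2'] [r1' r2' g' -> ->].
  have [f1 F1] := IHa _ _ _ _ r1 r1'; have [f2 F2] := IHq _ _ _ _ r2 r2'.
  have s1 := realizes_sub r1; have s2 := realizes_sub r2.
  have [f [ff1 ff2 [i e]]] := glue_iso s1 s2 g g' F1 F2.
  case: F1 => _ _ im1 ir1; case: F2 => _ _ im2 ir2.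
  exists f; split=> //.
    by rewrite imsetU -im1 -im2; congr (_ :|: _); apply: eq_in_imset.
  rewrite imsetU -ir1 -ir2; congr (_ :|: _); apply: eq_in_imset => u uR.
    by apply: ff1; apply: (subsetP s1).
  by apply: ff2; apply: (subsetP s2).
Qed.

Lemma realizes_isomorphic (G G' : sgraph) t (R S : {set G}) (R' : {set G'}) :
  realizes t R S -> realizes t R' [set: G'] -> isomorphic (induced S) G'.
Proof.
move=> r r'; have [f [i e im _]] := realizes_iso r r'.
exists (fun x : induced S => f (val x)) => [|x y]; last first.
  by rewrite e //; [apply: valP | apply: valP].
have inj : injective (fun x : induced S => f (val x)).
  by move=> x y /i h; apply: val_inj; apply: h; apply: valP.
have sur y : exists x : induced S, f (val x) = y.
  have : y \in f @: S by rewrite im.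
  by case/imsetP=> u uS ->; exists (exist _ u uS).
apply: (inj_card_bij inj); rewrite -(card_codom inj).
apply: subset_leq_card; apply/subsetP=> y _; apply/codomP.
by have [x <-] := sur y; exists x.
Qed.

(** * Segments *)

Local Open Scope ring_scope.

Record seg := Seg {xl : int; xr : int; yl : int; yr : int}.


Definition wf (s : seg) : Prop :=
  (xl s <= xr s /\ yl s <= yr s) /\ (xl s = xr s \/ yl s = yr s).

Definition meets (s t : seg) : Prop :=
  (xl s <= xr t /\ xl t <= xr s) /\ (yl s <= yr t /\ yl t <= yr s).

Definition rep (G : sgraph) (S : {set G}) (r : G -> seg) : Prop :=
  (forall u, u \in S -> wf (r u)) /\
  (forall u w, u \in S -> w \in S -> u != w -> (sedge u w <-> meets (r u) (r w))).

Lemma meetsC s t : meets s t <-> meets t s.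
Proof. by rewrite /meets; lia. Qed.

Lemma rep_sub (G : sgraph) (S T : {set G}) r : T \subset S -> rep S r -> rep T r.
Proof.
move=> /subsetP TS [w e]; split=> [u /TS/w // | u v /TS uS /TS vS uv]; exact: e.
Qed.

Lemma rep_map (G : sgraph) (S : {set G}) r r' :
  rep S r -> (forall u, u \in S -> wf (r' u)) ->
  (forall u w, u \in S -> w \in S -> u != w ->
     (meets (r u) (r w) <-> meets (r' u) (r' w))) ->
  rep S r'.
Proof.
move=> [w e] w' e'; split=> // u v uS vS uv; rewrite e //; exact: e'.
Qed.

Lemma rep_glue (G : sgraph) (S1 S2 : {set G}) r1 r2 :
  rep S1 r1 -> rep S2 r2 -> [disjoint S1 & S2] ->
  (forall u w, u \in S1 -> w \in S2 -> (sedge u w <-> meets (r1 u) (r2 w))) ->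
  exists r, [/\ rep (S1 :|: S2) r, {in S1, r =1 r1} & {in S2, r =1 r2}].
Proof.
move=> [w1 e1] [w2 e2] d e12.
pose r u := if u \in S1 then r1 u else r2 u.
have rr1 : {in S1, r =1 r1} by move=> u uS; rewrite /r uS.
have rr2 : {in S2, r =1 r2}.
  move=> u uS; rewrite /r; case: ifP => // uS1.
  by move/pred0P/(_ u): d; rewrite /= uS uS1.
exists r; split=> //; split=> [u | u w]; rewrite !inE.
  by case/orP=> uS; rewrite ?(rr1 _ uS) ?(rr2 _ uS); auto.
case/orP=> uS /orP[wS|wS] uw.
- by rewrite (rr1 _ uS) (rr1 _ wS); apply: e1.
- by rewrite (rr1 _ uS) (rr2 _ wS); apply: e12.
- by rewrite (rr2 _ uS) (rr1 _ wS) sedge_sym meetsC; apply: e12.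
- by rewrite (rr2 _ uS) (rr2 _ wS); apply: e2.
Qed.

(** * Drawings of rooted graphs *)

(** The root is a horizontal segment through the origin, and no other segment
    meets the line x = 0.  Unless [lu], everything lies to the right of the
    origin, so that a parent block may be put there with its left axis free;
    if [ro], the root runs to the right end of the drawing and can be
    prolonged. *)
Definition vbox (lu : bool) (L : int) (s : seg) : Prop :=
  (- L <= xl s /\ xr s <= L) /\ (- L <= yl s /\ yr s <= L) /\
  ((xr s < 0 /\ lu) \/ 0 < xl s).

Definition vrep (G : sgraph) (lu ro : bool) (v : G) (S : {set G}) : Prop :=
  v \in S /\
  exists r L a b, [/\ rep S r, r v = Seg (- a) b 0 0,
    [/\ 0 <= a /\ a <= L, 0 <= b /\ b <= L, lu \/ a = 0 & ro -> b = L] &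
    forall u, u \in S -> u != v -> vbox lu L (r u)].

Definition hits (s : seg) : Prop := 
  (xl s <= 0 /\ 0 <= xr s) /\ (yl s <= 0 /\ 0 <= yr s).

(** The members of a block, minus its root, all pass through the origin.  The
    four booleans tell which half-axes (left, right, up, down) are free, that
    is, meet no segment outside the origin. *)
Definition qbox (l r u d k : bool) (L : int) (s : seg) : Prop :=
  ((- L <= xl s /\ xr s <= L) /\ (- L <= yl s /\ yr s <= L)) /\
  (k <-> hits s) /\
  (l -> yl s <= 0 /\ 0 <= yr s -> 0 <= xl s) /\
  (r -> yl s <= 0 /\ 0 <= yr s -> xr s <= 0) /\
  (u -> xl s <= 0 /\ 0 <= xr s -> yr s <= 0) /\
  (d -> xl s <= 0 /\ 0 <= xr s -> 0 <= yl s).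

Definition qrep (G : sgraph) (l r u d : bool) (K S : {set G}) : Prop :=
  K \subset S /\ exists f L, [/\ rep S f, 0 <= L &
    forall x, x \in S -> qbox l r u d (x \in K) L (f x)].

Ltac segs := rewrite /vbox /qbox /hits /wf /meets /=.

Lemma rep_wf (G : sgraph) (S : {set G}) r u : rep S r -> u \in S -> wf (r u).
Proof. by case=> w _; apply: w. Qed.

Lemma rep_le (G : sgraph) (S : {set G}) r u :
  rep S r -> u \in S -> xl (r u) <= xr (r u) /\ yl (r u) <= yr (r u).
Proof. by move=> R /(rep_wf R)[]. Qed.

(** Opens a gap around the line x = 0, into which a block is inserted. *)
Definition spread (c e : int) (s : seg) : seg :=
  if 0 < xl s then Seg (xl s + c) (xr s + c) (yl s) (yr s)
  else Seg (xl s - e) (xr s - e) (yl s) (yr s).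

Lemma spreadP lu L c e s : vbox lu L s -> xl s <= xr s ->
  ((- L <= xl s /\ xr s <= L) /\ (- L <= yl s /\ yr s <= L)) /\
  ((0 < xl s /\ spread c e s = Seg (xl s + c) (xr s + c) (yl s) (yr s)) \/
   (lu /\ xr s < 0 /\ spread c e s = Seg (xl s - e) (xr s - e) (yl s) (yr s))).
Proof.
rewrite /vbox /spread => -[h1 [h2 [[h3 h4]|h3]]] h5; split=> //.
  by right; case: ifP => //; lia.
by left; rewrite h3.
Qed.

(** A quarter turn: the gluing lemmas below need to consider only one
    direction. *)
Lemma qrep_turn (G : sgraph) l r u d (K S : {set G}) :
  qrep l r u d K S -> qrep d u l r K S.
Proof.
case=> KS [f [L [R L0 B]]]; split=> //.
pose t s := Seg (yl s) (yr s) (- xr s) (- xl s).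
exists (fun x => t (f x)), L; split=> //.
  apply: (rep_map R) => [x xS | x y xS yS xy].
    by have := rep_wf R xS; segs; lia.
  by segs; lia.
move=> x xS; have := B x xS; segs; lia.
Qed.

Definition shift (c e : int) (s : seg) : seg := Seg (xl s + c) (xr s + c) (yl s + e) (yr s + e).

Lemma rep_shift (G : sgraph) (S : {set G}) r c e :
  rep S r -> rep S (fun u => shift c e (r u)).
Proof.
move=> R; apply: (rep_map R) => [x xS | x y xS yS xy].
  by have := rep_wf R xS; segs; lia.
by segs; lia.
Qed.

Lemma qrep_set0 (G : sgraph) : qrep true true true true (set0 : {set G}) set0.
Proof.
split; first exact: sub0set.
exists (fun=> Seg 0 0 0 0), 0; split=> [|//|x]; last by rewrite in_set0.
by split=> [u | u w]; rewrite in_set0.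
Qed.

Lemma qrep_weak (G : sgraph) (l r u d l' r' u' d' : bool) (K S : {set G}) :
  (l' -> l) -> (r' -> r) -> (u' -> u) -> (d' -> d) ->
  qrep l r u d K S -> qrep l' r' u' d' K S.
Proof.
move=> hl hr hu hd [KS [f [L [R L0 B]]]]; split=> //; exists f, L; split=> // x xS.
by have := B x xS; rewrite /qbox; tauto.
Qed.

Lemma vrep_weak (G : sgraph) (lu ro lu' ro' : bool) v (S : {set G}) :
  (lu -> lu') -> (ro' -> ro) -> vrep lu ro v S -> vrep lu' ro' v S.
Proof.
move=> hl hr [vS [f [L [a [b [R e [h1 h2 h3 h4] B]]]]]]; split=> //.
exists f, L, a, b; split=> //; first by split=> //; [case: h3; auto | auto].
move=> u uS uv; have := B u uS uv; rewrite /vbox; tauto.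
Qed.

Lemma vrep_rep (G : sgraph) lu ro v (S : {set G}) : vrep lu ro v S -> exists r, rep S r.
Proof. by case=> _ [f [L [a [b [R _ _ _]]]]]; exists f. Qed.

Lemma qrep_rep (G : sgraph) l r u d (K S : {set G}) :
  qrep l r u d K S -> exists r, rep S r.
Proof. by case=> _ [f [L [R _ _]]]; exists f. Qed.

Lemma vrep1 (G : sgraph) (v : G) : vrep false true v [set v].
Proof.
split; first by rewrite inE.
exists (fun=> Seg 0 0 0 0), 0, 0, 0; split=> //.
- by split=> [u | u w /set1P-> /set1P->]; rewrite ?eqxx // => _; segs; lia.
- by split; auto.
by move=> u /set1P->; rewrite eqxx.
Qed.

(** A vertex of the block without other blocks is drawn as the origin. *)
Lemma qrep_add_point (G : sgraph) l r u d (K S : {set G}) w :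
  qrep l r u d K S -> glue [set w] [set w] S K ->
  qrep l r u d (w |: K) (w |: S).
Proof.
case=> KS [f [L [R L0 B]]] [dj g]; split; first exact: setUS.
have R0 : rep [set w] (fun=> Seg 0 0 0 0).
  by split=> [x _ | x y /set1P-> /set1P->]; [segs; lia | rewrite eqxx].
have [|f' [R' f1 f2]] := rep_glue R0 R dj.
  move=> x y /set1P-> yS; rewrite g ?inE ?eqxx //.
  by have := B y yS; segs; lia.
exists f', L; split=> // x; rewrite !inE => /orP[/eqP->|xS].
  by rewrite f1 ?inE // eqxx; segs; lia.
have xw : (x == w) = false.
  by apply/eqP=> xw; move/pred0P/(_ x): dj; rewrite /= xS inE xw eqxx.
by rewrite f2 // xw; apply: B.
Qed.

Lemma qbox_right l u d L s :
  (- L <= xl s /\ xr s <= L) /\ (- L <= yl s /\ yr s <= L) ->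
  xl s <= xr s -> 0 < xl s -> qbox l false u d false L s.
Proof.
move=> h1 h2 h3; split=> //; split; first by rewrite /hits; clear - h3; lia.
by split; [|split; [|split]] => // _; clear - h2 h3; lia.
Qed.

Lemma qbox_left r u d L s :
  (- L <= xl s /\ xr s <= L) /\ (- L <= yl s /\ yr s <= L) ->
  xl s <= xr s -> xr s < 0 -> qbox false r u d false L s.
Proof.
move=> h1 h2 h3; split=> //; split; first by rewrite /hits; clear - h3; lia.
by split; [|split; [|split]] => // _; clear - h2 h3; lia.
Qed.

(** A further cutpoint [w] of the block.  Its drawing is opened at the origin so
    far that everything but the segment of [w] gets outside the box of the block
    drawn so far; within this box [w] covers only the horizontal axes, which are
    free. *)
Lemma qrep_add (G : sgraph) lu ro l u d (K S T : {set G}) w :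
  vrep lu ro w T -> qrep l true u d K S -> (lu -> l) -> glue T [set w] S K ->
  qrep (l && ~~ lu) false u d (w |: K) (T :|: S).
Proof.
case=> [wT [f1 [L1 [a [b [R1 e [a0 b0 la _] B1]]]]]] [KS [f2 [L2 [R2 L0 B2]]]] lul [dj g].
split; first by rewrite setUSS // sub1set.
have [a' [a1 a2 a3]] : exists a', [/\ (lu /\ a' = a + L2) \/ (lu = false /\ a' = 0),
    0 <= a' & a' <= a + L2].
  case: lu la {lul B1} => [_|[//|->]]; [exists (a + L2) | exists 0]; split; try lia;
    by [left | right].
pose f3 x := if x == w then Seg (- a') (b + L2) 0 0 else spread L2 L2 (f1 x).
have f3w : f3 w = Seg (- a') (b + L2) 0 0 by rewrite /f3 eqxx.
have f3x x : x \in T -> x != w ->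
    [/\ f3 x = spread L2 L2 (f1 x), xl (f1 x) <= xr (f1 x) /\ yl (f1 x) <= yr (f1 x),
        (- L1 <= xl (f1 x) /\ xr (f1 x) <= L1) /\ (- L1 <= yl (f1 x) /\ yr (f1 x) <= L1)
      & (0 < xl (f1 x) /\ f3 x = Seg (xl (f1 x) + L2) (xr (f1 x) + L2) (yl (f1 x)) (yr (f1 x))) \/
        ([/\ lu, l, a' = a + L2 & xr (f1 x) < 0] /\ f3 x = Seg (xl (f1 x) - L2) (xr (f1 x) - L2) (yl (f1 x)) (yr (f1 x)))].
  move=> xT xw; have le := rep_le R1 xT.
  have E : f3 x = spread L2 L2 (f1 x) by rewrite /f3 (negbTE xw).
  have [bx sx] := spreadP L2 L2 (B1 x xT xw) le.1; split=> //; rewrite E.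
  case: sx => [[h ->]|[h [h' ->]]]; [by left | right]; split=> //; split=> //.
    exact: lul.
  by case: a1 => [[]|[]] //; rewrite h.
have wx x : x \in T -> x != w -> (meets (f1 w) (f1 x) <-> meets (f3 w) (f3 x)).
  move=> xT xw; have [_ le bx [[h ->]|[[h1 h2 h3 h4] ->]]] := f3x x xT xw;
    rewrite e f3w /meets /=.
    by clear - a0 b0 a2 a3 L0 le bx h; lia.
  by clear - a0 b0 h3 h4 L0 le bx; lia.
have R3 : rep T f3.
  apply: (rep_map R1) => [x xT | x y xT yT xy].
    have [-> | xw] := eqVneq x w; first by rewrite f3w; segs; lia.
    have := rep_wf R1 xT; have [-> _ _ _] := f3x x xT xw; rewrite /spread.
    by segs; case: ifP => _ /=; lia.
  have [xw | xw] := eqVneq x w; first by rewrite xw; apply: wx; rewrite // -xw eq_sym.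
  have [yw | yw] := eqVneq y w; first by rewrite yw 2!(meetsC _ (_ w)); apply: wx.
  have [_ lx bx [[hx ->]|[[_ _ _ hx] ->]]] := f3x x xT xw;
  have [_ ly b_y [[hy ->]|[[_ _ _ hy] ->]]] := f3x y yT yw;
    rewrite /meets /=; clear - L0 lx ly hx hy; lia.
have [|f [R ff1 ff2]] := rep_glue R3 R2 dj.
  move=> x y xT yS; rewrite g // inE; have By := B2 y yS; have ly := rep_le R2 yS.
  have [-> | xw] := eqVneq x w.
    rewrite f3w; case: a1 => [[h1 h2]|[h1 h2]].
      by move: By; rewrite (lul h1); segs; clear - ly a0 b0 a2 L0; lia.
    by move: By; segs; clear - ly a0 b0 a2 h2 L0; lia.
  move: By => [By _].
  have [_ le bx [[h ->]|[[h1 h2 h3 h4] ->]]] := f3x x xT xw; segs; lia.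
exists f, (L1 + L2); split=> //; first by lia.
move=> x; rewrite !inE => /orP[xT|xS].
  have xK : x \in K = false.
    apply/negP=> /(subsetP KS) xS.
    by move/pred0P/(_ x): dj; rewrite /= xS xT.
  rewrite ff1 // xK orbF; have [-> | xw] := eqVneq x w.
    rewrite f3w; case: a1 => [[h1 h2]|[h1 h2]]; rewrite h1 ?andbF ?andbT;
      (split; last split); rewrite /hits /=; clear - a0 b0 a2 a3 L0 h2; try lia;
      by split; [|split; [|split]]; rewrite //=; lia.
  have [_ le bx [[h ->]|[[h1 h2 h3 h4] ->]]] := f3x x xT xw; rewrite ?h1 ?andbF.
    by apply: qbox_right => /=; clear - bx le h L0; lia.
  by apply: qbox_left => /=; clear - bx le h4 L0; lia.
have -> : (x == w) = false.
  by apply/eqP=> xw; move/pred0P/(_ x): dj; rewrite /= xS xw wT.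
rewrite ff2 //; have [B3 [B4 [B5 [_ [B6 B7]]]]] := B2 x xS.
split; first by clear - a0 b0 L0 B3; lia.
by split=> //; split=> // /andP[/B5].
Qed.

(** A block with a free line through it can be put anywhere on the segment of
    [v]; here it goes into a gap opened immediately to the right of the
    origin. *)
Lemma vrep_attach (G : sgraph) lu ro u d v (K S T : {set G}) :
  vrep lu ro v T -> qrep true true u d K S -> glue T [set v] S K ->
  vrep lu ro v (T :|: S).
Proof.
case=> [vT [f1 [L1 [a [b [R1 e [a0 b0 la bL] B1]]]]]] [KS [f2 [L2 [R2 L0 B2]]]] [dj g].
split; first by rewrite inE vT.
pose c := 2 * L2 + 1; pose L := L1 + L2 + c.
have [b' [b1 b2 b3]] : exists b', [/\ b + c <= b' <= L, b' = b + c \/ b = L1 & ro -> b' = L].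
  case: ro bL {B1} => [/(_ isT)->|_]; [exists L | exists (b + c)]; split; rewrite /L /c //; lia.
(* [c] is the width of the gap: the box of the block and one more column. *)
pose f3 x := if x == v then Seg (- a) b' 0 0 else spread c 0 (f1 x).
have f3v : f3 v = Seg (- a) b' 0 0 by rewrite /f3 eqxx.
have c0 : 0 < c by rewrite /c; lia.
have f3x x : x \in T -> x != v ->
    [/\ f3 x = spread c 0 (f1 x), xl (f1 x) <= xr (f1 x) /\ yl (f1 x) <= yr (f1 x),
        (- L1 <= xl (f1 x) /\ xr (f1 x) <= L1) /\ (- L1 <= yl (f1 x) /\ yr (f1 x) <= L1)
      & (0 < xl (f1 x) /\ f3 x = Seg (xl (f1 x) + c) (xr (f1 x) + c) (yl (f1 x)) (yr (f1 x))) \/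
        ((lu /\ xr (f1 x) < 0) /\ f3 x = f1 x)].
  move=> xT xw; have le := rep_le R1 xT.
  have E : f3 x = spread c 0 (f1 x) by rewrite /f3 (negbTE xw).
  have [bx sx] := spreadP c 0 (B1 x xT xw) le.1; split=> //; rewrite E.
  case: sx => [[h ->]|[h [h' ->]]]; [by left | right]; split=> //.
  by case: (f1 x) => ? ? ? ? /=; rewrite !GRing.subr0.
have wx x : x \in T -> x != v -> (meets (f1 v) (f1 x) <-> meets (f3 v) (f3 x)).
  move=> xT xw; have [_ le bx [[h ->]|[h ->]]] := f3x x xT xw;
    rewrite e f3v /meets /=; clear - a0 b0 b1 b2 c0 le bx h; lia.
have R3 : rep T f3.
  apply: (rep_map R1) => [x xT | x y xT yT xy].
    have [-> | xw] := eqVneq x v; first by rewrite f3v; segs; lia.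
    have := rep_wf R1 xT; have [-> _ _ _] := f3x x xT xw; rewrite /spread.
    by segs; case: ifP => _ /=; lia.
  have [xw | xw] := eqVneq x v; first by rewrite xw; apply: wx; rewrite // -xw eq_sym.
  have [yw | yw] := eqVneq y v; first by rewrite yw 2!(meetsC _ (_ v)); apply: wx.
  have [_ lx bx [[hx ->]|[[_ hx] ->]]] := f3x x xT xw;
  have [_ ly b_y [[hy ->]|[[_ hy] ->]]] := f3x y yT yw;
    rewrite /meets /=; clear - c0 lx ly hx hy; lia.
have R2' := rep_shift (L2 + 1) 0 R2.
have [|f [R ff1 ff2]] := rep_glue R3 R2' dj.
  move=> x y xT yS; rewrite g // inE; have By := B2 y yS; have ly := rep_le R2 yS.
  have [-> | xv] := eqVneq x v.
    by rewrite f3v; move: By; segs; rewrite /c in b1; clear - ly a0 b0 b1 L0; lia.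
  move: By => [By _].
  have [_ le bx [[h ->]|[h ->]]] := f3x x xT xv; segs; clear - h By le c0 L0; rewrite /c; lia.
exists f, L, a, b'; split=> //.
- by rewrite ff1.
- by split=> //; rewrite /L /c in b1 *; lia.
move=> x; rewrite inE => /orP[xT|xS] xv.
  rewrite ff1 //; have [_ le bx [[h ->]|[[h h'] ->]]] := f3x x xT xv; segs; rewrite /L; first by lia.
  by rewrite h; lia.
by rewrite ff2 //; have [+ _] := B2 x xS; have := rep_le R2 xS; rewrite /L /c; segs; lia.
Qed.

(** A block with only a free half-line goes beyond the right end of the segment
    of [v]; prolonging the segment thereafter is no longer possible. *)
Lemma vrep_end (G : sgraph) r u d v (K S T : {set G}) :
  vrep false true v T -> qrep true r u d K S -> glue T [set v] S K ->
  vrep false false v (T :|: S).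
Proof.
case=> [vT [f1 [L1 [a [b [R1 e [a0 b0 la bL] B1]]]]]] [KS [f2 [L2 [R2 L0 B2]]]] [dj g].
split; first by rewrite inE vT.
pose c := L1 + L2 + 1; pose L := c + L2.
have {}bL := bL isT.
pose f3 x := if x == v then Seg (- a) c 0 0 else f1 x.
have f3v : f3 v = Seg (- a) c 0 0 by rewrite /f3 eqxx.
have f3x x : x != v -> f3 x = f1 x by move=> xv; rewrite /f3 (negbTE xv).
have vb x : x \in T -> x != v -> [/\ xl (f1 x) <= xr (f1 x) /\ yl (f1 x) <= yr (f1 x),
    (- L1 <= xl (f1 x) /\ xr (f1 x) <= L1) /\ (- L1 <= yl (f1 x) /\ yr (f1 x) <= L1) &
    0 < xl (f1 x)].
  move=> xT xv; have [h1 [h2 [[]//|h3]]] := B1 x xT xv; split=> //; exact: rep_le xT.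
have wx x : x \in T -> x != v -> (meets (f1 v) (f1 x) <-> meets (f3 v) (f3 x)).
  move=> xT xv; have [le bx h] := vb x xT xv.
  by rewrite e f3v f3x // /meets /= /c; clear - a0 b0 bL L0 le bx h; lia.
have R3 : rep T f3.
  apply: (rep_map R1) => [x xT | x y xT yT xy].
    have [-> | xv] := eqVneq x v; first by rewrite f3v /c; segs; lia.
    by rewrite f3x //; apply: rep_wf xT.
  have [xv | xv] := eqVneq x v; first by rewrite xv; apply: wx; rewrite // -xv eq_sym.
  have [yv | yv] := eqVneq y v; first by rewrite yv 2!(meetsC _ (_ v)); apply: wx.
  by rewrite !f3x.
have R2' := rep_shift c 0 R2.
have [|f [R ff1 ff2]] := rep_glue R3 R2' dj.
  move=> x y xT yS; rewrite g // inE; have ly := rep_le R2 yS.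
  have [By [Hy [Ly _]]] := B2 y yS; have {}Ly := Ly isT.
  have [-> | xv] := eqVneq x v.
    by rewrite f3v Hy; segs; rewrite /c; clear - a0 b0 bL L0 ly By Ly; lia.
  have [le bx h] := vb x xT xv.
  by rewrite f3x //; segs; rewrite /c; clear - L0 ly By le bx; lia.
exists f, L, a, c; split=> //.
- by rewrite ff1.
- by split=> //; rewrite /L /c; lia.
move=> x; rewrite inE => /orP[xT|xS] xv.
  have [le bx h] := vb x xT xv.
  by rewrite ff1 // f3x // /L /c; segs; clear - a0 b0 L0 le bx h; lia.
have [By _] := B2 x xS; have ly := rep_le R2 xS.
by rewrite ff2 // /L /c; segs; clear - a0 b0 L0 ly By; lia.
Qed.

(** A second such block goes to the left end, which gives up the free left
    axis. *)
Lemma vrep_two_ends (G : sgraph) ro r u d v (K S T : {set G}) :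
  vrep false ro v T -> qrep true r u d K S -> glue T [set v] S K ->
  vrep true ro v (T :|: S).
Proof.
case=> [vT [f1 [L1 [a [b [R1 e [a0 b0 la bL] B1]]]]]] /qrep_turn/qrep_turn.
case=> KS [f2 [L2 [R2 L0 B2]]] [dj g].
split; first by rewrite inE vT.
pose L := L1 + L2 + L2 + 1; pose c := if ro then L else b.
pose f3 x := if x == v then Seg (- (L2 + 1)) c 0 0 else f1 x.
have f3v : f3 v = Seg (- (L2 + 1)) c 0 0 by rewrite /f3 eqxx.
have f3x x : x != v -> f3 x = f1 x by move=> xv; rewrite /f3 (negbTE xv).
have cb : b <= c <= L by rewrite /c /L; case: (ro); lia.
have cb' : b = c \/ b = L1 by rewrite /c; case: (ro) bL; auto.
have vb x : x \in T -> x != v -> [/\ xl (f1 x) <= xr (f1 x) /\ yl (f1 x) <= yr (f1 x),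
    (- L1 <= xl (f1 x) /\ xr (f1 x) <= L1) /\ (- L1 <= yl (f1 x) /\ yr (f1 x) <= L1) &
    0 < xl (f1 x)].
  move=> xT xv; have [h1 [h2 [[]//|h3]]] := B1 x xT xv; split=> //; exact: rep_le xT.
have wx x : x \in T -> x != v -> (meets (f1 v) (f1 x) <-> meets (f3 v) (f3 x)).
  move=> xT xv; have [le bx h] := vb x xT xv.
  by rewrite e f3v f3x // /meets /=; clear - a0 b0 cb cb' L0 le bx h; lia.
have R3 : rep T f3.
  apply: (rep_map R1) => [x xT | x y xT yT xy].
    have [-> | xv] := eqVneq x v; first by rewrite f3v; segs; lia.
    by rewrite f3x //; apply: rep_wf xT.
  have [xv | xv] := eqVneq x v; first by rewrite xv; apply: wx; rewrite // -xv eq_sym.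
  have [yv | yv] := eqVneq y v; first by rewrite yv 2!(meetsC _ (_ v)); apply: wx.
  by rewrite !f3x.
have R2' := rep_shift (- (L2 + 1)) 0 R2.
have [|f [R ff1 ff2]] := rep_glue R3 R2' dj.
  move=> x y xT yS; rewrite g // inE; have ly := rep_le R2 yS.
  have [By [Hy [_ [Ly _]]]] := B2 y yS; have {}Ly := Ly isT.
  have [-> | xv] := eqVneq x v.
    by rewrite f3v Hy; segs; clear - a0 b0 cb L0 ly By Ly; lia.
  have [le bx h] := vb x xT xv.
  by rewrite f3x //; segs; clear - L0 ly By le bx h; lia.
exists f, L, (L2 + 1), c; split=> //.
- by rewrite ff1.
- split=> //; try (rewrite /L; lia); by rewrite /c => ->.
move=> x; rewrite inE => /orP[xT|xS] xv.
  have [le bx h] := vb x xT xv.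
  by rewrite ff1 // f3x // /L; segs; clear - a0 b0 L0 le bx h; lia.
have [By _] := B2 x xS; have ly := rep_le R2 xS.
by rewrite ff2 // /L; segs; clear - a0 b0 L0 ly By; lia.
Qed.

Lemma rep_bound (G : sgraph) (S : {set G}) r : rep S r ->
  exists L, 0 <= L /\ forall x, x \in S ->
    (- L <= xl (r x) /\ xr (r x) <= L) /\ (- L <= yl (r x) /\ yr (r x) <= L).
Proof.
move=> _.
pose N x := `|xl (r x)| + `|xr (r x)| + `|yl (r x)| + `|yr (r x)|.
exists (\sum_(x : G) N x); split=> [|x _].
  by apply: Num.Theory.sumr_ge0 => x _; rewrite /N; lia.
have : N x <= \sum_(x : G) N x.
  rewrite (bigD1 x) //= Num.Theory.lerDl.
  by apply: Num.Theory.sumr_ge0 => y _; rewrite /N; lia.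
by rewrite /N; lia.
Qed.

(** The unrelated vertices are drawn far away in a quadrant, off the
    half-axes. *)
Lemma qrep_far (G : sgraph) l r u d (K S T : {set G}) :
  qrep l r u d K S -> (exists f, rep T f) -> glue S set0 T set0 ->
  qrep l r u d K (S :|: T).
Proof.
case=> KS [f1 [L1 [R1 L0 B1]]] [f2 R2] [dj g].
have [L2 [L20 B2]] := rep_bound R2.
pose c := L1 + L2 + 1; have R2' := rep_shift c c R2.
split; first exact: (subset_trans KS (subsetUl _ _)).
have [|f [R ff1 ff2]] := rep_glue R1 R2' dj.
  move=> x y xS yT; rewrite g // inE; have [h1 _] := B1 x xS; have h2 := rep_le R1 xS.
  have h3 := B2 y yT; have h4 := rep_le R2 yT.
  by rewrite /c; segs; clear - h1 h2 h3 h4 L0 L20; lia.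
exists f, (c + L2); split=> //; first by rewrite /c; lia.
move=> x; rewrite inE => /orP[xS|xT].
  rewrite ff1 //; have [h h'] := B1 x xS; split=> //.
  by rewrite /c; clear - h L0 L20; lia.
have -> : x \in K = false.
  by apply/negP=> /(subsetP KS) xS; move/pred0P/(_ x): dj; rewrite /= xS xT.
rewrite ff2 //; have h := B2 x xT; have h' := rep_le R2 xT.
split; last split; rewrite /hits /= /c; clear - h h' L0 L20; lia.
Qed.

Lemma rep_far (G : sgraph) (S T : {set G}) :
  (exists f, rep S f) -> (exists f, rep T f) -> glue S set0 T set0 ->
  exists f, rep (S :|: T) f.
Proof.
case=> f1 R1 [f2 R2] [dj g].
have [L1 [L10 B1]] := rep_bound R1; have [L2 [L20 B2]] := rep_bound R2.
pose c := L1 + L2 + 1; have R2' := rep_shift c c R2.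
have [|f [R _ _]] := rep_glue R1 R2' dj; last by exists f.
move=> x y xS yT; rewrite g // inE; have h1 := B1 x xS; have h2 := rep_le R1 xS.
have h3 := B2 y yT; have h4 := rep_le R2 yT.
by rewrite /c; segs; clear - h1 h2 h3 h4 L10 L20; lia.
Qed.


(** * Straight grid paths and segments *)

Definition on (p : gridpoint) (s : seg) : Prop :=
  (xl s <= p.1 /\ p.1 <= xr s) /\ (yl s <= p.2 /\ p.2 <= yr s).

Lemma meets_on s t : wf s -> wf t -> (meets s t <-> exists p, on p s /\ on p t).
Proof.
move=> ws wt; split=> [m | [p]]; last by move: ws wt; rewrite /on; segs; lia.
exists ((if xl s <= xl t then xl t else xl s), (if yl s <= yl t then yl t else yl s)).
by move: ws wt m; rewrite /on; segs; case: ifP; case: ifP; lia.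
Qed.

Definition seg_path (s : seg) : seq gridpoint :=
  if yl s == yr s then mkseq (fun i : nat => (xl s + i%:Z, yl s)) `|xr s - xl s|%N.+1
  else mkseq (fun i : nat => (xl s, yl s + i%:Z)) `|yr s - yl s|%N.+1.

Lemma mem_seg_path s p : wf s -> (p \in seg_path s <-> on p s).
Proof.
case: s => x x' y y'; case: p => a b; rewrite /wf /on /seg_path /= => w.
case: eqP => yy; split.
- by case/mapP=> i; rewrite mem_iota => h [-> ->]; lia.
- move=> h; apply/mapP; exists `|a - x|%N; first by rewrite mem_iota; lia.
  by congr (_, _); lia.
- by case/mapP=> i; rewrite mem_iota => h [-> ->]; lia.
- move=> h; apply/mapP; exists `|b - y|%N; first by rewrite mem_iota; lia.
  by congr (_, _); lia.
Qed.

Lemma sorted_mkseq (T : eqType) (e : rel T) (f : nat -> T) n :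
  (forall i, e (f i) (f i.+1)) -> sorted e (mkseq f n).
Proof.
move=> ef; rewrite /mkseq; case: n => //= n.
by elim: n 0%N => //= n IH m; rewrite ef IH.
Qed.

Lemma seg_path_grid s : grid_path (seg_path s).
Proof.
rewrite /grid_path /seg_path; case: ifP => _; apply/and3P; split=> //.
- by apply: sorted_mkseq => i; rewrite /grid_adj /=; lia.
- by apply: mkseq_uniq => i j [h]; lia.
- by apply: sorted_mkseq => i; rewrite /grid_adj /=; lia.
- by apply: mkseq_uniq => i j [h]; lia.
Qed.

Lemma seg_path_straight s : horizontal (seg_path s) \/ vertical (seg_path s).
Proof.
rewrite /seg_path; case: ifP => _; [left; exists (yl s) | right; exists (xl s)];
  by move=> p /mapP[i _ ->].
Qed.

Lemma rep_B0 (G H : sgraph) (S : {set G}) (f : H -> G) :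
  injective f -> (forall x y, sedge (f x) (f y) = sedge x y) ->
  (forall x, f x \in S) -> (exists r, rep S r) -> B0_VPG H.
Proof.
move=> inj ef fS [r [w e]]; exists (fun v => seg_path (r (f v))).
split=> [|v]; last exact: seg_path_straight.
split=> [v | u v uv]; first exact: seg_path_grid.
have [wu wv] := (w _ (fS u), w _ (fS v)).
rewrite -ef e ?fS // ?meets_on //; last by apply: contra_neq uv => /inj.
by split=> -[p [h1 h2]]; exists p; split; apply/mem_seg_path.
Qed.

(** Consecutive points of a straight path differ by one step, so the path
    covers an interval.  [f] is the moving coordinate and [g] the fixed one. *)
Lemma straight_interval (f g : gridpoint -> int) (s : seq gridpoint) c :
  (forall p q, grid_adj p q -> g p = g q -> f p = f q + 1 \/ f q = f p + 1) ->
  (forall p q, f p = f q -> g p = g q -> p = q) ->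
  s != [::] -> sorted grid_adj s -> (forall p, p \in s -> g p = c) ->
  exists a b, a <= b /\ forall p, p \in s <-> (g p = c /\ (a <= f p /\ f p <= b)).
Proof.
move=> adj inj; elim: s => // p [_ _ _ | q s IH _ /= /andP[e es] hc].
  move=> hc; exists (f p), (f p); split=> // q; split=> [|[h1 h2]].
    by rewrite inE => /eqP->; split; [apply: hc; rewrite inE | lia].
  by rewrite inE; apply/eqP/inj; [lia | rewrite h1 hc // inE].
have [||a [b [ab h]]] := IH _ es _ => //.
  by move=> p' p's; apply: hc; rewrite inE p's orbT.
have qi : q \in q :: s by rewrite inE eqxx.
have /h[gq fq] := qi.
have gp : g p = c by apply: hc; rewrite inE eqxx.
have fpq := adj p q e (etrans gp (esym gq)).
exists (if f p <= a then f p else a), (if b <= f p then f p else b).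
split; first by case: ifP; case: ifP; lia.
move=> x; rewrite inE; split=> [/predU1P[-> | /h[gx fx]] | [gx fx]].
- by split=> //; case: ifP; case: ifP; lia.
- by split=> //; case: ifP; case: ifP; lia.
have [xp | xp] := eqVneq (f x) (f p).
  by apply/orP; left; apply/eqP/inj; rewrite // gx.
apply/orP; right; apply/h; split=> //.
by move: fx; case: ifP; case: ifP; lia.
Qed.

Lemma B0_rep (G : sgraph) : B0_VPG G -> exists r, rep [set: G] r.
Proof.
case=> P [[gp e] st].
have seg_of v : exists s, wf s /\ forall p, p \in P v <-> on p s.
  have /and3P[n0 srt _] := gp v; case: (st v) => [[y hy]|[x hx]].
    have [| |a [b [ab h]]] := straight_interval (f := fst) (g := snd) _ _ n0 srt hy.
    - by move=> [? ?] [? ?] /=; rewrite /grid_adj /=; lia.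
    - by move=> [? ?] [? ?] /= -> ->.
    exists (Seg a b y y); split; first by segs; lia.
    by move=> p; rewrite h /on /=; lia.
  have [| |a [b [ab h]]] := straight_interval (f := snd) (g := fst) _ _ n0 srt hx.
  - by move=> [? ?] [? ?] /=; rewrite /grid_adj /=; lia.
  - by move=> [? ?] [? ?] /= -> ->.
  exists (Seg x x a b); split; first by segs; lia.
  by move=> p; rewrite h /on /=; lia.
have [r hr] := fin_all_exists seg_of; exists r.
split=> [u _ | u w _ _ uw]; first by case: (hr u).
have [wu hu] := hr u; have [ww hw] := hr w.
rewrite e // meets_on //.
by split=> -[p [h1 h2]]; exists p; [split; [apply/hu | apply/hw] | split; [apply/hu | apply/hw]].
Qed.

(** * Forced blocks *)

Lemma rep_common (G : sgraph) (A : {set G}) r u w :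
  rep A r -> u \in A -> w \in A -> u != w -> sedge u w ->
  exists p, on p (r u) /\ on p (r w).
Proof.
move=> R uA wA uw e; apply/meets_on; try exact: (rep_wf R).
by case: R => _ h; apply/h.
Qed.

Lemma rep_apart (G : sgraph) (A : {set G}) r u w p :
  rep A r -> u \in A -> w \in A -> u != w -> ~~ sedge u w ->
  on p (r u) -> ~ on p (r w).
Proof.
move=> R uA wA uw /negP e pu pw; apply: e; case: (R) => _ h; apply/h => //.
by apply/meets_on; try exact: (rep_wf R); exists p.
Qed.

Lemma int_argmax (T : finType) (A : {set T}) (f : T -> int) a :
  a \in A -> exists2 m, m \in A & forall x, x \in A -> f x <= f m.
Proof.
move=> aA; case: (Order.TotalTheory.arg_maxP (P := mem A) f aA) => m mA h.
by exists m => // x /h.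
Qed.

(** Helly property: intervals that meet pairwise contain the largest of their
    left ends, and this applies to both coordinates. *)
Lemma rep_helly (G : sgraph) (A K : {set G}) r k :
  rep A r -> K \subset A -> k \in K -> {in K &, forall u w, u != w -> sedge u w} ->
  exists p, forall u, u \in K -> on p (r u).
Proof.
move=> R KA kK cl.
have m u w : u \in K -> w \in K -> meets (r u) (r w).
  move=> uK wK; have [-> | uw] := eqVneq u w.
    by have := rep_le R (subsetP KA _ wK); segs; lia.
  by case: (R) => _ h; apply/h; rewrite ?(subsetP KA) //; apply: cl.
have [i iK hi] := int_argmax (fun u => xl (r u)) kK.
have [j jK hj] := int_argmax (fun u => yl (r u)) kK.
exists (xl (r i), yl (r j)) => u uK; rewrite /on /=.
by have := hi u uK; have := hj u uK; have := m u i uK iK; have := m u j uK jK; segs; lia.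
Qed.

(** The direction in which [q] is seen from [p], for points on a common
    horizontal or vertical line. *)
Definition dir (p q : gridpoint) : nat :=
  if p.1 < q.1 then 0 else if q.1 < p.1 then 1 else if p.2 < q.2 then 2 else 3.

Lemma dir_lt p q : (dir p q < 4)%N.
Proof. by rewrite /dir; do !case: ifP. Qed.

(** On two segments through [p], two points seen in the same direction lie on
    a common ray, so that the nearer one belongs to both segments. *)
Lemma dir_neq s t p q q' : wf s -> wf t -> on p s -> on p t -> on q s -> on q' t ->
  ~ on q t -> ~ on q' s -> dir p q != dir p q'.
Proof.
move=> ws wt ps pt qs qt' qt qs'.
have qp : q.1 <> p.1 \/ q.2 <> p.2 by move: pt qt; rewrite /on; lia.
have qp' : q'.1 <> p.1 \/ q'.2 <> p.2 by move: ps qs'; rewrite /on; lia.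
have h : (q.1 = p.1 \/ q.2 = p.2) /\ (q'.1 = p.1 \/ q'.2 = p.2).
  by move: ws wt ps pt qs qt'; rewrite /on /wf; clear; lia.
apply/eqP; rewrite /dir; move: ps pt qs qt' qt qs' qp qp' h; rewrite /on; clear.
by do !case: ifP => ?; lia.
Qed.

Lemma five_dirs p q1 q2 q3 q4 q5 :
  uniq [:: dir p q1; dir p q2; dir p q3; dir p q4; dir p q5] -> False.
Proof.
move=> u; suff : (5 <= size (iota 0 4))%N by [].
apply: (uniq_leq_size u) => x; rewrite mem_iota !inE /=.
by case/or4P=> [/eqP->|/eqP->|/eqP->|/orP[/eqP->|/eqP->]]; rewrite dir_lt.
Qed.

Section Drawing.
Variables (G : sgraph) (A : {set G}) (r : G -> seg).
Hypothesis R : rep A r.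

Lemma apart_on u w p : u \in A -> w \in A -> apart u w -> on p (r u) -> ~ on p (r w).
Proof. by move=> uA wA /andP[uw e]; apply: rep_apart R uA wA uw e. Qed.

(** The situation of [dir_neq] in a representation: the points [q] and [q'] lie
    on segments of vertices [w] and [w'] that tell the two members [a] and [b] of
    a block apart. *)
Lemma dir_legs p a w q b w' q' :
  [/\ a \in A, b \in A, w \in A & w' \in A] -> on p (r a) -> on p (r b) ->
  on q (r a) -> on q (r w) -> on q' (r b) -> on q' (r w') ->
  apart b w -> apart a w' -> dir p q != dir p q'.
Proof.
move=> [aA bA wA wA'] pa pb qa qw qb qw' bw aw'.
apply: (@dir_neq (r a) (r b)) => //; try exact: (rep_wf R).
  by apply: apart_on qw; rewrite // apartC.
by apply: apart_on qw'; rewrite // apartC.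
Qed.

Lemma apart_neq u w p q : u \in A -> w \in A -> apart u w ->
  on p (r u) -> on q (r w) -> p <> q.
Proof. by move=> uA wA uw pu qw pq; apply: (apart_on uA wA uw pu); rewrite pq. Qed.

(** If from both [pa] and [pb] the point [p] and the other one are seen in the
    same direction, then [p] lies between them. *)
Lemma between_dir s p pa pb : wf s -> on p s -> on pa s -> on pb s ->
  p <> pa -> p <> pb -> pa <> pb ->
  dir pa p = dir pa pb -> dir pb p = dir pb pa -> dir p pa != dir p pb.
Proof.
case: s => x x' y y'; case: p pa pb => [a b] [a1 b1] [a2 b2].
rewrite /wf /on /dir /= => w h h1 h2 n1 n2 n3.
have {}n1 : a <> a1 \/ b <> b1.
  by case: (eqVneq a a1) n1 => [-> n1 | ]; [right=> bb; apply: n1; rewrite bb | lia].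
have {}n2 : a <> a2 \/ b <> b2.
  by case: (eqVneq a a2) n2 => [-> n2 | ]; [right=> bb; apply: n2; rewrite bb | lia].
have {}n3 : a1 <> a2 \/ b1 <> b2.
  by case: (eqVneq a1 a2) n3 => [-> n3 | ]; [right=> bb; apply: n3; rewrite bb | lia].
have {w h h1 h2} : (b = b1 /\ b = b2) \/ (a = a1 /\ a = a2) by lia.
by case=> [[? ?]|[? ?]]; subst; rewrite ?Order.POrderTheory.ltxx; do !case: ifP => ?; lia.
Qed.

(** All other blocks at [y] are seen from [p] in the same direction, that is,
    [p] is an end of the part of the segment that carries blocks.  Other blocks
    are represented by their vertices, which are apart from the part [W] that
    belongs to the block at [p]. *)
Definition one_sided (y : G) (W : {set G}) (p : gridpoint) : Prop :=
  forall z1 z2 q1 q2, z1 \in A -> z2 \in A -> on q1 (r y) -> on q2 (r y) ->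
    on q1 (r z1) -> on q2 (r z2) -> {in W, forall w, apart z1 w} ->
    {in W, forall w, apart z2 w} -> dir p q1 = dir p q2.

(** The three cutpoints of [quad] use three directions at [p], so the remaining
    legs, of [a] and of [b], share the fourth.  For a block with four cutpoints,
    [a] and [b] are the vertex it hangs at; for one with five they are
    distinct. *)
Lemma quad_legs K W p a b z1 z2 q1 q2 : realizes quad K W -> W \subset A ->
  (forall k, k \in K -> on p (r k)) -> [/\ a \in A, b \in A, z1 \in A & z2 \in A] ->
  on p (r a) -> on p (r b) -> on q1 (r a) -> on q2 (r b) -> on q1 (r z1) -> on q2 (r z2) ->
  glue [set a] [set a] W K -> glue [set b] [set b] W K ->
  {in W, forall w, apart z1 w} -> {in W, forall w, apart z2 w} -> dir p q1 = dir p q2.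
Proof.
move=> [Ra] [Sa] [K'] [W'] [/pendantP[c1 [s1 [-> -> n1 e1]]]].
move=> [Rb] [Sb] [Rc] [Sc] [/pendantP[c2 [s2 [-> -> n2 e2]]]].
move=> /pendantP[c3 [s3 [-> -> n3 e3]]] g23 -> -> g1 -> -> WA hp.
move=> [aA bA z1A z2A] pa pb qa qb qz1 qz2 ga gb az1 az2.
have [|||g12 g13] := (glueUr _ _ _ _ _).1 g1; rewrite ?subsetUl //; first by case: g23.
have [m12 e12 a12 b12 d12] := glue_pendants n1 n2 g12.
have [m13 e13 a13 b13 d13] := glue_pendants n1 n3 g13.
have [m23 e23 a23 b23 d23] := glue_pendants n2 n3 g23.
have mem := subsetP WA.
have [[c1A s1A] [c2A s2A] [c3A s3A]] : [/\ c1 \in A /\ s1 \in A,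
    c2 \in A /\ s2 \in A & c3 \in A /\ s3 \in A].
  by split; split; apply: mem; rewrite !inE eqxx ?orbT.
have offK : [/\ s1 \notin c1 |: [set c2; c3], s2 \notin c1 |: [set c2; c3] &
    s3 \notin c1 |: [set c2; c3]].
  have ne (u v : G) : apart u v -> u != v by case/andP.
  split; rewrite !inE !negb_or ![_ == c1]eq_sym.
  - by rewrite n1 (ne _ _ b12) (ne _ _ b13).
  - by rewrite (ne _ _ a12) eq_sym n2 (ne _ _ b23).
  - by rewrite (ne _ _ a13) eq_sym (ne _ _ a23) eq_sym n3.
have [sW1 sW2 sW3] : [/\ s1 \in [set c1; s1] :|: ([set c2; s2] :|: [set c3; s3]),
    s2 \in [set c1; s1] :|: ([set c2; s2] :|: [set c3; s3]) &
    s3 \in [set c1; s1] :|: ([set c2; s2] :|: [set c3; s3])].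
  by split; rewrite !inE eqxx ?orbT.
have off y s : glue [set y] [set y] ([set c1; s1] :|: ([set c2; s2] :|: [set c3; s3]))
    (c1 |: [set c2; c3]) -> s \notin c1 |: [set c2; c3] -> 
    s \in [set c1; s1] :|: ([set c2; s2] :|: [set c3; s3]) -> apart y s.
  by move=> g sK sW; apply: (glue_apart g); rewrite ?set11 ?sK ?orbT.
have [p1 p2 p3] : [/\ on p (r c1), on p (r c2) & on p (r c3)].
  by split; apply: hp; rewrite !inE eqxx ?orbT.
have [[z11 z12 z13] [z21 z22 z23]] :
    [/\ apart z1 c1, apart z1 c2 & apart z1 c3] /\ [/\ apart z2 c1, apart z2 c2 & apart z2 c3].
  by split; split; (apply: az1 || apply: az2); rewrite !inE eqxx ?orbT.
have [t1 [tc1 ts1]] := rep_common R c1A s1A n1 e1.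
have [t2 [tc2 ts2]] := rep_common R c2A s2A n2 e2.
have [t3 [tc3 ts3]] := rep_common R c3A s3A n3 e3.
have dy c s t y i e : c \in A -> s \in A -> on p (r c) -> on t (r c) -> on t (r s) ->
    apart y s -> i \in A -> y \in A -> on p (r y) -> apart i c -> on e (r i) -> on e (r y) ->
    dir p e != dir p t.
  move=> cA sA pc tc ts ys iA yA py ic ei ey.
  by apply: (dir_legs (a := y) (w := i) (b := c) (w' := s)); rewrite // apartC.
have f12 : dir p t1 != dir p t2.
  by apply: (dir_legs (a := c1) (w := s1) (b := c2) (w' := s2)); rewrite // apartC.
have f13 : dir p t1 != dir p t3.
  by apply: (dir_legs (a := c1) (w := s1) (b := c3) (w' := s3)); rewrite // apartC.
have f23 : dir p t2 != dir p t3.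
  by apply: (dir_legs (a := c2) (w := s2) (b := c3) (w' := s3)); rewrite // apartC.
have [o1 o2 o3] := offK.
apply/eqP/negPn/negP => nq.
apply: (@five_dirs p q1 q2 t1 t2 t3); rewrite /= !inE !negb_or nq !andbT f12 f13 f23.
rewrite (dy c1 s1 t1 a z1) ?(off a) // (dy c2 s2 t2 a z1) ?(off a) // (dy c3 s3 t3 a z1) ?(off a) //.
by rewrite (dy c1 s1 t1 b z2) ?(off b) // (dy c2 s2 t2 b z2) ?(off b) // (dy c3 s3 t3 b z2) ?(off b).
Qed.

Lemma block_point q K W y : flat q -> realizes q K W -> W \subset A -> y \in A ->
  glue [set y] [set y] W K ->
  exists p, on p (r y) /\ forall k, k \in K -> on p (r k).
Proof.
move=> fq rq WA yA gy; have KW := realizes_sub rq.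
have cl := glue_clique gy KW (flat_clique fq rq).
have KA : y |: K \subset A by rewrite subUset sub1set yA (subset_trans KW).
have [p hp] := rep_helly R KA (setU11 _ _) cl.
by exists p; split=> [|k kK]; apply: hp; rewrite inE ?set11 // kK orbT.
Qed.

(** A forced block lies at an end of the segment of the vertex it hangs at:
    the cutpoints of the block use up the other three directions at the
    common point of the block. *)
Lemma forced_end q K W y p : forced q -> realizes q K W -> W \subset A -> y \in A ->
  glue [set y] [set y] W K -> on p (r y) -> (forall k, k \in K -> on p (r k)) ->
  one_sided y W p.
Proof.
move=> fq; elim: fq K W y p => [|a b fa IHa fb IHb] K W y p.
  move=> rq WA yA gy py pK z1 z2 q1 q2 z1A z2A qy1 qy2 qz1 qz2 az1 az2.
  exact: (quad_legs rq WA pK (a := y) (b := y) (z1 := z1) (z2 := z2)).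
move=> [Rp] [Sp] [Rq] [Sq] [/pendantP[c [s [-> -> ncs ecs]]]].
move=> /two_hungP[w [Ka [Wa [Kb [Wb [ra rb [gwa gwb gab] -> ->]]]]]] gp -> -> WA yA gy py pK.
have mem := subsetP WA.
have [cA sA wA] : [/\ c \in A, s \in A & w \in A].
  by split; apply: mem; rewrite !inE eqxx ?orbT.
have WaA : Wa \subset A by apply/subsetP=> x xW; apply: mem; rewrite !inE xW ?orbT.
have WbA : Wb \subset A by apply/subsetP=> x xW; apply: mem; rewrite !inE xW ?orbT.
have [pa [paw pak]] := block_point (forced_flat fa) ra WaA wA gwa.
have [pb [pbw pbk]] := block_point (forced_flat fb) rb WbA wA gwb.
have pa1 := IHa Ka Wa w pa ra WaA wA gwa paw pak.
have pb1 := IHb Kb Wb w pb rb WbA wA gwb pbw pbk.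
have [ka kaK] := realizes_root ra; have [kb kbK] := realizes_root rb.
have kaW := subsetP (realizes_sub ra) _ kaK; have kbW := subsetP (realizes_sub rb) _ kbK.
have kaA := subsetP WaA _ kaW; have kbA := subsetP WbA _ kbW.
have nw x : x \in Wa :|: Wb -> x != w.
  rewrite inE eq_sym => /orP[] xW; apply/eqP=> xw.
    by case: gwa => /pred0P/(_ x)/=; rewrite xw inE eqxx xW.
  by case: gwb => /pred0P/(_ x)/=; rewrite xw inE eqxx xW.
have cx x z : z \in [set c; s] -> x \in Wa :|: Wb -> apart z x.
  move=> zc xW; apply: (glue_apart gp zc); first by rewrite inE xW orbT.
  by rewrite !inE nw // orbT.
have yx x : x \in Wa :|: Wb -> apart y x.
  move=> xW; apply: (glue_apart gy (set11 y)); first by do 2![apply/setUP; right].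
  rewrite !inE negb_or nw // andbT; apply/orP; right.
  by have /andP[] := cx x c (set21 _ _) xW; rewrite eq_sym.
have ab x x' : x \in Wa -> x' \in Wb -> apart x x'.
  by move=> xa xb; apply: (glue_apart gab); rewrite ?inE.
have asw : apart s w.
  by apply: (glue_apart gp); rewrite !inE ?eqxx ?orbT // eq_sym ncs.
have ays : apart y s.
  apply: (glue_apart gy); rewrite !inE ?eqxx ?orbT // negb_or [s == c]eq_sym ncs.
  by case/andP: asw => ->; rewrite orbT.
have [pc pw] : on p (r c) /\ on p (r w) by split; apply: pK; rewrite !inE eqxx ?orbT.
have ia x : x \in Wa -> x \in Wa :|: Wb by rewrite inE => ->.
have ib x : x \in Wb -> x \in Wa :|: Wb by rewrite inE orbC => ->.
have da : dir pa p = dir pa pb.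
  apply: (pa1 y kb) => // [|x xW|x xW]; first exact: pbk.
    exact: yx (ia _ xW).
  by rewrite apartC; apply: ab.
have db : dir pb p = dir pb pa.
  apply: (pb1 y ka) => // [|x xW|x xW]; first exact: pak.
    exact: yx (ib _ xW).
  exact: ab.
have pka := pak _ kaK; have pkb := pbk _ kbK.
have yka := yx _ (ia _ kaW); have ykb := yx _ (ib _ kbW).
have dab : dir p pa != dir p pb.
  apply: (between_dir (rep_wf R wA)) => //.
  - exact: (apart_neq yA kaA yka py pka).
  - exact: (apart_neq yA kbA ykb py pkb).
  - exact: (apart_neq kaA kbA (ab _ _ kaW kbW) pka pkb).
move=> z1 z2 q1 q2 z1A z2A qy1 qy2 qz1 qz2 az1 az2; apply/eqP.
have [z1c z1w] : apart z1 c /\ apart z1 w by split; apply: az1; rewrite !inE eqxx ?orbT.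
have [z2c z2w] : apart z2 c /\ apart z2 w by split; apply: az2; rewrite !inE eqxx ?orbT.
have [t [tc ts]] := rep_common R cA sA ncs ecs.
apply/negPn/negP => nq.
apply: (@five_dirs p q1 q2 pa pb t); rewrite /= !inE !negb_or nq dab !andbT.
have cka := cx _ _ (set21 c s) (ia _ kaW); have ckb := cx _ _ (set21 c s) (ib _ kbW).
have h0 : dir p q1 != dir p pa.
  by apply: (dir_legs (a := y) (w := z1) (b := w) (w' := ka)); rewrite // apartC.
have h1 : dir p q1 != dir p pb.
  by apply: (dir_legs (a := y) (w := z1) (b := w) (w' := kb)); rewrite // apartC.
have h2 : dir p q1 != dir p t.
  by apply: (dir_legs (a := y) (w := z1) (b := c) (w' := s)); rewrite // apartC.
have h3 : dir p q2 != dir p pa.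
  by apply: (dir_legs (a := y) (w := z2) (b := w) (w' := ka)); rewrite // apartC.
have h4 : dir p q2 != dir p pb.
  by apply: (dir_legs (a := y) (w := z2) (b := w) (w' := kb)); rewrite // apartC.
have h5 : dir p q2 != dir p t.
  by apply: (dir_legs (a := y) (w := z2) (b := c) (w' := s)); rewrite // apartC.
have h6 : dir p pa != dir p t.
  by apply: (dir_legs (a := w) (w := ka) (b := c) (w' := s)); rewrite // apartC.
have h7 : dir p pb != dir p t.
  by apply: (dir_legs (a := w) (w := kb) (b := c) (w' := s)); rewrite // apartC.
by rewrite h0 h1 h2 h3 h4 h5 h6 h7.
Qed.

Lemma no_three_ends s pa pb pc : wf s -> on pa s -> on pb s -> on pc s ->
  pa <> pb -> pa <> pc -> pb <> pc ->
  dir pa pb = dir pa pc -> dir pb pa = dir pb pc -> dir pc pa = dir pc pb -> False.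
Proof.
move=> w oa ob oc ab ac bc da db dc.
by have /negP[] := between_dir w oc oa ob (nesym ac) (nesym bc) ab (esym da) (esym db); rewrite dc.
Qed.
End Drawing.

(** The obstructions have no representation: of three forced blocks hanging at
    a vertex, one would have to lie between the other two. *)
Lemma obstruction_norep (G : sgraph) (R S : {set G}) r t :
  obstruction t -> realizes t R S -> ~ rep S r.
Proof.
case=> [|a b c fa fb fc] rt rS.
  have cl := flat_clique (t := spider5) isT rt.
  have RS := realizes_sub rt; have [k kR] := realizes_root rt.
  have [p hp] := rep_helly rS RS kR cl.
  move: rt rS RS hp {cl k kR} => [Ra] [Sa] [K1] [S1] [/pendantP[c1 [s1 [-> -> n1 e1]]]].
  move=> [Rb] [Sb] [K] [W] [/pendantP[c2 [s2 [-> -> n2 e2]]]] rq g2 -> -> g1 -> -> rS RS hp.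
  have KW : K \subset W := realizes_sub (t := quad) rq.
  have [|//||g12 g1q] := (glueUr _ _ _ _ _).1 g1; rewrite ?subsetUl //; first by case: g2.
  have [m12 e12 a12 b12 d12] := glue_pendants n1 n2 g12.
  have [c1S s1S c2S s2S] : [/\ c1 \in [set c1; s1] :|: ([set c2; s2] :|: W),
      s1 \in [set c1; s1] :|: ([set c2; s2] :|: W),
      c2 \in [set c1; s1] :|: ([set c2; s2] :|: W) &
      s2 \in [set c1; s1] :|: ([set c2; s2] :|: W)] by split; rewrite !inE eqxx ?orbT.
  have [t1 [tc1 ts1]] := rep_common rS c1S s1S n1 e1.
  have [t2 [tc2 ts2]] := rep_common rS c2S s2S n2 e2.
  have WS : W \subset [set c1; s1] :|: ([set c2; s2] :|: W).
    by apply/subsetP=> x xW; rewrite !inE xW !orbT.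
  have [p1 p2] : on p (r c1) /\ on p (r c2) by split; apply: hp; rewrite !inE eqxx ?orbT.
  have pK k : k \in K -> on p (r k) by move=> kK; apply: hp; rewrite !inE kK !orbT.
  have sub (c s : G) : glue [set c; s] [set c] W K -> glue [set c] [set c] W K.
    move=> g; have := glueS (subsetUl [set c] [set s]) (subxx W) g.
    by rewrite (setIidPr KW) setIid.
  have sx (c s x : G) : c != s -> glue [set c; s] [set c] W K -> x \in W -> apart s x.
    by move=> cs g xW; apply: (glue_apart g); rewrite ?set22 // inE eq_sym cs.
  have := dir_legs (p := p) (a := c1) (w := s1) (q := t1) (b := c2) (w' := s2) (q' := t2) rS.
  move=> /(_ (And4 c1S c2S s1S s2S) p1 p2 tc1 ts1 tc2 ts2); rewrite apartC.
  move=> /(_ b12 a12)/eqP; apply.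
  apply: (quad_legs rS rq WS pK (a := c1) (b := c2) (z1 := s1) (z2 := s2)) => //.
  - exact: sub g1q.
  - exact: sub g2.
  - by move=> x; apply: sx g1q.
  - by move=> x; apply: sx g2.
have [w [Ka [Wa [Kb [Wb [Kc [Wc]]]]]]] := cherryP rt.
move=> [[ra rb rc] [ga gb gc] [gab gac gbc] eR eS].
have wS : w \in S by rewrite eS setU11.
have WaS : Wa \subset S by apply/subsetP=> x xW; rewrite eS !inE xW !orbT.
have WbS : Wb \subset S by apply/subsetP=> x xW; rewrite eS !inE xW !orbT.
have WcS : Wc \subset S by apply/subsetP=> x xW; rewrite eS !inE xW !orbT.
have [pa [paw pak]] := block_point rS (forced_flat fa) ra WaS wS ga.
have [pb [pbw pbk]] := block_point rS (forced_flat fb) rb WbS wS gb.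
have [pc [pcw pck]] := block_point rS (forced_flat fc) rc WcS wS gc.
have pa1 := forced_end rS fa ra WaS wS ga paw pak.
have pb1 := forced_end rS fb rb WbS wS gb pbw pbk.
have pc1 := forced_end rS fc rc WcS wS gc pcw pck.
have [ka kaK] := realizes_root ra; have [kb kbK] := realizes_root rb.
have [kc kcK] := realizes_root rc.
have kaW := subsetP (realizes_sub ra) _ kaK; have kaS := subsetP WaS _ kaW.
have kbW := subsetP (realizes_sub rb) _ kbK; have kbS := subsetP WbS _ kbW.
have kcW := subsetP (realizes_sub rc) _ kcK; have kcS := subsetP WcS _ kcW.
have ab x y : x \in Wa -> y \in Wb -> apart x y.
  by move=> xa yb; apply: (glue_apart gab); rewrite ?inE.
have ac x y : x \in Wa -> y \in Wc -> apart x y.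
  by move=> xa yb; apply: (glue_apart gac); rewrite ?inE.
have bc x y : x \in Wb -> y \in Wc -> apart x y.
  by move=> xa yb; apply: (glue_apart gbc); rewrite ?inE.
have [pka pkb pkc] := And3 (pak _ kaK) (pbk _ kbK) (pck _ kcK).
apply: (@no_three_ends (r w) pa pb pc (rep_wf rS wS)) => //.
- exact: (apart_neq rS kaS kbS (ab _ _ kaW kbW)).
- exact: (apart_neq rS kaS kcS (ac _ _ kaW kcW)).
- exact: (apart_neq rS kbS kcS (bc _ _ kbW kcW)).
- by apply: (pa1 kb kc) => // x xW; rewrite apartC; [apply: ab | apply: ac].
- by apply: (pb1 ka kc) => // x xW; [apply: ab | rewrite apartC; apply: bc].
- by apply: (pc1 ka kb) => // x xW; [apply: ac | apply: bc].
Qed.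

Local Close Scope ring_scope.

(** * Deleting a vertex from an obstruction *)

Lemma glue_set0 (G : sgraph) (S R R' : {set G}) : glue S R set0 R'.
Proof. by split=> [|u w _]; rewrite ?in_set0 // disjoint_sym disjoints_subset sub0set. Qed.

Lemma glue_del (G : sgraph) (S1 R1 S2 R2 : {set G}) u :
  glue S1 R1 S2 R2 -> glue S1 R1 (S2 :\ u) (R2 :\ u).
Proof.
case=> d g; split; first by apply: disjointWr d; apply: subsetDl.
by move=> x y xS; rewrite !inE => /andP[-> yS]; apply: g.
Qed.

Lemma setUD1 (T : finType) (A B : {set T}) u :
  [disjoint A & B] -> u \in A -> (A :|: B) :\ u = (A :\ u) :|: B.
Proof.
move=> d uA; apply/setP=> x; rewrite !inE; case: eqP => //= ->.
by move/pred0P/(_ u): d; rewrite /= uA /= => ->.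
Qed.

Lemma setUD1r (T : finType) (A B : {set T}) u :
  [disjoint A & B] -> u \in B -> (A :|: B) :\ u = A :|: (B :\ u).
Proof. by move=> d uB; rewrite setUC setUD1 // 1?disjoint_sym // setUC. Qed.

Lemma qrep1 (G : sgraph) (w : G) : qrep true true true true [set w] [set w].
Proof.
have := qrep_add_point (qrep_set0 G) (w := w); rewrite !setU0; apply.
exact: glue_set0.
Qed.

Lemma pendant_vrep (G : sgraph) (R S : {set G}) : realizes pendant R S ->
  exists c, R = [set c] /\ vrep false true c S.
Proof.
case=> R1 [S1] [R2] [S2] [[c [-> ->]] [s [-> ->]] g -> ->]; exists c; split=> //.
exact: vrep_attach (vrep1 c) (qrep1 s) g.
Qed.

Lemma qrep_pendant (G : sgraph) l u d (R S K W : {set G}) :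
  realizes pendant R S -> qrep l true u d K W -> glue S R W K ->
  qrep l false u d (R :|: K) (S :|: W).
Proof.
case/pendant_vrep=> c [-> v] q g.
by have := qrep_add v q _ g; rewrite andbT; apply.
Qed.

Lemma qrep_vrep (G : sgraph) lu ro v (S : {set G}) :
  vrep lu ro v S -> qrep (~~ lu) false true true [set v] S.
Proof.
move=> h; have := qrep_add h (qrep_set0 G) (fun=> isT) (glue_set0 _ _ _).
by rewrite !setU0.
Qed.

(** Deleting the root of the pendant edge leaves its other end isolated, and
    deleting the other end leaves a vertex without other blocks; neither uses a
    direction. *)
Lemma pendant_del (G : sgraph) l r u d (R S K W : {set G}) x :
  realizes pendant R S -> qrep l r u d K W -> glue S R W K -> x \in S ->
  qrep l r u d ((R :|: K) :\ x) ((S :|: W) :\ x).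
Proof.
case/pendantP=> c [s [-> -> ncs e]] q g xS.
have KW : K \subset W by case: q.
have d1 : [disjoint [set c; s] & W] by case: g.
have d2 : [disjoint [set c] & K] by apply: disjointW d1; rewrite // subsetUl.
move: xS; rewrite !inE => /orP[] /eqP->.
  rewrite setUD1 ?set11 // setDv set0U setUD1 ?set21 // setUC.
  have -> : [set c; s] :\ c = [set s].
    by apply/setP=> y; rewrite !inE; case: eqP => //= ->; rewrite (negbTE ncs).
  apply: qrep_far => //; first exact: qrep_rep (qrep1 s).
  apply: glueC; apply/(glue0 _ _ K).
  have := glueS (subsetUr [set c] [set s]) (subxx W) g.
  rewrite (setIidPr KW); suff -> : [set s] :&: [set c] = set0 by [].
  by apply/setP=> y; rewrite !inE; case: eqP => //= ->; rewrite eq_sym (negbTE ncs).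
have sK : s \notin K.
  by apply/negP=> /(subsetP KW) sW; move/pred0P/(_ s): d1; rewrite /= set22 sW.
have sW : s \notin W.
  by apply/negP=> sW; move/pred0P/(_ s): d1; rewrite /= set22 sW.
have -> : (c |: K) :\ s = c |: K.
  apply/setP=> y; rewrite !inE; case: eqP => //= ->.
  by rewrite (negbTE sK) eq_sym (negbTE ncs).
have -> : ([set c; s] :|: W) :\ s = c |: W.
  apply/setP=> y; rewrite !inE; case: eqP => //= [->|_]; last by rewrite orbF.
  by rewrite (negbTE sW) eq_sym (negbTE ncs).
apply: qrep_add_point => //.
have := glueS (subsetUl [set c] [set s]) (subxx W) g.
by rewrite (setIidPr KW) setIid.
Qed.

Fixpoint pendants (n : nat) : plan :=
  if n is n'.+1 then Join pendant (pendants n') else pendant.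

(** The pendant edges of a thin spider can be permuted, so that the deleted
    vertex may be assumed to belong to the first one. *)
Lemma pendants_pull (G : sgraph) n (K W : {set G}) x :
  realizes (pendants n.+1) K W -> x \in W ->
  exists R1 S1 R2 S2, [/\ realizes pendant R1 S1, realizes (pendants n) R2 S2,
    glue S1 R1 S2 R2, K = R1 :|: R2 & W = S1 :|: S2 /\ x \in S1].
Proof.
elim: n K W => [|n IH] K W [R1] [S1] [R2] [S2] [r1 r2 g -> ->].
  rewrite inE => /orP[xS|xS]; first by exists R1, S1, R2, S2.
  by exists R2, S2, R1, S1; split; rewrite 1?setUC //; apply: glueC.
rewrite inE => /orP[xS|xS]; first by exists R1, S1, R2, S2.
have [R3 [S3 [R4 [S4 [r3 r4 g34 eR [eS xS3]]]]]] := IH _ _ r2 xS.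
have [s1 s3 s4] := And3 (realizes_sub (t := pendant) r1) (realizes_sub r3)
  (realizes_sub (t := pendants n) r4).
move: g; rewrite eR eS => /glueUr[//|//||g13 g14]; first by case: g34.
exists R3, S3, (R1 :|: R4), (S1 :|: S4); split; rewrite 1?setUCA //.
  by exists R1, S1, R4, S4.
by apply/glueUr => //; [case: g14 | split => //; apply: glueC].
Qed.

Lemma pendants1_qrep (G : sgraph) (K W : {set G}) :
  realizes (pendants 1) K W -> qrep true true false false K W.
Proof.
case=> R1 [S1] [R2] [S2] [r1 /pendant_vrep[c [-> v]] g -> ->].
have := qrep_vrep v => /qrep_turn/qrep_turn q.
exact/qrep_turn/(qrep_pendant r1 q g).
Qed.

Lemma two_hung_vrep (G : sgraph) (w : G) (Ka Wa Kb Wb : {set G}) :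
  glue [set w] [set w] Wa Ka -> glue [set w] [set w] Wb Kb -> glue Wa set0 Wb set0 ->
  qrep true false false false Ka Wa -> qrep true false false false Kb Wb ->
  vrep true false w ([set w] :|: (Wa :|: Wb)).
Proof.
move=> ga gb gab qa qb; rewrite setUA; apply: (vrep_two_ends _ qb).
  exact: vrep_end (vrep1 w) qa ga.
by apply/glueHl => //; [case: ga | split=> //; apply/(glue0 _ _ Kb)].
Qed.

(** Once a vertex is deleted from one of two forced blocks, that block no longer
    has to be at an end, and the other one takes the right end. *)
Lemma two_hung_del (G : sgraph) (w x : G) (Ka Wa Kb Wb : {set G}) :
  glue [set w] [set w] Wa Ka -> glue [set w] [set w] Wb Kb -> glue Wa set0 Wb set0 ->
  qrep true true false false (Ka :\ x) (Wa :\ x) -> qrep true false false false Kb Wb ->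
  x \in Wa -> vrep false false w (([set w] :|: (Wa :|: Wb)) :\ x).
Proof.
move=> ga gb gab qa qb xW; rewrite setUA.
have dw : [disjoint [set w] & Wa] by case: ga.
have dab : [disjoint Wa & Wb] by case: gab.
have dwb : [disjoint [set w] & Wb] by case: gb.
rewrite setUD1; last by rewrite inE xW orbT.
  rewrite setUD1r //; apply: (vrep_end _ qb).
    apply: vrep_attach (vrep1 w) qa _; exact: glue_del.
  apply/glueHl => //; first by apply: disjointWr dw; apply: subsetDl.
  split=> //; apply/(glue0 _ _ Kb); have := glueS (subsetDl Wa [set x]) (subxx Wb) gab.
  by rewrite !setI0.
by rewrite -setI_eq0 setIUl setU_eq0 !setI_eq0 dwb.
Qed.

Lemma forced_qrep (G : sgraph) q (K W : {set G}) :
  forced q -> realizes q K W -> qrep true false false false K W.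
Proof.
move=> fq; elim: fq K W => [|a b fa IHa fb IHb] K W.
  move=> [R1] [S1] [R2] [S2] [r1 /pendants1_qrep Q g -> ->].
  exact: qrep_pendant r1 Q g.
move=> [R1] [S1] [R2] [S2] [r1 /two_hungP[w [Ka [Wa [Kb [Wb h]]]]] g -> ->].
case: h g => ra rb [ga gb gab] -> -> g.
have v := two_hung_vrep ga gb gab (IHa _ _ ra) (IHb _ _ rb).
have := qrep_vrep v => /qrep_turn Q.
exact: qrep_pendant r1 Q g.
Qed.

(** A forced block is no longer forced when a vertex is deleted: there remains a
    free line through it. *)
Lemma forced_del (G : sgraph) q (K W : {set G}) x :
  forced q -> realizes q K W -> x \in W ->
  qrep true true false false (K :\ x) (W :\ x).
Proof.
move=> fq; elim: fq K W => [|a b fa IHa fb IHb] K W.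
  move=> /(pendants_pull (n := 1)) h /h[R1 [S1 [R2 [S2 [r1 /pendants1_qrep Q g -> [-> xS]]]]]].
  exact: pendant_del r1 Q g xS.
move=> [R1] [S1] [R2] [S2] [r1 /two_hungP[w [Ka [Wa [Kb [Wb h]]]]] g -> ->].
case: h g => ra rb [ga gb gab] -> -> g.
have [qa qb] := (forced_qrep fa ra, forced_qrep fb rb).
have d : [disjoint S1 & [set w] :|: (Wa :|: Wb)] by case: g.
have d1 : [disjoint R1 & [set w]].
  by apply: disjointW d; [exact: (realizes_sub (t := pendant) r1) | exact: subsetUl].
have [c [eR vc]] := pendant_vrep r1.
have one : vrep false false w (([set w] :|: (Wa :|: Wb)) :\ x) -> x \in Wa :|: Wb ->
    qrep true true false false ((R1 :|: [set w]) :\ x) ((S1 :|: ([set w] :|: (Wa :|: Wb))) :\ x).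
  move=> v xW; have xwW : x \in [set w] :|: (Wa :|: Wb) by rewrite inE xW orbT.
  have g' := glue_del x g.
  rewrite [(S1 :|: _) :\ x]setUD1r //.
  have xw : x != w.
    apply/eqP=> xw; move: xW; rewrite xw inE => /orP[] wW.
      by case: ga => /pred0P/(_ w)/=; rewrite set11 wW.
    by case: gb => /pred0P/(_ w)/=; rewrite set11 wW.
  have -> : (R1 :|: [set w]) :\ x = R1 :|: [set w].
    apply/setP=> y; rewrite !inE; case: eqP => //= ->; rewrite (negbTE xw) orbF.
    apply/esym/negbTE/negP=> /(subsetP (realizes_sub (t := pendant) r1)) xS.
    by move/pred0P/(_ x): d; rewrite /= xS xwW.
  have wx : [set w] :\ x = [set w].
    by apply/setP=> y; rewrite !inE; case: eqP => //= ->; rewrite (negbTE xw).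
  rewrite wx in g'.
  have := qrep_vrep v => /qrep_turn/qrep_turn Q.
  by have := qrep_pendant r1 Q g' => /qrep_turn.
rewrite inE => /orP[xS|].
  have Q := qrep_vrep (two_hung_vrep ga gb gab qa qb).
  exact: pendant_del r1 (qrep_turn Q) g xS.
rewrite !inE => /or3P[/eqP->|xa|xb].
- have dw : [disjoint [set w] & Wa :|: Wb].
    by rewrite -setI_eq0 setIUr setU_eq0 !setI_eq0; case: ga => ->; case: gb => ->.
  have ww : w \in [set w] :|: (Wa :|: Wb) by rewrite setU11.
  have -> : (R1 :|: [set w]) :\ w = R1 by rewrite setUD1r ?set11 // setDv setU0.
  rewrite setUD1r // setUD1 ?set11 // setDv set0U eR.
  have := qrep_vrep vc => /qrep_turn Q.
  have g' : glue S1 set0 (Wa :|: Wb) set0.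
    have /glueHr[//|//|_ /glueC g1] := g; apply: glueC; exact/(glue0 _ _ R1).
  apply: (qrep_far _ _ g'); first exact: qrep_weak Q.
  by apply: rep_far => //; [exact: qrep_rep qa | exact: qrep_rep qb].
- by apply: one; [exact: two_hung_del ga gb gab (IHa _ _ ra xa) qb xa | rewrite inE xa].
- apply: one; last by rewrite inE xb orbT.
  rewrite [Wa :|: _]setUC; exact: two_hung_del gb ga (glueC gab) (IHb _ _ rb xb) qa xb.
Qed.

Lemma cherry_del (G : sgraph) a b c (R S : {set G}) x :
  forced a -> forced b -> forced c -> realizes (cherry a b c) R S -> x \in S ->
  exists r, rep (S :\ x) r.
Proof.
move=> fa fb fc rt xS.
have inside a' b' c' : forced a' -> forced b' -> forced c' -> forall w Ka Wa Kb Wb Kc Wc,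
    [/\ realizes a' Ka Wa, realizes b' Kb Wb & realizes c' Kc Wc] ->
    [/\ glue [set w] [set w] Wa Ka, glue [set w] [set w] Wb Kb & glue [set w] [set w] Wc Kc] ->
    [/\ glue Wa set0 Wb set0, glue Wa set0 Wc set0 & glue Wb set0 Wc set0] ->
    x \in Wa -> exists r, rep (([set w] :|: (Wa :|: (Wb :|: Wc))) :\ x) r.
  move=> fa' fb' fc' w Ka Wa Kb Wb Kc Wc [ra rb rc] [ga gb gc] [gab gac gbc] xW.
  have v := two_hung_del ga gb gab (forced_del fa' ra xW) (forced_qrep fb' rb) xW.
  have dab : [disjoint Wa & Wb] by case: gab.
  have dw : [disjoint [set w] & Wa :|: Wb].
    by rewrite -setI_eq0 setIUr setU_eq0 !setI_eq0; case: ga => ->; case: gb => ->.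
  have xS' : x \in [set w] :|: (Wa :|: Wb) by rewrite !inE xW orbT.
  have xw : x != w.
    by apply/eqP=> xw; case: ga => /pred0P/(_ w)/=; rewrite set11 -xw xW.
  have g : glue ([set w] :|: (Wa :|: Wb)) [set w] Wc Kc.
    apply/glueHl => //; split=> //; rewrite -[set0]setU0.
    by apply/glueUl; rewrite ?sub0set //; split; apply/(glue0 _ _ Kc).
  have {}g := glueC (glue_del x (glueC g)).
  have wx : [set w] :\ x = [set w].
    by apply/setP=> y; rewrite !inE; case: eqP => //= ->; rewrite (negbTE xw).
  rewrite wx in g.
  have -> : [set w] :|: (Wa :|: (Wb :|: Wc)) = [set w] :|: (Wa :|: Wb) :|: Wc.
    by rewrite !setUA.
  have dc : [disjoint [set w] :|: (Wa :|: Wb) & Wc].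
    rewrite -setI_eq0 !setIUl !setU_eq0 !setI_eq0.
    by case: gc => ->; case: gac => ->; case: gbc => ->.
  rewrite setUD1 //.
  exact: vrep_rep (vrep_two_ends v (forced_qrep fc' rc) g).
have [w [Ka [Wa [Kb [Wb [Kc [Wc]]]]]]] := cherryP rt.
move=> [[ra rb rc] [ga gb gc] [gab gac gbc] eR eS]; rewrite eS in xS *.
move: xS; rewrite !inE => /or4P[/eqP->|xa|xb|xc].
- have dw : [disjoint [set w] & Wa :|: (Wb :|: Wc)].
    rewrite -setI_eq0 !setIUr !setU_eq0 !setI_eq0.
    by case: ga => ->; case: gb => ->; case: gc => ->.
  rewrite setUD1 ?set11 // setDv set0U.
  have [ra' rb' rc'] := And3 (qrep_rep (forced_qrep fa ra)) (qrep_rep (forced_qrep fb rb))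
    (qrep_rep (forced_qrep fc rc)).
  apply: rep_far => //; first exact: rep_far.
  rewrite -[X in glue _ _ _ X]setU0; apply/glueUr; rewrite ?sub0set //.
  by case: gbc.
- exact: (inside a b c fa fb fc _ _ _ _ _ _ _ (And3 ra rb rc) (And3 ga gb gc) (And3 gab gac gbc) xa).
- rewrite [Wa :|: _]setUCA.
  exact: (inside b a c fb fa fc _ _ _ _ _ _ _ (And3 rb ra rc) (And3 gb ga gc) (And3 (glueC gab) gbc gac) xb).
rewrite [Wa :|: _]setUA [_ :|: Wc]setUC.
exact: (inside c a b fc fa fb _ _ _ _ _ _ _ (And3 rc ra rb) (And3 gc ga gb) (And3 (glueC gac) (glueC gbc) gab) xc).
Qed.

Lemma obstruction_del (G : sgraph) t (R S : {set G}) x :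
  obstruction t -> realizes t R S -> x \in S -> exists r, rep (S :\ x) r.
Proof.
case=> [|a b c fa fb fc]; last exact: cherry_del.
move=> /(pendants_pull (n := 3)) h /h [R1 [S1 [R2 [S2 [r1 r2 g _ [-> xS]]]]]].
move: r2 g => [R3] [S3] [R4] [S4] [r3 r4 g34 -> ->] g.
have Q := forced_qrep forced_quad r4.
have := qrep_pendant r3 (qrep_turn (qrep_turn Q)) g34 => Q'.
exact: qrep_rep (pendant_del r1 Q' g xS).
Qed.

(** * Drawing block graphs without obstructions *)

(** The witness that a part cannot be drawn better is an induced rooted subgraph.
    All roots of the whole that it contains are roots of the subgraph, so that
    gluing two parts glues their subgraphs. *)
Definition contains (G : sgraph) (t : plan) (K S : {set G}) : Prop :=
  exists R W, [/\ realizes t R W, W \subset S & R = W :&: K].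

Lemma containsW (G : sgraph) t t' (K S : {set G}) :
  (forall R W : {set G}, realizes t R W -> realizes t' R W) ->
  contains t K S -> contains t' K S.
Proof. by move=> h [R [W [r s e]]]; exists R, W; split; auto. Qed.

Lemma contains_sub (G : sgraph) t (K K' S S' : {set G}) :
  S \subset S' -> S :&: K' = S :&: K -> contains t K S -> contains t K' S'.
Proof.
move=> sS e [R [W [r s eR]]]; exists R, W; split=> //; first exact: subset_trans sS.
by rewrite eR -(setIidPl s) -!setIA e.
Qed.

Lemma contains_single (G : sgraph) (K S : {set G}) k :
  k \in K -> k \in S -> contains Single K S.
Proof.
move=> kK kS; exists [set k], [set k]; split; rewrite ?sub1set //; first by exists k.
by apply/esym/setIidPl; rewrite sub1set.
Qed.

Section Glue.
Variables (G : sgraph) (S1 K1 S2 K2 : {set G}).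
Hypotheses (s1 : K1 \subset S1) (s2 : K2 \subset S2) (g : glue S1 K1 S2 K2).

Lemma glue_off12 x : x \in S1 -> x \in S2 = false.
Proof. by move=> xS; case: g => /pred0P/(_ x)/=; rewrite xS. Qed.

Lemma glue_S1K : S1 :&: (K1 :|: K2) = K1.
Proof.
apply/setP=> x; rewrite !inE; case: (boolP (x \in S1)) => xS /=.
  case: (boolP (x \in K2)) => [/(subsetP s2)|_]; last by rewrite orbF.
  by rewrite glue_off12.
by apply/esym/negbTE; apply: contra xS => /(subsetP s1).
Qed.

Lemma glue_S2K : S2 :&: (K1 :|: K2) = K2.
Proof.
apply/setP=> x; rewrite !inE; case: (boolP (x \in S2)) => xS /=.
  case: (boolP (x \in K1)) => [/(subsetP s1)/glue_off12|//].
  by rewrite xS.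
by apply/esym/negbTE; apply: contra xS => /(subsetP s2).
Qed.

Lemma glue_S2K1 : S2 :&: K1 = set0.
Proof.
apply/setP=> x; rewrite !inE; apply/negP=> /andP[xS /(subsetP s1)/glue_off12].
by rewrite xS.
Qed.

Lemma contains_hang a q :
  contains a K1 S1 -> contains q K2 S2 -> contains (Hang a q) K1 (S1 :|: S2).
Proof.
move=> [R1 [W1 [r1 w1 e1]]] [R2 [W2 [r2 w2 e2]]].
exists R1, (W1 :|: W2); split; last first.
- rewrite setIUl -e1 -(setIidPl w2) -setIA glue_S2K1 setI0 setU0 //.
- exact: setUSS.
exists R1, W1, R2, W2; split=> //; rewrite e1 e2; exact: glueS g.
Qed.

Lemma contains_join a q :
  contains a K1 S1 -> contains q K2 S2 -> contains (Join a q) (K1 :|: K2) (S1 :|: S2).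
Proof.
move=> [R1 [W1 [r1 w1 e1]]] [R2 [W2 [r2 w2 e2]]].
exists (R1 :|: R2), (W1 :|: W2); split; last first.
- rewrite setIUl e1 e2 -{2}(setIidPl w1) -{2}(setIidPl w2) -!(setIA _ _ (K1 :|: K2)).
  by rewrite glue_S1K glue_S2K.
- exact: setUSS.
exists R1, W1, R2, W2; split=> //; rewrite e1 e2; exact: glueS g.
Qed.

Lemma contains_hangl a : contains a K1 S1 -> contains a K1 (S1 :|: S2).
Proof. by apply: contains_sub; rewrite // subsetUl. Qed.

Lemma contains_joinl a : contains a K1 S1 -> contains a (K1 :|: K2) (S1 :|: S2).
Proof. by apply: contains_sub; rewrite ?subsetUl // glue_S1K (setIidPr s1). Qed.

Lemma contains_joinr a : contains a K2 S2 -> contains a (K1 :|: K2) (S1 :|: S2).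
Proof. by apply: contains_sub; rewrite ?subsetUr // glue_S2K (setIidPr s2). Qed.
End Glue.

(** A forced block with two more cutpoints is an obstruction: for [quad] it has
    five cutpoints; for [tri a b] it has four, so that together with [a] and [b]
    there are three forced blocks at one of them. *)
Lemma forced_overfull (G : sgraph) q (R S : {set G}) :
  forced q -> realizes (Join pendant (Join pendant q)) R S ->
  exists t R', obstruction t /\ realizes t R' S.
Proof.
case=> [|a b fa fb] r; first by exists spider5, R; split=> //; constructor.
have {}r : realizes (Join (two_hung a b) quad) R S.
  apply: joinCA; apply: joinWr r => {}R {}S r; apply: joinCA.
  by apply: joinWr r => {}R {}S; apply: joinC.
have [R' r'] := join_hang r; exists (cherry a b quad), R'; split=> //.
by constructor=> //; constructor.
Qed.

Section Status.
Variable G : sgraph.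
Hypothesis noobs : forall t (R S : {set G}), obstruction t -> ~ realizes t R S.
Hypothesis cyc : forall s : seq G, uniq s -> cycle (@sedge G) s ->
  {in s &, forall u w, u != w -> sedge u w}.

Lemma nocontains t (K S : {set G}) : obstruction t -> ~ contains t K S.
Proof. by move=> o [R [W [r _ _]]]; apply: noobs o r. Qed.

(** The drawing of a connected part [S] that hangs at the rest of the graph by
    its vertex [v] depends on the number of forced blocks at [v]; the plan
    contained in [S] witnesses that no better drawing exists. *)
Inductive vstatus (v : G) (S : {set G}) : Prop :=
| VLeaf of S = [set v]
| VFree of vrep false true v S & contains pendant [set v] S
| VEnd q of vrep false false v S & contains pendant [set v] S & forced q &
    contains (Hang Single q) [set v] S
| VTwo a b of vrep true false v S & contains pendant [set v] S & forced a & forced b &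
    contains (two_hung a b) [set v] S.

(** Likewise for a block with a removed vertex, whose remaining vertices [K]
    carry the part [S] of the graph: [QPair] and [QThrough] leave a straight
    line through the block free, [QForced] only a half-line. *)
Inductive qstatus (K S : {set G}) : Prop :=
| QFree of qrep true true true true K S
| QOne of qrep true true true false K S & contains pendant K S
| QPair of qrep true true false false K S & contains (pendants 1) K S
| QThrough a b of qrep true true false false K S & forced a & forced b &
    contains (two_hung a b) K S
| QForced q of qrep true false false false K S & forced q & contains q K S.

(** A block with a free line through it changes nothing; any other one counts as
    a forced block, and a third one of these completes a cherry. *)
Lemma vstatus_step v (T K S : {set G}) : v \in T -> K \subset S -> K != set0 ->
  glue T [set v] S K -> vstatus v T -> qstatus K S -> vstatus v (T :|: S).
Proof.
move=> vT KS /set0Pn[k kK] g sv sq.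
have v1 : [set v] \subset T by rewrite sub1set.
have leaf : contains Single [set v] T by apply: contains_single (set11 v) vT.
have pend : contains pendant [set v] (T :|: S).
  apply: (contains_hang v1 g leaf); exact: contains_single kK (subsetP KS _ kK).
have pass l r : vrep l r v T -> (exists u d, qrep true true u d K S) -> vrep l r v (T :|: S).
  by move=> V [u [d Q]]; apply: vrep_attach V Q g.
have keep a : contains a [set v] T -> contains a [set v] (T :|: S) by exact: contains_hangl.
have sq' : (exists u d, qrep true true u d K S) \/
    (exists q, [/\ qrep true false false false K S, forced q & contains q K S]).
  case: sq => [h|h _|h _|a b h _ _ _|q h fq cq]; try by left; do 2!eexists; apply: h.
  by right; exists q.
case: sv => [eT|V cp|q V cp fq cq|a b V cp fa fb cab]; case: sq' => [P|[q' [Q fq' cq']]].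
- by apply: VFree => //; apply: pass P; rewrite eT; apply: vrep1.
- apply: (VEnd (q := q')) => //; last exact: (contains_hang v1 g leaf cq').
  by apply: vrep_end Q g; rewrite eT; apply: vrep1.
- by apply: VFree => //; apply: pass P.
- apply: (VEnd (q := q')) => //; last exact: (contains_hang v1 g leaf cq').
  exact: vrep_end V Q g.
- by apply: (VEnd (q := q)) => //; [apply: pass P | apply: keep].
- apply: (VTwo (a := q) (b := q')) => //; last exact: (contains_hang v1 g cq cq').
  exact: vrep_two_ends V Q g.
- by apply: (VTwo (a := a) (b := b)) => //; [apply: pass P | apply: keep].
have := contains_hang v1 g cab cq'; case/nocontains.
by constructor.
Qed.

(** The block is built up vertex by vertex; [w] is the new vertex and [T] the part
    hanging at it.  The vertex [v], at which the whole block hangs, has the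
    neighbour [p] elsewhere and so counts as one more cutpoint when an
    obstruction has to be found. *)
Lemma qstatus_step v p w (T K S : {set G}) : w \in T -> K \subset S ->
  glue T [set w] S K -> v != p -> sedge v p ->
  glue [set v; p] [set v] (T :|: S) (w |: K) ->
  vstatus w T -> qstatus K S -> qstatus (w |: K) (T :|: S).
Proof.
move=> wT KS g vp evp gv sv sq.
have w1 : [set w] \subset T by rewrite sub1set.
have wK : w |: K \subset T :|: S by apply: setUSS.
have v1 : [set v] \subset [set v; p] by rewrite subsetUl.
have cv : contains pendant [set v] [set v; p].
  exists [set v], [set v; p]; split; rewrite ?subxx //; last by apply/esym/setIidPr.
  exists [set v], [set v], [set p], [set p]; split=> //; [by exists v | by exists p |].
  split; first by apply/pred0P=> x /=; rewrite !inE; case: eqP => //= ->; apply: negbTE.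
  by move=> x y /set1P-> /set1P->; rewrite !set11 evp.
have bad a : contains a (w |: K) (T :|: S) ->
    (forall R W : {set G}, realizes (Join pendant a) R W ->
       exists t R', obstruction t /\ realizes t R' W) -> False.
  move=> c h; have [R [W [r _ _]]] := contains_join v1 wK gv cv c.
  by have [t [R' [o r']]] := h _ _ r; apply: noobs o r'.
have join a q : contains a [set w] T -> contains q K S ->
    contains (Join a q) (w |: K) (T :|: S) by exact: contains_join.
have left a : contains a [set w] T -> contains a (w |: K) (T :|: S) by exact: contains_joinl.
have right a : contains a K S -> contains a (w |: K) (T :|: S) by exact: contains_joinr.
have over q : contains pendant [set w] T -> forced q -> contains q K S -> False.
  move=> cp fq cq; apply: (bad _ (join _ _ cp cq)) => R W; exact: forced_overfull.
have turn l r u d : qrep l r u d (w |: K) (T :|: S) -> qrep d u l r (w |: K) (T :|: S).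
  exact: qrep_turn.
have add l u d : vrep false false w T -> qrep l true u d K S ->
    qrep l false u d (w |: K) (T :|: S).
  by move=> V Q; have := qrep_add V Q _ g; rewrite andbT; apply.
have add2 u d : vrep true false w T -> qrep true true u d K S ->
    qrep false false u d (w |: K) (T :|: S).
  by move=> V Q; apply: (qrep_add V Q).
have end_case : vrep false false w T -> contains pendant [set w] T ->
    qstatus (w |: K) (T :|: S).
  move=> V cp; case: sq => [Q|Q c|Q c|a b Q fa fb c|q Q fq c].
  - by apply: QOne; [apply/turn/add | apply: left].
  - apply: QPair; last exact: join.
    by apply/turn/(add _ _ _ V); apply/qrep_turn.
  - by apply: (QForced (q := quad)); [apply: add | constructor | apply: join].
  - by apply: (QForced (q := tri a b)); [apply: add | constructor | apply: join].
  - by have := over q cp fq c.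
case: sv => [eT|V cp|q V cp fq cq|a b V cp fa fb cab].
- rewrite eT in g join left right *.
  have add1 l r u d : qrep l r u d K S -> qrep l r u d (w |: K) (w |: S).
    by move=> Q; apply: qrep_add_point Q g.
  case: sq => [Q|Q c|Q c|a b Q fa fb c|q Q fq c].
  + exact: QFree (add1 _ _ _ _ Q).
  + exact: QOne (add1 _ _ _ _ Q) (right _ c).
  + exact: QPair (add1 _ _ _ _ Q) (right _ c).
  + exact: QThrough (add1 _ _ _ _ Q) fa fb (right _ c).
  + exact: QForced (add1 _ _ _ _ Q) fq (right _ c).
- by apply: end_case => //; apply: vrep_weak V.
- exact: end_case.
case: sq => [Q|Q c|Q c|a' b' Q fa' fb' c|q Q fq c].
- by apply: (QThrough (a := a) (b := b)) => //; [apply/turn/add2 | apply: left].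
(* [w] takes both horizontal directions and the old cutpoint a vertical one;
   three turns bring the remaining free direction to the left. *)
- apply: (QForced (q := tri a b)); [ | by constructor | ].
    by apply/turn/turn/turn; apply: add2 V _; apply: Q.
  by apply: containsW (join _ _ cab c) => R W; apply: joinC.
- case: (bad _ (join _ _ cab c)) => R W /joinCA/join_hang[R' r].
  by exists (cherry a b quad), R'; split=> //; constructor=> //; constructor.
- case: (bad _ (join _ _ cab c)) => R W /joinCA/join_hang[R' r].
  by exists (cherry a b (tri a' b')), R'; split=> //; constructor=> //; constructor.
by have := over q cp fq c.
Qed.

(** A path from [a] to [b] closes up to a cycle through [v]. *)
Lemma ear (X : {set G}) (v a b : G) : v \notin X -> a \in X -> linked X a b ->
  sedge v a -> sedge v b -> a != b -> sedge a b.
Proof.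
move=> vX aX /connectP[p0 pp0 eb] va vb ab.
case/shortenP: pp0 eb => p pp up _ eb.
have pX : {subset a :: p <= X}.
  move=> x; elim: p a aX pp {va ab up eb} => [|y p IH] a aX /=.
    by move=> _; rewrite inE => /eqP->.
  case/andP=> /and3P[_ yX _] pp; rewrite inE => /predU1P[-> // |]; exact: IH.
apply: (cyc (s := v :: a :: p)) => //.
- by rewrite cons_uniq up andbT; apply: contra vX => /pX.
- rewrite /= va rcons_path -eb [sedge b v]sedge_sym vb andbT.
  by apply: sub_path pp => x y /and3P[].
- by rewrite !inE eqxx orbT.
- by rewrite eb inE mem_last orbT.
Qed.

Lemma square (v w t z : G) : uniq [:: v; w; t; z] -> sedge v w -> sedge w t -> sedge t z ->
  sedge z v -> sedge v t.
Proof.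
move=> u vw wt tz zv; have := u; rewrite /= !inE !negb_or => /andP[/and3P[_ vt _] _].
by apply: (cyc u) => //=; rewrite ?inE ?eqxx ?orbT // vw wt tz zv.
Qed.

(** A component [C] of the graph without [v] contains the vertices of exactly
    one block at [v]: by [ear], the neighbours of [v] in [C] form a clique. *)
Lemma split_at (S : {set G}) (v a : G) : v \in S -> a \in S -> sedge v a ->
  (forall u, u \in S -> linked S v u) ->
  exists C K : {set G}, [/\ a \in K, C \subset S & v \notin C] /\ 
   [/\ K = [set k in C | sedge v k], glue (S :\: C) [set v] C K,
      {in K &, forall k k', k != k' -> sedge k k'},
      (forall u, u \in C -> linked C a u) & (forall u, u \in S :\: C -> linked (S :\: C) v u)].
Proof.
move=> vS aS va lS; have av : a != v by apply/eqP=> av; rewrite av sedge_irrefl in va.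
have [C inC] : exists C : {set G}, forall t, (t \in C) = linked (S :\ v) a t.
  by exists [set t | linked (S :\ v) a t] => t; rewrite inE.
have aD : a \in S :\ v by rewrite !inE av.
have CD u : u \in C -> u \in S :\ v by rewrite inC; apply: linked_in.
have aC : a \in C by rewrite inC; apply: connect0.
have vC : v \notin C by apply/negP=> /CD; rewrite !inE eqxx.
have CS : C \subset S by apply/subsetP=> u /CD; rewrite !inE => /andP[].
have cl x y : x \in C -> y \in S -> y != v -> sedge x y -> y \in C.
  move=> xC yS yv e; rewrite inC; have := xC; rewrite inC => /linked_trans; apply.
  by apply: linked_edge e; [apply: CD | rewrite !inE yv].
have lC u : u \in C -> linked C a u.
  rewrite inC => h; suff [] : u \in C /\ linked C a u by [].
  apply: (connect_ind (P := fun u => u \in C /\ linked C a u) h).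
    by split=> //; apply: connect0.
  move=> x y [xC lx] /and3P[_ + e]; rewrite !inE => /andP[yv yS].
  have yC := cl x y xC yS yv e.
  by split=> //; apply: linked_trans lx (linked_edge xC yC e).
exists C, [set k in C | sedge v k]; split; first by rewrite inE aC va.
split=> //.
- split; first by apply/pred0P=> x /=; rewrite inE andbAC andNb.
  move=> x z /setDP[xS xC] zC; rewrite in_set1 inE zC /=.
  have [-> //|xv] := eqVneq x v.
  by apply/negbTE; apply: contra xC => e; apply: (cl z) => //; rewrite sedge_sym.
- move=> k k' /setIdP[kC vk] /setIdP[kC' vk'].
  apply: (ear vC kC _ vk vk'); apply: (linked_trans _ (lC _ kC')).
  by rewrite linked_sym lC.
move=> u uSC; have := uSC; rewrite inE => /andP[uC uS].
suff [uC'|] : u \in C \/ linked (S :\: C) v u by [rewrite uC' in uC | ].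
have vSC : v \in S :\: C by rewrite inE vC.
apply: (connect_ind (P := fun u => u \in C \/ linked (S :\: C) v u) (lS u uS)).
  by right; apply: connect0.
move=> x y IH /and3P[xS yS e].
have [yC|yC] := boolP (y \in C); first by left.
have ySC : y \in S :\: C by rewrite inE yC.
right; case: IH => [xC|lx].
  have [-> | yv] := eqVneq y v; first exact: connect0.
  by rewrite (cl x y) in yC.
by apply: (linked_trans lx); apply: linked_edge e; rewrite // (linked_in vSC lx).
Qed.

(** The two decompositions alternate.  A part hanging at [v] loses one of its
    blocks by [split_at].  A part hanging at a block loses a vertex [w] of the
    block with the part [T] that can be reached from [w] without the other
    vertices of the block; that no other edge leaves [T] holds because a cycle
    through [v] would be a clique. *)
Lemma status_rec n :
  (forall (S : {set G}) v p, #|S| <= n -> v \in S -> (forall u, u \in S -> linked S v u) ->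
     p \notin S -> sedge v p -> (forall u, u \in S -> u != v -> ~~ sedge p u) -> vstatus v S) /\
  (forall (C K : {set G}) v p, #|C| <= n -> K \subset C ->
     {in K &, forall k k', k != k' -> sedge k k'} ->
     (forall u, u \in C -> exists2 k, k \in K & linked C k u) ->
     v != p -> sedge v p -> glue [set v; p] [set v] C K -> qstatus K C).
Proof.
elim: n => [|n [IHv IHq]].
  split=> [S v p|C K v p]; rewrite leqn0 cards_eq0 => /eqP->.
    by rewrite in_set0.
  by rewrite subset0 => /eqP-> _ _ _ _ _; apply/QFree/qrep_set0.
have V (S : {set G}) v p : #|S| <= n.+1 -> v \in S -> (forall u, u \in S -> linked S v u) ->
    p \notin S -> sedge v p -> (forall u, u \in S -> u != v -> ~~ sedge p u) -> vstatus v S.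
  move=> cS vS lS pS vp pu.
  have [eS | [u uS uv]] : S = [set v] \/ exists2 u, u \in S & u != v.
    have [eS|] := eqVneq S [set v]; first by left.
    rewrite eqEsubset sub1set vS andbT => /subsetPn[u uS]; rewrite inE => uv.
    by right; exists u.
  - exact: VLeaf.
  have [a aS va] : exists2 a, a \in S & sedge v a.
    suff [uv'|] : u = v \/ exists2 a, a \in S & sedge v a by [rewrite uv' eqxx in uv |].
    apply: (connect_ind (P := fun u => u = v \/ exists2 a, a \in S & sedge v a) (lS u uS)).
      by left.
    move=> x y [->|h] /and3P[xS yS e]; last by right.
    by right; exists y.
  have [C [K [[aK CS vC] [eK g cK lC lSC]]]] := split_at vS aS va lS.
  have KC : K \subset C by rewrite eK; apply/subsetP=> x; rewrite inE => /andP[].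
  have aC := subsetP KC _ aK.
  have vp' : v != p by apply/eqP=> e; rewrite -e vS in pS.
  have gvp : glue [set v; p] [set v] C K.
    split.
      apply/pred0P=> x /=; rewrite !inE; apply/negP=> /andP[/orP[]/eqP-> xC].
        by rewrite xC in vC.
      by rewrite (subsetP CS) in pS.
    move=> x y; rewrite !inE eK inE => /orP[]/eqP-> yC; rewrite ?eqxx ?yC //.
    rewrite eq_sym (negbTE vp') /=; apply/negbTE/pu; first exact: (subsetP CS).
    by apply/eqP=> yv; rewrite -yv yC in vC.
  have eS : S = (S :\: C) :|: C by rewrite -{1}(setID S C) (setIidPr CS) setUC.
  rewrite eS; apply: (vstatus_step (K := K)) => //.
  - by rewrite inE vC.
  - by apply/set0Pn; exists a.
  - apply: (IHv _ v p) => //.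
    + by rewrite -ltnS; apply: leq_trans cS; rewrite [X in _ < X](cardsD1 a) aS add1n ltnS subset_leq_card // setDS // sub1set.
    + by rewrite inE vC.
    + by rewrite inE negb_and (negbTE pS) orbT.
    + by move=> x; rewrite inE => /andP[_ xS]; apply: pu.
  - apply: (IHq _ _ v p) => //.
    + rewrite -ltnS; apply: leq_trans cS; rewrite [X in _ < X](cardsD1 v) vS add1n ltnS.
      by apply: subset_leq_card; apply/subsetP=> x xC; rewrite !inE (subsetP CS) // andbT; apply/eqP=> xv; rewrite -xv xC in vC.
    + by move=> x xC; exists a; last exact: lC.
split=> // C K v p cC KC cK lC vp evp g.
have [K0 | /set0Pn[w wK]] := eqVneq K set0.
  have C0 : C = set0.
    apply/setP=> u; rewrite in_set0; apply/negP=> /lC[k].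
    by rewrite K0 in_set0.
  by rewrite K0 C0; apply/QFree/qrep_set0.
have [vC pC evC vpC] : [/\ v \notin C, p \notin C, (forall x, x \in C -> sedge v x = (x \in K)) &
    forall x, x \in C -> ~~ sedge p x].
  case: g => d g; split.
  - by apply/negP=> vC; move/pred0P/(_ v): d; rewrite /= set21 vC.
  - by apply/negP=> vC; move/pred0P/(_ p): d; rewrite /= set22 vC.
  - by move=> x xC; rewrite g ?set21 // set11.
  - by move=> x xC; rewrite g ?set22 // inE eq_sym (negbTE vp).
pose K' := K :\ w; pose D := C :\: K'.
have wC := subsetP KC _ wK.
have wD : w \in D by rewrite !inE eqxx.
have [T inT] : exists T : {set G}, forall t, (t \in T) = linked D w t.
  by exists [set t | linked D w t] => t; rewrite inE.
have TD t : t \in T -> t \in D by rewrite inT; apply: linked_in.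
have wT : w \in T by rewrite inT; apply: connect0.
have TC : T \subset C by apply/subsetP=> t /TD; rewrite inE => /andP[].
have TK t : t \in T -> (t \in K) = (t == w).
  by move=> /TD; rewrite !inE; case: eqVneq => [->|_] //=; case: (t \in K).
have lT t : t \in T -> linked T w t.
  rewrite inT => h; suff [] : t \in T /\ linked T w t by [].
  apply: (connect_ind (P := fun t => t \in T /\ linked T w t) h).
    by split=> //; apply: connect0.
  move=> x y [xT lx] /and3P[xD yD e].
  have yT : y \in T.
    by rewrite inT; have := xT; rewrite inT => /linked_trans; apply; apply: linked_edge.
  by split=> //; apply: linked_trans lx (linked_edge xT yT e).
have TC' t z : t \in T -> z \in C :\: T -> sedge t z = (t == w) && (z \in K').
  move=> tT /setDP[zC zT].
  have zw : z != w by apply: contra zT => /eqP->.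
  have [zK' | zK'] := boolP (z \in K'); last first.
    rewrite andbF; apply/negbTE; apply: contra zT => e.
    rewrite inT; have := tT; rewrite inT => /linked_trans; apply.
    by apply: linked_edge e; [apply: TD | rewrite inE zK'].
  have zK : z \in K by move: zK'; rewrite !inE => /andP[].
  have [-> | tw] := eqVneq t w; first by rewrite cK // eq_sym.
  apply/negbTE/negP=> e.
  have wt : sedge w t.
    apply: (ear (X := D) (v := z) (a := w) (b := t)) => //.
    - by rewrite inE zK'.
    - by rewrite -inT.
    - exact: cK.
    - by rewrite sedge_sym.
    - by rewrite eq_sym.
  have : sedge v t.
    apply: (square (w := w) (z := z)) => //; last first.
    - by rewrite sedge_sym evC.
    - by rewrite evC.
    rewrite /= !inE !negb_or (eq_sym w) tw (eq_sym w) zw !andbT.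
    have ne x : x \in C -> v != x by move=> xC; apply: contra vC => /eqP->.
    have tz : t != z by apply: contra zT => /eqP<-.
    by rewrite tz (ne w wC) (ne z zC) (ne t (subsetP TC _ tT)).
  by rewrite evC ?(subsetP TC) // TK // (negbTE tw).
have K'C' : K' \subset C :\: T.
  apply/subsetP=> k; rewrite !inE => /andP[kw kK]; rewrite (subsetP KC) // andbT.
  by apply: contra kw => kT; rewrite -TK.
have eK : K = w |: K' by rewrite setD1K.
have eC : C = T :|: (C :\: T) by rewrite -{1}(setID C T) (setIidPr TC).
have g1 : glue T [set w] (C :\: T) K'.
  split; first by apply/pred0P=> x /=; rewrite inE andbA andbN.
  by move=> t z tT zC; rewrite TC' // inE.
suff : qstatus (w |: K') (T :|: (C :\: T)) by rewrite -eK -eC.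
apply: (qstatus_step (v := v) (p := p)) => //.
- by rewrite -eK -eC.
- apply: (V _ _ v) => //.
  + exact: leq_trans (subset_leq_card TC) cC.
  + by apply: contra vC => /(subsetP TC).
  + by rewrite sedge_sym evC.
  + by move=> u uT uw; rewrite evC ?(subsetP TC) // TK // uw.
apply: (IHq _ _ v p) => //.
- rewrite -ltnS; apply: leq_trans cC; rewrite [X in _ < X](cardsD1 w) wC add1n ltnS.
  by apply: subset_leq_card; rewrite setDS // sub1set.
- by move=> k k'; rewrite !inE => /andP[_ kK] /andP[_ kK']; apply: cK.
- move=> u uC'; have /setDP[uC uT] := uC'; have [k0 k0K lu] := lC u uC.
  suff [uT'|] : u \in T \/ (u \in C :\: T /\ exists2 k, k \in K' & linked (C :\: T) k u).
  + by rewrite uT' in uT.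
  + by case.
  apply: (connect_ind (P := fun u => u \in T \/
    (u \in C :\: T /\ exists2 k, k \in K' & linked (C :\: T) k u)) lu).
    have [-> | k0w] := eqVneq k0 w; [by left | right].
    have k0K' : k0 \in K' by rewrite !inE k0w.
    by split; [apply: (subsetP K'C') | exists k0 => //; apply: connect0].
  move=> x y IH /and3P[xC yC e].
  have [yT|yT] := boolP (y \in T); [by left | right].
  have yC' : y \in C :\: T by rewrite inE yT.
  split=> //; case: IH => [xT | [xC' [k kK lx]]].
    exists y; last exact: connect0.
    by have := e; rewrite TC' // => /andP[].
  by exists k => //; apply: linked_trans lx (linked_edge xC' yC' e).
have := glueS (subxx _) (subsetDl C T) g.
rewrite setIC (setIidPl (subsetUl _ _)).
suff -> : (C :\: T) :&: K = K' by [].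
apply/setP=> x; rewrite !inE; have [xT|xT] := boolP (x \in T).
  by rewrite /= -(TK _ xT) andbC; case: (x \in K).
apply/andP/andP=> [[xC xK]|[xw xK]]; split=> //.
  by apply: contra xT => /eqP->.
exact: (subsetP KC).
Qed.

(** A connected graph whose cycles are cliques and which contains no
    obstruction is either a clique, drawn at a single point, or has a
    cutpoint, at which the two parts of [split_at] can be drawn. *)
Lemma noobs_rep : {in [set: G] &, forall u w, linked [set: G] u w} ->
  exists r, rep [set: G] r.
Proof.
move=> con.
have [/existsP[v /existsP[a /existsP[b /and4P[va vb ab nab]]]] | no] :=
  boolP [exists v : G, [exists a, [exists b, [&& sedge v a, sedge v b, a != b & ~~ sedge a b]]]];
  last first.
  have cl (u w : G) : u != w -> sedge u w.
    move=> uw; have := con u w (in_setT _) (in_setT _) => h.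
    suff [wu|//] : w = u \/ sedge u w by rewrite wu eqxx in uw.
    apply: (connect_ind (P := fun x => x = u \/ sedge u x) h); first by left.
    move=> x y [->|ux] /and3P[_ _ e]; first by right.
    have [-> | yu] := eqVneq y u; [by left | right].
    apply/negPn/negP=> nuy; case/negP: no.
    apply/existsP; exists x; apply/existsP; exists u; apply/existsP; exists y.
    by rewrite e sedge_sym ux eq_sym yu nuy.
  exists (fun=> Seg 0 0 0 0); split=> [u _ | u w _ _ uw]; first by split; [|left].
  by split=> // _; apply: cl.
have lv u : u \in [set: G] -> linked [set: G] v u by move=> _; apply: con.
have [C [K [[aK _ vC] [eK g cK lC lS]]]] := split_at (in_setT v) (in_setT a) va lv.
have KC : K \subset C by rewrite eK; apply/subsetP=> x /setIdP[].
have aC := subsetP KC _ aK.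
have vS : v \in [set: G] :\: C by rewrite !inE vC.
have bC : b \notin C.
  apply/negP=> bC; case/negP: nab; apply: cK => //.
  by rewrite eK inE bC.
have bS : b \in [set: G] :\: C by rewrite !inE bC.
have vb' : v != b by apply/eqP=> e; rewrite e sedge_irrefl in vb.
have va' : v != a by apply/eqP=> e; rewrite e sedge_irrefl in va.
have [gd ge] := g.
have [sv _] := status_rec #|[set: G] :\: C|; have [_ sq] := status_rec #|C|.
have V : vstatus v ([set: G] :\: C).
  apply: (sv _ _ a) => //; first by rewrite !inE aC.
  move=> u uS uv; rewrite sedge_sym ge // in_set1 (negbTE uv) //.
have Q : qstatus K C.
  apply: (sq _ _ v b) => //.
    by move=> u uC; exists a; last exact: lC.
  have := glueS _ (subxx C) g; rewrite (setIidPr KC) => /(_ [set v; b]).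
  have -> : [set v; b] :&: [set v] = [set v] by apply/setIidPr; rewrite subsetUl.
  by apply; rewrite subUset !sub1set vS bS.
have : vstatus v (([set: G] :\: C) :|: C).
  by apply: (vstatus_step (K := K)) => //; apply/set0Pn; exists a.
have -> : ([set: G] :\: C) :|: C = [set: G].
  by apply/setP=> x; rewrite !inE; case: (x \in C).
case=> [->|/vrep_rep//|q /vrep_rep//|? ? /vrep_rep//].
exact: vrep_rep (vrep1 v).
Qed.
End Status.

(** * Cutpoints and blocks *)

Lemma linked_imset (G H : sgraph) (f : H -> G) (S : {set H}) x y :
  injective f -> (forall x y, sedge (f x) (f y) = sedge x y) ->
  linked S x y = linked (f @: S) (f x) (f y).
Proof.
move=> inj ef; apply/idP/idP => c.
  apply: (connect_ind (P := fun y => linked (f @: S) (f x) (f y)) c).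
    exact: connect0.
  move=> a b IH /and3P[aS bS e]; apply: (linked_trans IH).
  by apply: linked_edge; rewrite ?imset_f // ef.
suff: forall b, linked (f @: S) (f x) b -> forall y, f y = b -> linked S x y by move/(_ _ c); apply.
move=> b cb; apply: (connect_ind (P := fun b => forall y, f y = b -> linked S x y) cb).
  by move=> z /inj->; apply: connect0.
move=> a b' IH /and3P[/imsetP[a' aS ea] /imsetP[b'' bS eb] e] z ez.
have e' := IH a' (esym ea); apply: (linked_trans e').
have -> : z = b'' by apply: inj; rewrite ez.
by apply: linked_edge; rewrite // -ef -ea -eb.
Qed.

Lemma connectedP (G : sgraph) (S : {set G}) :
  reflect {in S &, forall u w, linked S u w} (connected (induced S)).
Proof.
have im : val @: [set: induced S] = S.
  apply/setP=> x; apply/imsetP/idP => [[y _ ->]|xS]; first exact: valP.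
  by exists (exist _ x xS).
have E (x y : induced S) : connect (@sedge (induced S)) x y = linked S (val x) (val y).
  by rewrite -linked_setT (@linked_imset G (induced S) val) ?im //; apply: val_inj.
apply: (iffP idP) => [/forallP h u w uS wS | h].
  have := h (exist _ u uS) => /forallP/(_ (exist _ w wS)).
  by rewrite E.
apply/forallP=> x; apply/forallP=> y; rewrite E; apply: h; exact: valP.
Qed.

Lemma connected_setT (G : sgraph) :
  connected G -> {in [set: G] &, forall u w, linked [set: G] u w}.
Proof. by move=> /forallP c u w _ _; have /forallP := c u; rewrite linked_setT. Qed.

Lemma setT_connected (G : sgraph) :
  {in [set: G] &, forall u w, linked [set: G] u w} -> connected G.
Proof.
by move=> c; apply/forallP=> u; apply/forallP=> w; rewrite -linked_setT; apply: c.
Qed.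

Lemma sedge_csym (G : sgraph) : connect_sym (@sedge G).
Proof. exact: sym_connect_sym (@sedge_sym G). Qed.

Lemma ncomponents_le1 (G : sgraph) : connected G -> ncomponents G <= 1.
Proof.
move=> c; apply/card_le1_eqP => x y; rewrite !inE => /andP[/eqP rx _] /andP[/eqP ry _].
have /forallP/(_ x)/forallP/(_ y) cxy := c.
by have := elimT (fingraph.rootP (@sedge_csym G)) cxy; rewrite rx ry.
Qed.

Lemma ncomponents_gt0 (G : sgraph) (x : G) : 0 < ncomponents G.
Proof.
apply/card_gt0P; exists (fingraph.root (@sedge G) x).
by apply/andP; split=> //; exact: (roots_root (@sedge_csym G)).
Qed.

Lemma ncomponents_gt1 (G : sgraph) (x y : G) : ~~ connect (@sedge G) x y -> 1 < ncomponents G.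
Proof.
move=> nc; apply/card_gt1P.
exists (fingraph.root (@sedge G) x), (fingraph.root (@sedge G) y); split;
  try by apply/andP; split=> //; exact: (roots_root (@sedge_csym G)).
apply: contra nc => /eqP h; exact: introT (fingraph.rootP (@sedge_csym G)) h.
Qed.

Lemma ncomponents_induced (G : sgraph) (S : {set G}) u w :
  u \in S -> w \in S -> ~~ linked S u w -> 1 < ncomponents (induced S).
Proof.
move=> uS wS; apply: contraR; rewrite -leqNgt => h.
have : connected (induced S).
  apply/forallP=> x; apply/forallP=> y; apply: contraLR h; rewrite -ltnNge.
  exact: ncomponents_gt1.
by move/connectedP/(_ u w uS wS).
Qed.

Lemma cutpointP (G : sgraph) (v : G) : connected G ->
  reflect (exists u w, [/\ u != v, w != v & ~~ linked [set~ v] u w]) (cutpoint v).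
Proof.
move=> c; apply: (iffP idP); rewrite /cutpoint; last first.
  case=> u [w [uv wv nl]]; apply: leq_ltn_trans (ncomponents_le1 c) _.
  by apply: ncomponents_induced nl; rewrite !inE.
move=> h; have {h} : ~~ connected (induced [set~ v]).
  apply: contraL h => /ncomponents_le1 h; rewrite -leqNgt; apply: leq_trans h _.
  exact: ncomponents_gt0 v.
move/connectedP=> h.
have [/existsP[u /existsP[w /and3P[uv wv nl]]]|no] :=
  boolP [exists u, exists w, [&& u != v, w != v & ~~ linked [set~ v] u w]].
  by exists u, w.
case: h => u w; rewrite !inE => uv wv; apply/negPn/negP=> nl; case/negP: no.
by apply/existsP; exists u; apply/existsP; exists w; rewrite uv wv.
Qed.

Lemma nonseparableP (G : sgraph) (B : {set G}) :
  reflect ({in B &, forall u w, linked B u w} /\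
     forall z, z \in B -> {in B :\ z &, forall u w, linked (B :\ z) u w})
    (nonseparable B).
Proof.
have im (z : induced B) : val @: [set~ z] = B :\ val z.
  apply/setP=> x; rewrite !inE; apply/imsetP/andP => [[y yz ->]|[xz xB]].
    by split; [move: yz; rewrite !inE; apply: contra => /eqP/val_inj-> | apply: valP].
  by exists (exist _ x xB); rewrite // !inE; apply: contra xz => /eqP<-.
have E (z x y : induced B) : linked [set~ z] x y = linked (B :\ val z) (val x) (val y).
  by rewrite (@linked_imset G (induced B) val) ?im //; apply: val_inj.
apply: (iffP andP) => [[cB /forallP nc] | [cB nc]].
  split=> [|z zB u w]; first exact/connectedP.
  rewrite !inE => /andP[uz uB] /andP[wz wB].
  have := nc (exist _ z zB) => /cutpointP-/(_ cB) h.
  rewrite -(E (exist _ z zB) (exist _ u uB) (exist _ w wB)).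
  apply/negPn/negP=> nl; apply: h.
  by exists (exist _ u uB), (exist _ w wB).
have c : connected (induced B) by apply/connectedP.
split=> //; apply/forallP=> z; apply/cutpointP => // -[u [w [uz wz]]].
have vB (x : induced B) : val x \in B by apply: valP.
by rewrite E nc // !inE vB andbT.
Qed.

Lemma nonsep_linked (G : sgraph) (B : {set G}) z u w :
  nonseparable B -> u \in B -> w \in B -> u != z -> w != z -> linked (B :\ z) u w.
Proof.
case/nonseparableP=> c nc uB wB uz wz.
have [zB | zB] := boolP (z \in B); first by apply: nc; rewrite // !inE ?uz ?wz.
have -> : B :\ z = B; last exact: c.
by apply/setP=> x; rewrite !inE andbC; case: eqP => [->|_]; rewrite ?andbT // (negbTE zB).
Qed.

(** A nonseparable set does not meet both sides of a separation by [z]. *)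
Lemma nonsep_split (G : sgraph) (B : {set G}) z (X : pred G) u w :
  nonseparable B -> u \in B -> w \in B -> u != z -> w != z -> X u -> ~~ X w ->
  (forall x y, x \in B -> y \in B -> x != z -> y != z -> X x -> ~~ X y -> ~~ sedge x y) ->
  False.
Proof.
move=> nB uB wB uz wz Xu /negP Xw e; apply: Xw.
apply: (connect_ind (P := fun x => X x) (nonsep_linked nB uB wB uz wz)) => //.
move=> x y Xx /and3P[]; rewrite !inE => /andP[xz xB] /andP[yz yB] exy.
by apply/negPn/negP=> Xy; have := e x y xB yB xz yz Xx Xy; rewrite exy.
Qed.

Lemma cliqueP (G : sgraph) (A : {set G}) :
  reflect {in A &, forall u w, u != w -> sedge u w} (clique A).
Proof.
apply: (iffP forall_inP) => [h u w uA wA | h u uA].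
  by have /forall_inP/(_ w wA)/implyP := h u uA.
by apply/forall_inP=> w wA; apply/implyP; apply: h.
Qed.

Lemma clique_nonsep (G : sgraph) (A : {set G}) : clique A -> nonseparable A.
Proof.
move/cliqueP=> cA.
have c (B : {set G}) : B \subset A -> {in B &, forall u w, linked B u w}.
  move=> /subsetP BA u w uB wB; have [-> | uw] := eqVneq u w; first exact: connect0.
  by apply: linked_edge => //; apply: cA; rewrite ?BA.
by apply/nonseparableP; split=> [|z _]; apply: c; rewrite ?subsetDl.
Qed.

Lemma path_linked (G : sgraph) (x : G) p : path (@sedge G) x p ->
  {in [set y in x :: p] &, forall u w, linked [set y in x :: p] u w}.
Proof.
move=> pp; have h u : u \in x :: p -> linked [set y in x :: p] x u.
  elim: p x u pp => [|y p IH] x u /=; first by rewrite inE => _ /eqP->; apply: connect0.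
  case/andP=> e pp; rewrite inE => /predU1P[->|up]; first exact: connect0.
  apply: (linked_trans (linked_edge _ _ e)); rewrite ?inE ?eqxx ?orbT //.
  apply: linkedS (IH y u pp up); apply/subsetP=> z; rewrite !inE => ->; exact: orbT.
move=> u w; rewrite !(inE, in_set) => uS wS; apply: (@linked_trans _ _ x).
  by rewrite linked_sym; apply: h; rewrite inE.
by apply: h; rewrite inE.
Qed.

(** A cycle without one of its vertices is still a path. *)
Lemma cycle_nonsep (G : sgraph) (s : seq G) :
  uniq s -> cycle (@sedge G) s -> nonseparable [set x in s].
Proof.
move=> us cs; apply/nonseparableP; split.
  case: s us cs => [|x p] _ /=; first by move=> _ u w; rewrite inE.
  by rewrite rcons_path => /andP[pp _]; apply: path_linked.
move=> z; rewrite inE => /rot_to[i s' e].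
have cs' : cycle (@sedge G) (z :: s') by rewrite -e rot_cycle.
have us' : uniq (z :: s') by rewrite -e rot_uniq.
have -> : [set x in s] :\ z = [set x in s'].
  apply/setP=> x; rewrite !inE -(mem_rot i) e inE; case: eqP => //= ->.
  by move: us' => /= /andP[/negbTE->].
case: s' {e us'} cs' => [|y p] /=; first by move=> _ u w; rewrite inE.
by case/andP=> _; rewrite rcons_path => /andP[pp _]; apply: path_linked.
Qed.

(** The only property of block graphs that is used to draw them. *)
Lemma block_graph_cycle (G : sgraph) (s : seq G) : block_graph G -> uniq s ->
  cycle (@sedge G) s -> {in s &, forall u w, u != w -> sedge u w}.
Proof.
case=> _ bl us cs.
have [B mB sB] := maxset_exists (cycle_nonsep us cs).
have /cliqueP cB := bl B mB.
by move=> u w us' ws; apply: cB; apply: (subsetP sB); rewrite inE.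
Qed.

(** * Pendant edges at a block *)

(** The components left when the edges of the root clique are removed from a
    flat graph each contain one root; [pi] maps a vertex to that root. *)
Lemma flat_retract (G : sgraph) t (R S : {set G}) : flat t -> realizes t R S ->
  exists pi : G -> G, [/\ {in S, forall u, pi u \in R}, {in R, forall u, pi u = u} &
    {in S &, forall u w, sedge u w -> pi u = pi w \/ (u \in R /\ w \in R)}].
Proof.
have single (t' : plan) (R' S' : {set G}) : single_root t' -> realizes t' R' S' ->
    exists pi : G -> G, [/\ {in S', forall u, pi u \in R'}, {in R', forall u, pi u = u} &
    {in S' &, forall u w, sedge u w -> pi u = pi w \/ (u \in R' /\ w \in R')}].
  move=> sr /(single_rootP sr)[v ->]; exists (fun=> v); split=> [u _|u /set1P->|u w _ _ _] //.
    exact: set11.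
  by left.
elim: t R S => [|a IHa q IHq|a IHa q IHq] R S; try exact: single.
move=> /andP[sa fq] [R1 [S1 [R2 [S2 [r1 r2 [d g] -> ->]]]]].
have [v ev] := single_rootP sa r1.
have [s1 s2] := (subsetP (realizes_sub r1), subsetP (realizes_sub r2)).
have [pi [pi1 pi2 pi3]] := IHq _ _ fq r2.
have S2S1 x : x \in S2 -> x \in S1 = false.
  by move=> xS; apply/negP=> xS1; move/pred0P/(_ x): d; rewrite /= xS xS1.
exists (fun u => if u \in S1 then v else pi u); split.
- move=> u; rewrite !inE; case: ifP => [_ _|_ /= uS]; first by rewrite ev set11.
  by rewrite pi1 // orbT.
- move=> u; rewrite inE => /orP[uR|uR].
    by rewrite (s1 _ uR); move: uR; rewrite ev => /set1P.
  by rewrite S2S1 ?s2 // pi2.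
move=> u w; rewrite !in_setU => /orP[uS|uS] /orP[wS|wS] e.
- by left; rewrite uS wS.
- by right; move: e; rewrite g // => /andP[-> ->]; rewrite orbT.
- by right; move: e; rewrite sedge_sym g // => /andP[-> ->]; rewrite orbT.
rewrite !S2S1 //; case: (pi3 u w uS wS e) => [->|[-> ->]]; [by left | right].
by rewrite !orbT.
Qed.

Lemma realizes_join_pendant (G : sgraph) (v s : G) q (K W : {set G}) :
  v != s -> sedge v s -> realizes q K W -> glue [set v; s] [set v] W K ->
  realizes (Join pendant q) (v |: K) ([set v; s] :|: W).
Proof.
move=> vs e r g; exists [set v], [set v; s], K, W; split=> //.
exists [set v], [set v], [set s], [set s]; split=> //; [by exists v | by exists s |].
split; first by apply/pred0P=> x /=; rewrite !inE; case: eqP => //= ->; apply: negbTE.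
by move=> x y /set1P-> /set1P->; rewrite !set11 e.
Qed.

Section PendantEdge.
Variables (G : sgraph) (q : plan) (c s : G) (K W : {set G}).
Hypotheses (fq : flat q) (rq : realizes q K W) (g : glue [set c; s] [set c] W K).
Hypotheses (ncs : c != s) (ecs : sedge c s) (cover : [set: G] = [set c; s] :|: W).

Let KW : K \subset W := realizes_sub rq.

Let cW : c \in W = false.
Proof. by apply/negP=> cW; case: g => /pred0P/(_ c)/=; rewrite set21 cW. Qed.

Let sW : s \in W = false.
Proof. by apply/negP=> sW; case: g => /pred0P/(_ s)/=; rewrite set22 sW. Qed.

Let sR : s \in c |: K = false.
Proof.
rewrite !inE eq_sym (negbTE ncs); apply/negP=> /(subsetP KW); by rewrite sW.
Qed.

Let allP x : [\/ x = c, x = s | x \in W].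
Proof.
have := in_setT x; rewrite cover !inE => /orP[/orP[]/eqP->|xW].
- by constructor 1.
- by constructor 2.
by constructor 3.
Qed.

Lemma pendant_leaf x : sedge s x -> x = c.
Proof.
case: (allP x) => [-> //|->|xW]; first by rewrite sedge_irrefl.
by case: g => _ ->; rewrite ?set22 // inE eq_sym (negbTE ncs).
Qed.

Lemma pendant_root x : x \in W -> sedge c x = (x \in K).
Proof. by move=> xW; case: g => _ ->; rewrite ?set21 // set11. Qed.

Lemma pendant_realizes : realizes (Join pendant q) (c |: K) [set: G].
Proof. by rewrite cover; apply: realizes_join_pendant. Qed.

Lemma pendant_connected : connected G.
Proof. exact/setT_connected/(realizes_linked pendant_realizes). Qed.

Lemma pendant_block_clique : clique (c |: K).
Proof. by apply/cliqueP; apply: flat_clique pendant_realizes. Qed.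

Lemma pendant_edge_clique : clique [set c; s].
Proof.
apply/cliqueP=> u w; rewrite !inE => /orP[]/eqP-> /orP[]/eqP->; rewrite ?eqxx // => _.
by rewrite sedge_sym.
Qed.

(** A nonseparable set cannot extend beyond a root of the clique [c |: K] and
    still contain another one, since that root would separate. *)
Lemma pendant_nonsep B : nonseparable B -> c \in B -> B \subset [set c; s] \/ B \subset c |: K.
Proof.
move=> nB cB; have [sB | sB] := boolP (s \in B).
  left; apply/subsetP=> x xB; apply/negPn/negP; rewrite !inE negb_or => /andP[xc xs].
  apply: (nonsep_split (z := c) (X := pred1 s) nB sB xB) => //=; rewrite 1?eq_sym //.
  move=> y y' yB y'B yc y'c /eqP-> y's; apply: contra y'c => /pendant_leaf->; exact: eqxx.
right; apply/subsetP=> x xB; apply/negPn/negP=> xR.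
have xW : x \in W.
  case: (allP x) => // xx; [by rewrite xx setU11 in xR | by rewrite -xx xB in sB].
have [pi [pi1 pi2 pi3]] := flat_retract fq rq.
have kK := pi1 x xW; have kW := subsetP KW _ kK.
have xk : x != pi x by apply: contra xR => /eqP->; rewrite inE kK orbT.
have ck : c != pi x by apply/eqP=> ck; rewrite -ck cW in kW.
apply: (nonsep_split (z := pi x) (X := fun y => (y \in W) && (pi y == pi x)) nB xB cB) => //=.
- by rewrite xW eqxx.
- by rewrite cW.
move=> y y' yB y'B yk y'k /andP[yW /eqP py] y'X; apply/negP=> e.
case: (allP y') y'X e => [->|y's|y'W].
- rewrite sedge_sym pendant_root // => _ yK.
  by rewrite -py pi2 // eqxx in yk.
- by rewrite -y's y'B in sB.
rewrite y'W /= => ny e; case: (pi3 _ _ yW y'W e) => [pp|[yK _]].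
  by rewrite -pp py eqxx in ny.
by rewrite -py pi2 // eqxx in yk.
Qed.

Lemma pendant_edge_block : block [set c; s].
Proof.
apply/maxsetP; split; first exact/clique_nonsep/pendant_edge_clique.
move=> B nB sub; have cB : c \in B by apply: (subsetP sub); rewrite set21.
case: (pendant_nonsep nB cB) => [h|/subsetP/(_ s)]; first by apply/eqP; rewrite eqEsubset h sub.
by rewrite sR (subsetP sub) ?set22 // => /(_ isT).
Qed.

Lemma pendant_big_block : block (c |: K).
Proof.
apply/maxsetP; split; first exact/clique_nonsep/pendant_block_clique.
move=> B nB sub; have cB : c \in B by apply: (subsetP sub); rewrite setU11.
have [k kK] := realizes_root rq; have kB : k \in B by apply: (subsetP sub); rewrite inE kK orbT.
case: (pendant_nonsep nB cB) => [/subsetP/(_ k kB)|h]; last by apply/eqP; rewrite eqEsubset h sub.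
have := subsetP KW _ kK; rewrite !inE => kW /orP[]/eqP e; rewrite e in kW.
  by rewrite cW in kW.
by rewrite sW in kW.
Qed.

Lemma pendant_blocks B : block B -> c \in B -> B = [set c; s] \/ B = c |: K.
Proof.
move=> bB cB; have /maxsetP[nB maxB] := bB.
case: (pendant_nonsep nB cB) => sub; [left | right]; apply/esym/maxB => //.
  exact/clique_nonsep/pendant_edge_clique.
exact/clique_nonsep/pendant_block_clique.
Qed.

Lemma pendant_cutpoint : cutpoint c.
Proof.
have [k kK] := realizes_root rq; have kW := subsetP KW _ kK.
apply/(cutpointP _ pendant_connected); exists s, k; split; first by rewrite eq_sym.
  by apply/eqP=> e; rewrite e cW in kW.
apply/negP=> l.
suff e : k = s by rewrite e sW in kW.
apply: (connect_ind (P := fun x => x = s) l) => // x y -> /and3P[_ yc /pendant_leaf e].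
by rewrite e !inE eqxx in yc.
Qed.

Lemma pendant_not_cutpoint : ~~ cutpoint s.
Proof.
apply/negP=> /(cutpointP _ pendant_connected)[u [w [us ws]]]; apply/negP; rewrite negbK.
have r : realizes (Join Single q) (c |: K) ([set c] :|: W).
  exists [set c], [set c], K, W; split=> //; first by exists c.
  have := glueS (subsetUl [set c] [set s]) (subxx W) g.
  by rewrite (setIidPr KW) setIid.
have -> : [set~ s] = [set c] :|: W.
  apply/setP=> x; rewrite !inE; apply/idP/idP => [xs|/orP[/eqP->//|xW]].
    by case: (allP x) xs => [->|->|->]; rewrite ?eqxx ?orbT.
  by apply/eqP=> e; rewrite e sW in xW.
have mem x : x != s -> x \in [set c] :|: W.
  by move=> xs; case: (allP x) xs => [->|->|xW]; rewrite !inE ?eqxx // xW orbT.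
by apply: (realizes_linked r); apply: mem.
Qed.

Lemma pendant_endblock : endblock [set c; s].
Proof.
rewrite /endblock pendant_edge_block /=.
have -> : [set v in [set c; s] | cutpoint v] = [set c]; last by rewrite cards1.
apply/setP=> x; rewrite !inE; apply/andP/eqP => [[/orP[]/eqP-> // cs]|->].
  by rewrite (negbTE pendant_not_cutpoint) in cs.
by rewrite eqxx pendant_cutpoint.
Qed.

Lemma pendant_two_cutpoint : two_cutpoint c.
Proof.
rewrite /two_cutpoint pendant_cutpoint /=; apply/andP; split; last first.
  by apply/existsP; exists [set c; s]; rewrite pendant_endblock set21.
have -> : [set B : {set G} | block B & c \in B] = [set [set c; s]; c |: K].
  apply/setP=> B; rewrite !inE; apply/andP/orP => [[bB cB]|].
    by case: (pendant_blocks bB cB) => ->; [left | right].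
  case=> /eqP->; first by rewrite pendant_edge_block set21.
  by rewrite pendant_big_block setU11.
rewrite cards2; suff -> : [set c; s] != c |: K by [].
by apply/eqP=> /setP/(_ s); rewrite set22 sR.
Qed.

Lemma pendant_endblock_eq (c' : G) B : c' \in K -> cutpoint c' ->
  endblock B -> c \in B -> B = [set c; s].
Proof.
move=> c'K cc' /andP[bB /cards1P[z ez]] cB; case: (pendant_blocks bB cB) => // eB.
have /set1P cz : c \in [set z] by rewrite -ez inE cB pendant_cutpoint.
have /set1P c'z : c' \in [set z] by rewrite -ez inE eB inE c'K orbT cc'.
by have := subsetP KW _ c'K; rewrite c'z -cz cW.
Qed.

End PendantEdge.

(** * The replacement step *)

(** The spider is built up by the index of its legs. *)
Lemma spider_pendants n :
  exists2 R, realizes (pendants n) R [set: thin_spider n.+1] &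
    forall x : 'I_n.+1 + 'I_n.+1, (x \in R) = if x is inl _ then true else false.
Proof.
pose c i : thin_spider n.+1 := inl i; pose s i : thin_spider n.+1 := inr i.
pose R (j : nat) : {set thin_spider n.+1} :=
  [set x : ('I_n.+1 + 'I_n.+1)%type | if x is inl i then i <= j else false].
pose S (j : nat) : {set thin_spider n.+1} :=
  [set x : ('I_n.+1 + 'I_n.+1)%type | match x with inl i => i <= j | inr i => i <= j end].
suff h j : j <= n -> realizes (pendants j) (R j) (S j).
  exists (R n); last by case=> i; rewrite !inE -1?ltnS ?ltn_ord.
  have -> : [set: thin_spider n.+1] = S n; last exact: h.
  by apply/setP=> -[i|i]; rewrite !inE /= -ltnS ltn_ord.
have pend (k : 'I_n.+1) : realizes pendant [set c k] [set c k; s k].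
  exists [set c k], [set c k], [set s k], [set s k]; split=> //.
  - by exists (c k).
  - by exists (s k).
  split; first by apply/pred0P=> x /=; rewrite !inE; case: eqP => //= ->.
  by move=> x y /set1P-> /set1P->; rewrite !inE !eqxx /sedge /= eqxx.
have ecc (i k : 'I_n.+1) : (inl i == c k) = (i == k) by [].
have ess (i k : 'I_n.+1) : (inr i == s k) = (i == k) by [].
have esc (i k : 'I_n.+1) : (inr i == c k) = false by [].
have ecs (i k : 'I_n.+1) : (inl i == s k) = false by [].
elim: j => [|j IH] jn.
  have -> : R 0 = [set c ord0].
    by apply/setP=> -[i|i]; rewrite !inE ?ecc ?esc // leqn0 -val_eqE.
  have -> : S 0 = [set c ord0; s ord0]; last exact: pend.
  by apply/setP=> -[i|i]; rewrite !inE ?ecc ?ess ?esc ?ecs ?orbF // leqn0 -val_eqE.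
pose k : 'I_n.+1 := Ordinal (jn : j.+1 < n.+1).
have ek (i : 'I_n.+1) : (i <= j.+1) = (i == k) || (i <= j).
  by rewrite leq_eqVlt ltnS -val_eqE.
have lk (i : 'I_n.+1) : i <= j -> (i == k) = false.
  by move=> ij; apply/eqP=> e; rewrite e /= ltnn in ij.
exists [set c k], [set c k; s k], (R j), (S j); split.
- exact: pend.
- exact: IH (ltnW jn).
- split.
    by apply/pred0P=> x /=; rewrite !inE; apply/negP=> /andP[/orP[]/eqP->]; rewrite /= ltnn.
  move=> x y; rewrite !inE => /orP[]/eqP->; case: y => i ij; have ik := lk _ ij;
    by rewrite /sedge /= ?eqxx ?ecc ?esc //= eq_sym ik // ij.
- by apply/setP=> -[i|i]; rewrite !inE ?ecc ?esc /= ?ek.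
by apply/setP=> -[i|i]; rewrite !inE ?ecc ?ess ?esc ?ecs ?orbF /= ?ek.
Qed.

(** The situation in which a replacement step applies: [v1] and [v2] are
    2-cutpoints of a block, and [q] describes the graph without their endblocks,
    rooted at the remaining vertices of the block. *)
Definition two_pendants (G : sgraph) (v1 s1 v2 s2 : G) (q : plan) (K W : {set G}) : Prop :=
  [/\ realizes q K W, glue [set v2; s2] [set v2] W K,
      glue [set v1; s1] [set v1] ([set v2; s2] :|: W) (v2 |: K),
      [/\ v1 != s1, sedge v1 s1, v2 != s2 & sedge v2 s2] &
      [set: G] = [set v1; s1] :|: ([set v2; s2] :|: W)].

Section Step.
Variables (G : sgraph) (v1 s1 v2 s2 : G) (q : plan) (K W : {set G}).
Hypothesis TP : two_pendants v1 s1 v2 s2 q K W.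

Lemma two_pendants_sym : two_pendants v2 s2 v1 s1 q K W.
Proof.
case: TP => r g2 g1 [n1 e1 n2 e2] cov.
have KW := realizes_sub r.
have /glueUr[|//||g12 g1W] := g1; rewrite ?subsetUl //; first by case: g2.
split=> //; last by rewrite setUCA.
by apply/glueUr; rewrite ?subsetUl //; [case: g1W | split=> //; apply: glueC].
Qed.

Let E1 := [set v1; s1].
Let E2 := [set v2; s2].
Let G' := spider_replace v1 v2 E1 E2.

Lemma step_kept : kept v1 v2 E1 E2 = v1 |: W.
Proof.
case: TP => r g2 g1 [n1 e1 n2 e2] cov.
have d1 : [disjoint E1 & E2 :|: W] by case: g1.
have d2 : [disjoint E2 & W] by case: g2.
have o1 x : x \in E1 -> x \in E2 :|: W = false.
  by move=> xE; apply/negP=> xW; move/pred0P/(_ x): d1; rewrite /= xE xW.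
have o2 x : x \in E2 -> x \in W = false.
  by move=> xE; apply/negP=> xW; move/pred0P/(_ x): d2; rewrite /= xE xW.
have [a1 a2] := (o1 v1 (set21 _ _), o1 s1 (set22 _ _)).
have [b1 b2] := (o2 v2 (set21 _ _), o2 s2 (set22 _ _)).
move: a1 a2 b1 b2; rewrite !in_setU !in_set1.
move=> /norP[/norP[/negbTE a1 /negbTE a3] /negbTE a4] /norP[/norP[/negbTE a5 /negbTE a6] /negbTE a7] b1 b2.
have {}n1 := negbTE n1; have {}n2 := negbTE n2.
apply/setP=> x; have := in_setT x; rewrite cov !inE.
case/orP=> [/orP[]/eqP->|/orP[/orP[]/eqP->|xW]].
- by rewrite !eqxx a1 a3 andbF.
- by rewrite !eqxx a5 a6 a7 (eq_sym s1) n1 /= ?orbT ?orbF.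
- by rewrite !eqxx b1 (eq_sym v2) a1.
- by rewrite !eqxx b2 (eq_sym s2 v1) a3 (eq_sym s2 v2) n2 /= ?orbT.
have ne y : (y \in W) = false -> (x == y) = false by move=> yW; apply/eqP=> e; rewrite -e xW in yW.
by rewrite xW (ne v1) // (ne v2) // (ne s1) // (ne s2).
Qed.

(** The contracted vertex carries the two new blocks with four vertices and,
    in place of the block that has lost two vertices, the part [q]. *)
Lemma step_realizes : exists R, realizes (cherry quad quad q) R [set: G'].
Proof.
case: TP => r g2 g1 [n1 e1 n2 e2] cov.
have KW := subsetP (realizes_sub r).
have v1k : v1 \in kept v1 v2 E1 E2 by rewrite step_kept setU11.
have Wk w : w \in W -> w \in kept v1 v2 E1 E2 by rewrite step_kept inE orbC => ->.
pose x0 : {u : G | u \in kept v1 v2 E1 E2} := exist _ v1 v1k.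
pose phi (u : G) : G' := inl (insubd x0 u).
pose qi (b : bool) (a : thin_spider 3) : G' := inr (b, a).
have vphi u : u \in kept v1 v2 E1 E2 -> val (insubd x0 u) = u.
  by move=> uk; rewrite insubdK.
have off x : x \in W -> (x == v1 = false) * (x == v2 = false).
  move=> xW; split; apply/eqP=> e.
    by case: g1 => /pred0P/(_ x)/= + _; rewrite e set21 -e inE xW orbT.
  by case: g2 => /pred0P/(_ x)/= + _; rewrite e set21 -e xW.
have ephi : {in W &, forall u w, sedge (phi u) (phi w) = sedge u w}.
  move=> u w uW wW; rewrite /phi {1}/sedge /= /contract_edge !vphi ?Wk //.
  by rewrite !(off u uW) !(off w wW) /= orbF; case: eqP => // ->; rewrite sedge_irrefl.
have iphi : {in W &, injective phi}.
  move=> u w uW wW [e]; by rewrite -[u]vphi ?Wk // -[w]vphi ?Wk // e.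
have exphi w : w \in W -> sedge (phi v1) (phi w) = (w \in K).
  move=> wW; rewrite /phi {1}/sedge /= /contract_edge (vphi _ v1k) (vphi _ (Wk _ wW)).
  have [_ g1'] := g1; have [_ g2'] := g2.
  have wEW : w \in E2 :|: W by rewrite inE wW orbT.
  rewrite (g1' v1 w) ?set21 // (g2' v2 w) ?set21 // !inE.
  by rewrite !eqxx (eq_sym v1) !(off w wW) /=; case: (w \in K).
have [R3 r3 inR3] := spider_pendants 2.
have eqi b b' a a' : sedge (qi b a) (qi b' a') = (b == b') && sedge a a'.
  by case: a a' => [a|a] [a'|a'].
have rqi b : realizes quad (qi b @: R3) (qi b @: setT).
  apply: (@realizes_imset _ _ (qi b) quad) r3 => [a a' _ _ [] //|a a' _ _].
  by rewrite eqi eqxx.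
have mqi b b' a (A : {set thin_spider 3}) : (qi b a \in qi b' @: A) = (b == b') && (a \in A).
  apply/imsetP/andP => [[a' aA [-> ->]]|[/eqP-> aA]]; [by rewrite eqxx | by exists a].
have mphi b (A : {set thin_spider 3}) u : phi u \in qi b @: A = false by apply/imsetP=> -[].
have mqi' b a (A : {set G}) : qi b a \in phi @: A = false by apply/imsetP=> -[].
have exq b a : sedge (phi v1) (qi b a) = (a \in R3).
  rewrite inR3; case: a => a; rewrite /sedge //=; exact/eqP/vphi.
have gx b : glue [set phi v1] [set phi v1] (qi b @: setT) (qi b @: R3).
  split; first by apply/pred0P=> x /=; rewrite inE; case: eqP => //= ->; rewrite mphi.
  by move=> _ _ /set1P-> /imsetP[a _ ->]; rewrite exq set11 mqi eqxx.
have gqq : glue (qi true @: setT) set0 (qi false @: setT) set0.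
  split; first by apply/pred0P=> x /=; apply/andP=> -[/imsetP[a _ ->]]; rewrite mqi.
  by move=> _ _ /imsetP[a _ ->] /imsetP[a' _ ->]; rewrite eqi inE.
have eqphi b a w : w \in W -> sedge (qi b a) (phi w) = false.
  by move=> wW; case: a => a; rewrite /sedge //= vphi ?Wk // off.
have gqp b : glue (qi b @: setT) set0 (phi @: W) (phi @: K).
  split; first by apply/pred0P=> x /=; apply/andP=> -[/imsetP[a _ ->]]; rewrite mqi'.
  by move=> _ _ /imsetP[a _ ->] /imsetP[w wW ->]; rewrite eqphi // inE.
have gxp : glue [set phi v1] [set phi v1] (phi @: W) (phi @: K).
  split.
    apply/pred0P=> x /=; rewrite inE; case: eqP => //= ->; apply/imsetP=> -[w wW [e]].
    have := off w wW; have := vphi v1 v1k; rewrite e vphi ?Wk // => ->.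
    by rewrite eqxx => -[].
  move=> _ _ /set1P-> /imsetP[w wW ->]; rewrite exphi // set11 /=.
  apply/idP/imsetP => [wK|[w' wK e]]; first by exists w.
  by rewrite (iphi w w' wW (KW _ wK) e).
have d01 : [disjoint [set phi v1] & qi true @: setT] by case: (gx true).
have cov' : [set: G'] = [set phi v1] :|: qi true @: setT :|: qi false @: setT :|: phi @: W.
  apply/setP=> -[[u uk]|[b a]]; rewrite !inE; last first.
    apply/esym; rewrite -[inr (b, a)]/(qi b a) !mqi !inE !andbT; case: b; by rewrite ?orbT.
  have e : inl (exist _ u uk) = phi u.
    by congr inl; apply: val_inj; rewrite /= vphi.
  apply/esym; rewrite e !mphi !orbF; have := uk; rewrite step_kept !inE => /orP[/eqP->|uW].
    by rewrite eqxx.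
  by rewrite imset_f ?orbT.
exists [set phi v1], [set phi v1], ([set phi v1] :|: qi true @: setT :|: qi false @: setT),
  (phi @: K), (phi @: W); split=> //.
- exists [set phi v1], ([set phi v1] :|: qi true @: setT),
    (qi false @: R3), (qi false @: setT); split=> //.
    exists [set phi v1], [set phi v1], (qi true @: R3), (qi true @: setT); split=> //.
    by exists (phi v1).
  by apply/glueHl => //; split; [exact: gx | apply/(glue0 _ _ (qi false @: R3))/gqq].
- exact: (realizes_imset iphi ephi r).
apply/glueHl.
- exact: subsetUl.
- rewrite -setI_eq0 setIUl setU_eq0 !setI_eq0; case: (gx false) => -> _; by case: gqq.
split; last exact: gqp.
by apply/glueHl.
Qed.
End Step.

(** * The family and the obstructions *)

Lemma pendant_joinP (G : sgraph) q (R S : {set G}) : realizes (Join pendant q) R S ->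
  exists c s K W, [/\ realizes q K W, glue [set c; s] [set c] W K,
    c != s /\ sedge c s, R = c |: K & S = [set c; s] :|: W].
Proof.
by case=> [_] [_] [K] [W] [/pendantP[c [s [-> -> n e]]] r g -> ->]; exists c, s, K, W.
Qed.

Lemma two_pendantsP (G : sgraph) q (R : {set G}) :
  realizes (Join pendant (Join pendant q)) R [set: G] ->
  exists (v1 s1 v2 s2 : G) (K W : {set G}), two_pendants v1 s1 v2 s2 q K W.
Proof.
case/pendant_joinP=> v1 [s1 [K1 [W1 [/pendant_joinP[v2 [s2 [K [W [r g2 [n2 e2] -> ->]]]]] g1 [n1 e1] _ cov]]]].
by exists v1, s1, v2, s2, K, W; split.
Qed.

Lemma forced_two_roots (G : sgraph) q (K W : {set G}) : forced q -> realizes q K W ->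
  exists k k', [/\ k \in K, k' \in K & k != k'].
Proof.
move=> fq r; have [q' [c [s [K' [W' [rq g eK]]]]]] : exists q' (c s : G) (K' W' : {set G}),
    [/\ realizes q' K' W', glue [set c; s] [set c] W' K' & K = c |: K'].
  case: fq r => [|a b _ _] /pendant_joinP[c [s [K' [W' [rq g _ eK _]]]]].
    by exists (Join pendant pendant), c, s, K', W'.
  by exists (two_hung a b), c, s, K', W'.
have [k kK] := realizes_root rq; exists c, k; rewrite eK !inE eqxx kK orbT; split=> //.
have := glue_edge g (subsetUl _ _) (realizes_sub rq) (set11 c) kK; by case.
Qed.

Section Members.
Variables (G : sgraph) (v1 s1 v2 s2 : G) (q : plan) (K W : {set G}).
Hypotheses (fq : forced q) (TP : two_pendants v1 s1 v2 s2 q K W).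

Let flat2 : flat (Join pendant q) := forced_flat fq.

Let real2 : realizes (Join pendant q) (v2 |: K) ([set v2; s2] :|: W).
Proof. by case: TP => r g2 _ [_ _ n2 e2] _; apply: realizes_join_pendant. Qed.

Lemma two_pendants_two_cutpoint : two_cutpoint v1.
Proof.
case: TP => _ _ g1 [n1 e1 _ _] cov; exact: (pendant_two_cutpoint flat2 real2 g1 n1 e1 cov).
Qed.

Lemma two_pendants_endblock : endblock [set v1; s1].
Proof.
case: TP => _ _ g1 [n1 e1 _ _] cov; exact: (pendant_endblock flat2 real2 g1 n1 e1 cov).
Qed.

Lemma two_pendants_clique : clique (v1 |: (v2 |: K)).
Proof.
case: TP => _ _ g1 [n1 e1 _ _] cov; exact: (pendant_block_clique flat2 real2 g1 n1 e1 cov).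
Qed.

Lemma two_pendants_neq : v1 != v2 /\ (v1 \notin K) && (v2 \notin K).
Proof.
case: TP => r [d2 _] [d1 _] _ _; have KW := subsetP (realizes_sub r).
have n1 : v1 \notin [set v2; s2] :|: W.
  by apply/negP=> h; move/pred0P/(_ v1): d1; rewrite /= set21 h.
have n2 : v2 \notin W by apply/negP=> h; move/pred0P/(_ v2): d2; rewrite /= set21 h.
split; first by apply: contra n1 => /eqP->; rewrite inE set21.
by apply/andP; split; [apply: contra n1 => /KW h; rewrite inE h orbT | apply: contra n2 => /KW].
Qed.

Lemma two_pendants_endblock_eq B : cutpoint v2 -> endblock B -> v1 \in B -> B = [set v1; s1].
Proof.
move=> c2 eB vB; case: TP => _ _ g1 [n1 e1 _ _] cov.
by apply: (pendant_endblock_eq flat2 real2 g1 n1 e1 cov (setU11 v2 K) c2 eB vB).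
Qed.
End Members.

Lemma two_pendants_family (G : sgraph) (v1 s1 v2 s2 : G) q (K W : {set G}) :
  family_F G -> forced q -> two_pendants v1 s1 v2 s2 q K W ->
  family_F (spider_replace v1 v2 [set v1; s1] [set v2; s2]).
Proof.
move=> fG fq TP; have TP' := two_pendants_sym TP.
have [n12 /andP[n1 n2]] := two_pendants_neq TP.
have [r _ _ _ _] := TP; have [k [k' [kK kK' kk']]] := forced_two_roots fq r.
have ne v x : v \notin K -> x \in K -> v != x by move=> nv xK; apply: contra nv => /eqP->.
apply: (@family_F_step _ (v1 |: (v2 |: [set k; k']))) => //.
- apply/cliqueP=> x y xH yH; apply: (cliqueP _ (two_pendants_clique fq TP)).
    by move: xH; rewrite !inE => /or4P[]/eqP->; rewrite ?eqxx ?kK ?kK' ?orbT.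
  by move: yH; rewrite !inE => /or4P[]/eqP->; rewrite ?eqxx ?kK ?kK' ?orbT.
- by rewrite !cardsU1 cards1 !inE !negb_or n12 kk' !ne.
- by rewrite !inE eqxx.
- by rewrite !inE eqxx orbT.
- exact: two_pendants_two_cutpoint fq TP.
- exact: two_pendants_two_cutpoint fq TP'.
- exact: two_pendants_endblock fq TP.
- by rewrite set21.
- exact: two_pendants_endblock fq TP'.
- by rewrite set21.
Qed.

Definition in_family (t : plan) : Prop :=
  exists F, family_F F /\ exists R : {set F}, realizes t R [set: F].

Lemma in_familyW t t' : in_family t ->
  (forall (G : sgraph) (R S : {set G}), realizes t R S -> exists R', realizes t' R' S) ->
  in_family t'.
Proof. by move=> [F [fF [R r]]] h; exists F; split=> //; apply: h r. Qed.

Lemma in_family_step q : forced q -> in_family (Join pendant (Join pendant q)) ->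
  in_family (cherry quad quad q).
Proof.
move=> fq [F [fF [R /two_pendantsP[v1 [s1 [v2 [s2 [K [W TP]]]]]]]]].
exists (spider_replace v1 v2 [set v1; s1] [set v2; s2]); split; last exact: step_realizes TP.
exact: two_pendants_family fF fq TP.
Qed.

Lemma in_family_spider5 : in_family spider5.
Proof.
exists (thin_spider 5); split; first exact: family_F_base.
by have [R r _] := spider_pendants 4; exists R.
Qed.

Lemma quad_hung_join (G : sgraph) c d (R S : {set G}) :
  realizes (cherry quad c d) R S ->
  exists R', realizes (Join pendant (Join pendant (tri c d))) R' S.
Proof.
move/cherryC/cherryCA/hang_join=> [R' r]; exists R'.
apply: joinWr (joinCA (q := Join pendant pendant) r) => R1 T1 r1.
by apply: joinWr (joinCA (q := pendant) r1) => R2 T2; apply: joinC.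
Qed.

(** One replacement step at the leaf [quad], seen after moving the root to the
    new inner node. *)
Lemma in_family_grow c d : forced c -> forced d -> in_family (cherry quad c d) ->
  in_family (cherry quad quad (tri c d)).
Proof.
move=> fc fd /in_familyW h; apply: in_family_step; first by constructor.
by apply: h => G R S; apply: quad_hung_join.
Qed.

Lemma in_family_swap12 a b c : in_family (cherry a b c) -> in_family (cherry b a c).
Proof. by move/in_familyW; apply=> G R S /cherryC r; exists R. Qed.

Lemma in_family_swap23 a b c : in_family (cherry a b c) -> in_family (cherry a c b).
Proof. by move/in_familyW; apply=> G R S /cherryCA r; exists R. Qed.

Lemma in_family_rot a b c d :
  in_family (cherry a b (tri c d)) -> in_family (cherry c d (tri a b)).
Proof. by move/in_familyW; apply=> G R S; apply: cherry_rot. Qed.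

(** Every tree grows from its leaves: [tri a1 a2] is obtained by replacing a leaf
    by a node with two leaves, which are then replaced by [a1] and [a2]; these
    replacements take place at the new node, where the rest of the tree is
    [tri c d]. *)
Lemma in_family_replace a c d : forced a -> forced c -> forced d ->
  in_family (cherry quad c d) -> in_family (cherry a c d).
Proof.
move=> fa; elim: fa c d => [//|a1 a2 fa IHa fb IHb] c d fc fd h.
have f : forced (tri c d) by constructor.
have h1 := IHa _ _ forced_quad f (in_family_grow fc fd h).
have h2 := IHb _ _ fa f (in_family_swap12 h1).
exact: in_family_swap12 (in_family_swap23 (in_family_rot (in_family_swap12 h2))).
Qed.

Lemma obstruction_in_family t : obstruction t -> in_family t.
Proof.
case=> [|a b c fa fb fc]; first exact: in_family_spider5.
have fq := forced_quad.
have h1 := in_family_replace fa fq fq (in_family_step fq in_family_spider5).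
have h2 := in_family_replace fb fa fq (in_family_swap12 h1).
have h3 := in_family_replace fc fb fa (in_family_swap12 (in_family_swap23 h2)).
exact: in_family_swap23 (in_family_swap12 (in_family_swap23 h3)).
Qed.

Lemma family_realized (G : sgraph) t (R S : {set G}) : obstruction t -> realizes t R S ->
  exists F, family_F F /\ isomorphic (induced S) F.
Proof.
move=> /obstruction_in_family[F [fF [R' r']]] r; exists F; split=> //.
exact: realizes_isomorphic r r'.
Qed.

(** * Locating a replacement step *)

Lemma clique4_degree (G : sgraph) (H : {set G}) v c :
  clique H -> #|H| = 4 -> v \in H -> (forall x, sedge v x -> x = c) -> False.
Proof.
move=> /cliqueP cH H4 vH deg; have : H \subset [set v; c].
  apply/subsetP=> x xH; rewrite !inE; have [//|xv] := eqVneq x v.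
  by rewrite (deg x) ?eqxx //; apply: cH; rewrite // eq_sym.
move/subset_leq_card; rewrite H4 cards2; by case: (v != c).
Qed.

Lemma pull_root (G : sgraph) n (K W : {set G}) v :
  realizes (pendants n.+1) K W -> v \in K ->
  exists s K' W', [/\ realizes (pendants n) K' W', glue [set v; s] [set v] W' K',
    v != s /\ sedge v s, K = v |: K' & W = [set v; s] :|: W'].
Proof.
move=> r vK; have vW := subsetP (realizes_sub r) _ vK.
have [R1 [S1 [R2 [S2 [/pendantP[c [s [eR eS ncs e]]] r2 g eK [eW vS]]]]]] := pendants_pull r vW.
move: vS vK; rewrite eK eS eR !inE => /orP[]/eqP-> h.
  by exists s, R2, S2; rewrite -eS -eR.
have := h; rewrite eq_sym (negbTE ncs) /= => /(subsetP (realizes_sub r2)) sS.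
by case: g => /pred0P/(_ s)/=; rewrite sS eS set22.
Qed.

Lemma pendants_leaf (G : sgraph) n (K W : {set G}) v :
  realizes (pendants n) K W -> v \in W -> v \notin K ->
  exists c, forall x, x \in W -> sedge v x -> x = c.
Proof.
case: n => [|n] r vW vK.
  have [c [s [eR eS ncs e]]] := pendantP r.
  move: vW vK; rewrite eR eS !inE => /orP[]/eqP->; first by rewrite eqxx.
  by move=> _; exists c => x; rewrite !inE => /orP[]/eqP-> //; rewrite sedge_irrefl.
have [R1 [S1 [R2 [S2 [/pendantP[c [s [eR eS ncs e]]] r2 g eK [eW vS]]]]]] := pendants_pull r vW.
move: vS vK; rewrite eK eS eR !inE => /orP[]/eqP->; first by rewrite eqxx.
move=> _; exists c => x; rewrite eW eS !inE -orbA => /or3P[/eqP->//|/eqP->|xS].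
  by rewrite sedge_irrefl.
by case: g => _ ->; rewrite ?eS ?set22 // eR inE eq_sym (negbTE ncs).
Qed.

(** A vertex of a clique of size 4 has degree at least 3, hence is not the end of
    a pendant edge. *)
Lemma locate_pendants (G : sgraph) n (KT T K W H : {set G}) v1 v2 :
  glue T KT W K -> realizes (pendants n.+2) K W -> [set: G] = T :|: W ->
  clique H -> #|H| = 4 -> v1 \in H -> v2 \in H -> v1 != v2 -> v1 \in W -> v2 \in W ->
  exists s1 s2 K' W', [/\ [/\ realizes (pendants n) K' W', glue [set v2; s2] [set v2] W' K' &
      glue [set v1; s1] [set v1] ([set v2; s2] :|: W') (v2 |: K')],
    [/\ v1 != s1, sedge v1 s1, v2 != s2 & sedge v2 s2],
    K = v1 |: (v2 |: K') & W = [set v1; s1] :|: ([set v2; s2] :|: W')].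
Proof.
move=> g r cov cH H4 v1H v2H n12 v1W v2W.
have root v : v \in H -> v \in W -> v \in K.
  move=> vH vW; apply/negPn/negP=> vK; have [c hc] := pendants_leaf r vW vK.
  apply: (clique4_degree cH H4 vH (c := c)) => x; have := in_setT x.
  rewrite cov inE => /orP[xT|]; last exact: hc.
  by case: g => _ g'; rewrite sedge_sym g' // (negbTE vK) andbF.
have [s1 [K1 [W1 [r1 g1 [n1 e1] eK eW]]]] := pull_root r (root _ v1H v1W).
have v2K1 : v2 \in K1.
  by have := root _ v2H v2W; rewrite eK !inE eq_sym (negbTE n12).
have [s2 [K2 [W2 [r2 g2 [n2 e2] eK1 eW1]]]] := pull_root r1 v2K1.
by exists s1, s2, K2, W2; split; [split=> //; rewrite -eW1 -eK1| | rewrite -eK1 | rewrite -eW1].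
Qed.

Definition located (G : sgraph) (v1 v2 : G) : Prop :=
  exists s1 s2 q K W, forced q /\ two_pendants v1 s1 v2 s2 q K W.

Lemma locate_spider5 (G : sgraph) (R H : {set G}) v1 v2 :
  realizes spider5 R [set: G] ->
  clique H -> #|H| = 4 -> v1 \in H -> v2 \in H -> v1 != v2 -> located v1 v2.
Proof.
move=> r cH H4 v1H v2H n12.
have g : glue (set0 : {set G}) set0 [set: G] R.
  by split=> [|u w]; rewrite ?in_set0 // disjoints_subset sub0set.
have [s1 [s2 [K [W [[rK g2 g1] ne _ eW]]]]] := locate_pendants (n := 2) g r
  (esym (set0U _)) cH H4 v1H v2H n12 (in_setT v1) (in_setT v2).
by exists s1, s2, quad, K, W; split; [constructor | split].
Qed.

Lemma locate_quad (G : sgraph) a b (KT T K W H : {set G}) v1 v2 :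
  forced a -> forced b -> realizes (two_hung a b) KT T ->
  glue T KT W K -> realizes quad K W -> [set: G] = T :|: W ->
  clique H -> #|H| = 4 -> v1 \in H -> v2 \in H -> v1 != v2 -> v1 \in W -> v2 \in W ->
  located v1 v2.
Proof.
move=> fa fb rT g r cov cH H4 v1H v2H n12 v1W v2W.
have [s1 [s2 [K' [W' [[rK g2 g1] ne eK eW]]]]] :=
  locate_pendants (n := 0) g r cov cH H4 v1H v2H n12 v1W v2W.
have sT := realizes_sub rT; have sK := realizes_sub rK.
have d2 : [disjoint [set v2; s2] & W'] by case: g2.
have d1 : [disjoint [set v1; s1] & [set v2; s2] :|: W'] by case: g1.
have s2W : v2 |: K' \subset [set v2; s2] :|: W' by rewrite setUSS // subsetUl.
move: g; rewrite eK eW => /glueUr[|//|//|gT1 /glueUr[|//|//|gT2 gT3]]; rewrite ?subsetUl //.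
exists s1, s2, (tri a b), (K' :|: KT), (W' :|: T); split; first by constructor.
have [gT1' gT2' gT3'] := And3 (glueC gT1) (glueC gT2) (glueC gT3).
have d3 : [disjoint W' & T] by case: gT3'.
split=> //.
- by exists K', W', KT, T.
- exact/glueUr.
- rewrite !setUA; apply/glueUr => //.
    by rewrite -setI_eq0 setIUl setU_eq0 !setI_eq0 d3; case: gT2' => ->.
- by rewrite cov eW setUC !setUA.
Qed.

(** A cherry covering the whole graph, with its parts named, so that one can
    follow in which of them the clique lies when the root is moved. *)
Definition cherry_at (G : sgraph) (w : G) a (Ka Wa : {set G}) b (Kb Wb : {set G}) c
    (Kc Wc : {set G}) : Prop :=
  [/\ [/\ realizes a Ka Wa, realizes b Kb Wb & realizes c Kc Wc],
    [/\ glue [set w] [set w] Wa Ka, glue [set w] [set w] Wb Kb & glue [set w] [set w] Wc Kc],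
    [/\ glue Wa set0 Wb set0, glue Wa set0 Wc set0 & glue Wb set0 Wc set0] &
    [set: G] = [set w] :|: (Wa :|: (Wb :|: Wc))].

Lemma cherry_at_rot (G : sgraph) (w : G) a (Ka Wa : {set G}) b (Kb Wb : {set G}) c
    (Kc Wc : {set G}) :
  cherry_at w a Ka Wa b Kb Wb c Kc Wc -> cherry_at w b Kb Wb c Kc Wc a Ka Wa.
Proof.
case=> [[ra rb rc] [ga gb gc] [gab gac gbc] cov]; split=> //.
  by split=> //; apply: glueC.
by rewrite cov [Wa :|: _]setUC -setUA.
Qed.

Lemma cherry_at_off (G : sgraph) (w : G) a (Ka Wa : {set G}) b (Kb Wb : {set G}) c
    (Kc Wc : {set G}) x :
  cherry_at w a Ka Wa b Kb Wb c Kc Wc -> x \in Wa ->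
  [/\ x != w, x \notin Wb & x \notin Wc].
Proof.
case=> _ [[ga _] [gb _] [gc _]] [[gab _] [gac _] _] _ xa; split.
- by apply/eqP=> e; move/pred0P/(_ w): ga; rewrite /= set11 -e xa.
- by apply/negP=> xb; move/pred0P/(_ x): gab; rewrite /= xa xb.
- by apply/negP=> xc; move/pred0P/(_ x): gac; rewrite /= xa xc.
Qed.

Lemma cherry_at_edge (G : sgraph) (w : G) a (Ka Wa : {set G}) b (Kb Wb : {set G}) c
    (Kc Wc : {set G}) x y :
  cherry_at w a Ka Wa b Kb Wb c Kc Wc -> x \in Wa -> sedge x y -> y \in w |: Wa.
Proof.
case=> _ _ [[_ gab] [_ gac] _] cov xa; have := in_setT y.
rewrite cov !inE => /or4P[->|->|yb|yc]; rewrite ?orbT //.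
  by rewrite gab // in_set0.
by rewrite gac // in_set0.
Qed.

Lemma cherry_at_block (G : sgraph) (w : G) a (Ka Wa : {set G}) b (Kb Wb : {set G}) c
    (Kc Wc : {set G}) :
  cherry_at w a Ka Wa b Kb Wb c Kc Wc ->
  exists B k, [/\ block B, w \in B, k \in B, k \in Ka & B \subset w |: Wa].
Proof.
move=> C; have [[ra _ _] [ga _ _] _ _] := C.
have [k kK] := realizes_root ra; have kW := subsetP (realizes_sub ra) _ kK.
have [nwk ewk] := glue_edge ga (subxx _) (realizes_sub ra) (set11 w) kK.
have cl : clique [set w; k].
  apply/cliqueP=> u v; rewrite !inE => /orP[]/eqP-> /orP[]/eqP->; rewrite ?eqxx //.
  by rewrite sedge_sym.
have [B mB sB] := maxset_exists (clique_nonsep cl).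
have [wB kB] : w \in B /\ k \in B by split; apply: (subsetP sB); rewrite !inE eqxx ?orbT.
exists B, k; split=> //; apply/subsetP=> x xB; apply/negPn/negP; rewrite inE negb_or in_set1.
move=> /andP[xw xW]; have nB := maxsetp mB.
apply: (nonsep_split (z := w) (X := fun y => y \in Wa) nB kB xB) => //; first by rewrite eq_sym.
move=> y y' _ _ yw y'w yW y'W; apply/negP=> /(cherry_at_edge C yW).
by rewrite inE in_set1 (negbTE y'w) (negbTE y'W).
Qed.

(** The edges from the root to its three parts lie in different blocks. *)
Lemma cherry_at_not_two (G : sgraph) (w : G) a (Ka Wa : {set G}) b (Kb Wb : {set G}) c
    (Kc Wc : {set G}) :
  cherry_at w a Ka Wa b Kb Wb c Kc Wc -> ~~ two_cutpoint w.
Proof.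
move=> C; have C' := cherry_at_rot C; have C'' := cherry_at_rot C'.
have [A [ka [bA wA kaA kaK sA]]] := cherry_at_block C.
have [B [kb [bB wB kbB kbK sB]]] := cherry_at_block C'.
have [D [kd [bD wD kdD kdK sD]]] := cherry_at_block C''.
have [[ra rb rc] _ _ _] := C.
have kaW := subsetP (realizes_sub ra) _ kaK; have kbW := subsetP (realizes_sub rb) _ kbK.
have [nka nkab nkac] := cherry_at_off C kaW; have [nkb nkbc _] := cherry_at_off C' kbW.
apply/negP=> /and3P[_ /eqP c2 _].
suff : 2 < #|[set B : {set G} | block B & w \in B]| by rewrite c2.
apply/card_gt2P; exists A, B, D; split; first by rewrite !inE bA bB bD wA wB wD.
split; apply/eqP=> e.
- by move: kaA; rewrite e => /(subsetP sB); rewrite !inE (negbTE nka) (negbTE nkab).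
- by move: kbB; rewrite e => /(subsetP sD); rewrite !inE (negbTE nkb) (negbTE nkbc).
- by move: kaA; rewrite -e => /(subsetP sD); rewrite !inE (negbTE nka) (negbTE nkac).
Qed.

Lemma two_hung_intro (G : sgraph) (w : G) a (Ka Wa : {set G}) b (Kb Wb : {set G}) :
  realizes a Ka Wa -> realizes b Kb Wb -> glue [set w] [set w] Wa Ka ->
  glue [set w] [set w] Wb Kb -> glue Wa set0 Wb set0 ->
  realizes (two_hung a b) [set w] ([set w] :|: (Wa :|: Wb)).
Proof.
move=> ra rb ga gb gab; exists [set w], ([set w] :|: Wa), Kb, Wb; split; rewrite ?setUA //.
  by exists [set w], [set w], Ka, Wa; split=> //; exists w.
by apply/glueHl => //; [case: ga | split=> //; apply/(glue0 _ _ Kb)].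
Qed.

Lemma glue0S (G : sgraph) (S T S' T' : {set G}) :
  S' \subset S -> T' \subset T -> glue S set0 T set0 -> glue S' set0 T' set0.
Proof.
move=> /subsetP s /subsetP t [d e]; split; first by apply: disjointW d; apply/subsetP.
by move=> x y /s xS /t yT; apply: e.
Qed.

Lemma glue0Ur (G : sgraph) (S A B : {set G}) :
  glue S set0 A set0 -> glue S set0 B set0 -> glue S set0 (A :|: B) set0.
Proof.
move=> [d1 e1] [d2 e2]; split.
  by rewrite -setI_eq0 setIUr setU_eq0 !setI_eq0 d1 d2.
by move=> x y xS; rewrite inE => /orP[yA|yB]; [apply: e1 | apply: e2].
Qed.

Lemma glue00 (G : sgraph) (S R T R' : {set G}) :
  glue S R T R' -> [disjoint S & R] \/ [disjoint T & R'] -> glue S set0 T set0.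
Proof.
move=> [d e] h; split=> // x y xS yT; rewrite e // in_set0; apply/andP=> -[xR yR].
by case: h => /pred0P h; [have := h x | have := h y]; rewrite /= ?xS ?yT ?xR ?yR.
Qed.

(** The triangle between the roots of a cherry and of its third part belongs
    to both in the same way: the cherry can be read from the other root. *)
Lemma cherry_at_reroot (G : sgraph) (w : G) a (Ka Wa : {set G}) b (Kb Wb : {set G}) a' b'
    (Kc Wc : {set G}) :
  cherry_at w a Ka Wa b Kb Wb (tri a' b') Kc Wc ->
  exists u s w' Ka' Wa' Kb' Wb', [/\ 
    cherry_at w' a' Ka' Wa' b' Kb' Wb' (tri a b) ([set u] :|: [set w])
      ([set u; s] :|: ([set w] :|: (Wa :|: Wb))),
    Wc = [set u; s] :|: ([set w'] :|: (Wa' :|: Wb')) & ~~ sedge s w /\ s != w].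
Proof.
case=> [[ra rb rc] [ga gb gc] [gab gac gbc] cov].
case/pendant_joinP: rc => u [s [K' [T' [/two_hungP[w' [Ka' [Wa' [Kb' [Wb' [ra' rb' [ga' gb' gab'] eK eT]]]]]]]]]].
rewrite {K'}eK {T'}eT => g' [nus eus] eKc eWc; rewrite {}eKc {}eWc in gc gac gbc cov *.
have d' : [disjoint [set u; s] & [set w'] :|: (Wa' :|: Wb')] by case: g'.
have dw' : [disjoint [set w'] & Wa' :|: Wb'].
  by rewrite -setI_eq0 setIUr setU_eq0 !setI_eq0; case: ga' => ->; case: gb' => ->.
have dw : [disjoint [set w] & Wa :|: Wb].
  by rewrite -setI_eq0 setIUr setU_eq0 !setI_eq0; case: ga => ->; case: gb => ->.
have /glueUr[||//|gwu gwT] := gc; rewrite ?subsetUl //.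
have /glueHr[//|//|gww gwab] := gwT.
have /glueHr[//|//|gu' guab] := g'.
have sub (A : {set G}) : A \subset Wa' :|: Wb' -> glue [set w] set0 A set0.
  move=> h; apply: glue0S (glue00 gwab _) => //.
  by right; rewrite disjoint_sym disjoints_subset sub0set.
have sub' (A : {set G}) : A \subset Wa' :|: Wb' -> glue A set0 [set u; s] set0.
  move=> h; apply: glueC; apply: glue0S (glue00 guab _); rewrite //.
  by right; rewrite disjoint_sym disjoints_subset sub0set.
have off (A B : {set G}) : A \subset [set u; s] :|: ([set w'] :|: (Wa' :|: Wb')) ->
    B \subset Wa :|: Wb -> glue A set0 B set0.
  move=> hA hB; apply: glue0S hA hB _.
  by apply: glue0Ur; apply: glueC.
have rt : realizes (two_hung a b) [set w] ([set w] :|: (Wa :|: Wb)).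
  exact: two_hung_intro ra rb ga gb gab.
have gt : glue [set u; s] [set u] ([set w] :|: (Wa :|: Wb)) [set w].
  apply/glueHr => //; split; first exact: glueC.
  apply: glueC; apply/(glue0 _ _ [set u]); apply: glueC; apply: off => //.
  exact: subsetUl.
exists u, s, w', Ka', Wa', Kb', Wb'; split=> //; last first.
  have su : s \notin [set u] by rewrite in_set1 eq_sym.
  have := glue_apart gwu (set11 w) (set22 u s); rewrite su orbT => /(_ isT).
  by rewrite /apart eq_sym sedge_sym => /andP[-> ->].
have sa : Wa' \subset Wa' :|: Wb' by apply: subsetUl.
have sb : Wb' \subset Wa' :|: Wb' by apply: subsetUr.
have sT (A : {set G}) : A \subset [set w'] :|: (Wa' :|: Wb') ->
    A \subset [set u; s] :|: ([set w'] :|: (Wa' :|: Wb')).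
  by move=> h; apply: subset_trans h _; apply: subsetUr.
have sT' (A : {set G}) : A \subset Wa' :|: Wb' -> A \subset [set w'] :|: (Wa' :|: Wb').
  by move=> h; apply: subset_trans h _; apply: subsetUr.
have part (A : {set G}) : A \subset Wa' :|: Wb' ->
    glue A set0 ([set u; s] :|: ([set w] :|: (Wa :|: Wb))) set0.
  move=> h; apply: glue0Ur; first exact: sub'.
  by apply: glue0Ur; [apply: glueC; apply: sub | apply: off => //; apply/sT/sT'].
split.
- by split=> //; apply: realizes_join_pendant.
- split=> //; apply/glueUr; rewrite ?subsetUl //; first by case: gt.
  split; first exact: glueC.
  apply/glueHr => //; split; first exact: glueC.
  by apply: glueC; apply/(glue0 _ _ [set w']); apply: glueC; apply: off => //; apply/sT/subsetUl.
- by split=> //; apply: part.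
by rewrite cov; apply/setP=> x; rewrite !inE; do !case: (x \in _) => //; do !case: eqP => //.
Qed.

(** There are no edges between the parts, so a clique meets at most one. *)
Lemma cherry_at_side (G : sgraph) (w : G) a (Ka Wa : {set G}) b (Kb Wb : {set G}) c
    (Kc Wc H : {set G}) :
  cherry_at w a Ka Wa b Kb Wb c Kc Wc -> clique H ->
  [\/ H \subset w |: Wa, H \subset w |: Wb | H \subset w |: Wc].
Proof.
move=> C /cliqueP cH; have C' := cherry_at_rot C; have C'' := cherry_at_rot C'.
have [Hw | /subsetPn[h hH]] := boolP (H \subset [set w]).
  by constructor 1; apply: subset_trans Hw (subsetUl _ _).
rewrite in_set1 => hw; have [_ _ _ cov] := C.
have side (A : {set G}) : (forall y, sedge h y -> y \in w |: A) -> h \in A -> H \subset w |: A.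
  move=> e hA; apply/subsetP=> x xH; have [-> | xh] := eqVneq x h; first by rewrite inE hA orbT.
  by apply: e; apply: cH; rewrite // eq_sym.
have := in_setT h; rewrite cov !inE (negbTE hw) /= => /or3P[hA|hA|hA].
- by constructor 1; apply: side => // y; apply: cherry_at_edge C hA.
- by constructor 2; apply: side => // y; apply: cherry_at_edge C' hA.
- by constructor 3; apply: side => // y; apply: cherry_at_edge C'' hA.
Qed.

(** If the part that contains the clique is a [tri], moving the root to its
    vertex with the two forced blocks yields a smaller part that contains the
    clique; the triangle and its pendant edge are too small for it. *)
Lemma locate_cherry n (G : sgraph) (w : G) a (Ka Wa : {set G}) b (Kb Wb : {set G}) c
    (Kc Wc H : {set G}) v1 v2 :
  #|Wc| <= n -> forced a -> forced b -> forced c -> cherry_at w a Ka Wa b Kb Wb c Kc Wc ->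
  H \subset w |: Wc -> clique H -> #|H| = 4 -> v1 \in H -> v2 \in H -> v1 != v2 ->
  two_cutpoint v1 -> two_cutpoint v2 -> located v1 v2.
Proof.
elim: n w a Ka Wa b Kb Wb c Kc Wc => [|n IH] w a Ka Wa b Kb Wb c Kc Wc lW fa fb fc C HW cH H4
  v1H v2H n12 t1 t2.
  have [[_ _ rc] _ _ _] := C; have [k kK] := realizes_root rc.
  by move: lW; rewrite leqn0 cards_eq0 => /eqP W0; have := subsetP (realizes_sub rc) _ kK; rewrite W0 in_set0.
case: fc C => [|a' b' fa' fb'] C.
  have [[ra rb rc] [ga gb gc] [gab gac gbc] cov] := C.
  have vW v : v \in H -> two_cutpoint v -> v \in Wc.
    move=> vH tv; have := subsetP HW v vH; rewrite !inE => /orP[/eqP vw|//].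
    by have := cherry_at_not_two C; rewrite -vw tv.
  apply: (locate_quad fa fb (two_hung_intro ra rb ga gb gab) _ rc _ cH H4) => //.
  - apply/glueHl => //.
      by rewrite -setI_eq0 setIUr setU_eq0 !setI_eq0; case: ga => ->; case: gb => ->.
    split=> //; apply/(glue0 _ _ Kc); apply: glueC; apply: glue0Ur; exact: glueC.
  - by rewrite cov -!setUA.
  - exact: vW.
  - exact: vW.
have [u [s [w' [Ka' [Wa' [Kb' [Wb' [C' eW [nsw sw]]]]]]]]] := cherry_at_reroot C.
set X := [set u; s] :|: _ in C'.
have uX : u \in X by rewrite !inE eqxx.
clearbody X.
have ft : forced (tri a b) by constructor.
have C2 := cherry_at_rot C'; have C3 := cherry_at_rot C2.
have uW : u \in Wc by rewrite eW !inE eqxx.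
have small (A : {set G}) : A \subset Wc -> u \notin A -> #|A| <= n.
  move=> sA uA; rewrite -ltnS; apply: leq_trans lW; apply: proper_card.
  by apply/properP; split=> //; exists u.
have offa x : x \in Wa' -> x != w' /\ x \notin X by move=> h; have [? ? ?] := cherry_at_off C' h.
have offb x : x \in Wb' -> x != w' /\ x \notin X by move=> h; have [? ? ?] := cherry_at_off C2 h.
have [Ha | Hb | HX] := cherry_at_side C' cH.
- apply: (IH _ _ _ _ _ _ _ _ _ _ _ fb' ft fa' C2 Ha cH H4) => //.
  apply: small; first by rewrite eW; apply/subsetP=> x xA; rewrite !inE xA !orbT.
  by apply: contraL uX => /offa[].
- apply: (IH _ _ _ _ _ _ _ _ _ _ _ ft fa' fb' C3 Hb cH H4) => //.
  apply: small; first by rewrite eW; apply/subsetP=> x xA; rewrite !inE xA !orbT.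
  by apply: contraL uX => /offb[].
have : H \subset [set w; u; s; w'].
  apply/subsetP=> x xH; have := subsetP HW x xH; have := subsetP HX x xH.
  rewrite [x \in _ |: X]inE in_set1 eW [x \in _ |: _]inE !in_setU !in_set1.
  move=> hX /or3P[->//|/orP[]->|/or3P[->|xa|xb]]; rewrite ?orbT //.
    by have [xw xX] := offa x xa; rewrite (negbTE xw) (negbTE xX) in hX.
  by have [xw xX] := offb x xb; rewrite (negbTE xw) (negbTE xX) in hX.
have card4 : #|[set w; u; s; w']| <= #|H|.
  have le (A : {set G}) x : #|A :|: [set x]| <= #|A|.+1.
    by rewrite setUC cardsU1 -add1n leq_add2r leq_b1.
  rewrite H4; do 3!apply: leq_trans (le _ _) _; by rewrite cards1.
move=> sH; have /eqP eH : H == [set w; u; s; w'] by rewrite eqEcard sH card4.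
have [sIn wIn] : s \in H /\ w \in H by rewrite eH !inE !eqxx !orbT.
by case/negP: nsw; apply: (cliqueP _ cH).
Qed.

(** Clique and cutpoints of a step are those of a [quad], or of the spider, and
    the endblocks are the pendant edges at these cutpoints; the step is then the
    one of [step_realizes]. *)
Lemma family_obstruction (F : sgraph) : family_F F ->
  exists t R, obstruction t /\ realizes t R [set: F].
Proof.
elim=> [|G H v1 v2 B1 B2 _ [t [R [ob r]]] cH H4 v1H v2H n12 t1 t2 e1 v1B e2 v2B].
  by have [R r _] := spider_pendants 4; exists spider5, R; split=> //; constructor.
have [s1 [s2 [q [K [W [fq TP]]]]]] : located v1 v2.
  case: ob r => [|a b c fa fb fc] r; first exact: locate_spider5 r cH H4 v1H v2H n12.
  have [w [Ka [Wa [Kb [Wb [Kc [Wc [h1 h2 h3 _ h4]]]]]]]] := cherryP r.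
  have C : cherry_at w a Ka Wa b Kb Wb c Kc Wc by [].
  have C2 := cherry_at_rot C; have C3 := cherry_at_rot C2.
  have [Ha|Hb|Hc] := cherry_at_side C cH.
  - exact: locate_cherry (leqnn _) fb fc fa C2 Ha cH H4 v1H v2H n12 t1 t2.
  - exact: locate_cherry (leqnn _) fc fa fb C3 Hb cH H4 v1H v2H n12 t1 t2.
  - exact: locate_cherry (leqnn _) fa fb fc C Hc cH H4 v1H v2H n12 t1 t2.
have [/and3P[c1 _ _] /and3P[c2 _ _]] := (t1, t2).
rewrite (two_pendants_endblock_eq fq TP c2 e1 v1B).
rewrite (two_pendants_endblock_eq fq (two_pendants_sym TP) c1 e2 v2B).
have [R' r'] := step_realizes TP; exists (cherry quad quad q), R'; split=> //.
by constructor=> //; constructor.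
Qed.

(** * The characterization *)

Lemma isomorphic_realizes (G F : sgraph) (S : {set G}) t (R : {set F}) :
  isomorphic (induced S) F -> realizes t R [set: F] ->
  exists (R' S' : {set G}), realizes t R' S'.
Proof.
case=> f [h fK hK] ef r; pose g (x : F) : G := val (h x).
exists (g @: R), (g @: setT); apply: realizes_imset r.
  by move=> x y _ _ /val_inj/(can_inj hK).
by move=> x y _ _; rewrite -{2}[x]hK -{2}[y]hK ef.
Qed.

Theorem theorem12 :
  (forall G : sgraph, block_graph G -> VPG G -> (B0_VPG G <-> F_free G)) /\
  (forall F : sgraph, family_F F ->
     ~ B0_VPG F /\
     (forall S : {set F}, S \proper [set: F] -> B0_VPG (induced S))).
Proof.
split=> [G bG _ | F /family_obstruction[t [R [ob r]]]]; last first.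
  split=> [/B0_rep[f rf] | S /properP[_ [x _ xS]]]; first exact: obstruction_norep ob r rf.
  have rx := obstruction_del ob r (in_setT x).
  apply: (@rep_B0 F (induced S) _ val val_inj _ _ rx) => // y; rewrite !inE andbT.
  by apply: contraNneq xS => <-; apply: valP.
split=> [/B0_rep[f rf] F S /family_obstruction[t [R [ob r]]] iso | free].
  have [R' [S' r']] := isomorphic_realizes iso r.
  exact: obstruction_norep ob r' (rep_sub (subsetT S') rf).
have noobs t (R S : {set G}) : obstruction t -> ~ realizes t R S.
  by move=> ob /(family_realized ob)[F [fF]]; apply: free.
have cyc s := @block_graph_cycle G s bG.
apply: (rep_B0 (f := id) _ _ _ (noobs_rep noobs cyc _)) => //.
by apply: connected_setT; case: bG.
Qed.
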